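(* Let $H=\sum_Z H_Z$ be a Hamiltonian on a lattice $\Lambda\subset\mathbb{R}^d$, $d\ge1$, satisfying the standing assumptions of the context, with $J>0$ and decay exponent $\alpha>d$ (arbitrary multi-body interactions). Fix a finite nonempty $X\subseteq\Lambda$. For each $\sigma$ with $\frac{d+1}{\alpha+1}<\sigma<1$ there are constants $v>0$ and $K>0$ (depending on $\sigma$, the lattice, $H$ and $X$, but not on $Y,A,B,t$) such that, with $$\mathcal{C}_\sigma(r,t)=2|X|e^{vt-r^{1-\sigma}}+K\,\frac{vt+(vt)^{1+d/(1-\sigma)}}{r^{\sigma\alpha}},$$ one has $\|[\tau_t^H(A),B]\|\le \|A\|\|B\|\,\mathcal{C}_\sigma(r,t)$ for all $t\ge0$, all nonempty $Y\subseteq\Lambda$ with $r=d(X,Y)>0$, and all observables $A$, $B$ supported on $X$, $Y$ respectively. Let $\beta^{\mathrm{LC2}}(\sigma)$ be the infimum of the $\gamma>0$ such that $$\lim_{t\to\infty}\ t\int_{t^\gamma}^\infty r^{d-1}\,\mathcal{C}_\sigma(r,t)\,dr=0 ,$$ and let $\beta^{\mathrm{LC2}}=\inf_{\frac{d+1}{\alpha+1}<\sigma<1}\beta^{\mathrm{LC2}}(\sigma)$. Then $\beta^{\mathrm{LC2}}$ is finite for every $\alpha>d$ (that is, a power-law light-cone LC2 exists for all $\alpha>d$), and, with $$\alpha_M=\frac{3d}{2}\left(1+\sqrt{1+\frac{8}{9d}}\right),$$ it is given by $$\beta^{\mathrm{LC2}}=\begin{cases}\dfrac{2}{(\alpha-d)^2}\left\{\alpha-d+d\alpha\left[1+\sqrt{1+\dfrac{2}{d}-\dfrac{2}{\alpha}}\,\right]\right\},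 & d<\alpha<\alpha_M,\\[2ex] \dfrac{\alpha+2}{\alpha-2d}, & \alpha\ge\alpha_M .\end{cases}$$
   Context: **Lattice.** $\Lambda$ is a set of sites with a metric $d(x,y)$. It is embedded in Euclidean space $\mathbb{R}^d$: each $z\in\Lambda$ has a position $\mathbf{r}_z\in\mathbb{R}^d$ with $d(x,y)=|\mathbf{r}_x-\mathbf{r}_y|$. The smallest separation is normalized to $1$: $d(x,y)\ge 1$ for all distinct $x,y\in\Lambda$. For $X,Y\subseteq\Lambda$, $d(X,Y)$ is the minimum distance between an element of $X$ and an element of $Y$; $\mathrm{diam}(Z)=\sup_{x,y\in Z}d(x,y)$; $|X|$ is the number of sites of $X$. (The letter $d$ denotes both the dimension and the metric.) **Spin system.** Each site carries a finite-dimensional Hilbert space. An observable supported on $X$ is an operator acting nontrivially only on the sites of $X$; $\|\cdot\|$ is the operator norm. The Hamiltonian is $H=\sum_{Z\subseteq\Lambda}H_Z$ with $H_Z$ self-adjoint and supported on $Z$ (no restriction on the number of sites in $Z$). The Heisenberg evolution is $\tau_t^H(O)=e^{itH}Oe^{-itH}$ (if $\Lambda$ is infinite, understood as the usual infinite-volume limit of the dynamics). **Standing assumptions on $H$.** Let $f(R):=\sup_{z\in\Lambda}\sum_{Z\ni z:\ \mathrm{diam}(Z)\ge R}\|H_Z\|$. There are constants $J$ and $\alpha>d$ such that $f(R)\le J R^{-\alpha}$ for all $R>0$. Moreover $\mathcal{C}_0:=\sup_{x\in\Lambda}\sum_{y\in\Lambda}\sum_{Z\ni x,y}\|H_Z\|<\infty$.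 **Light-cone LC2.** Given a Lieb-Robinson bound $\|[\tau_t^H(A),B]\|\le\|A\|\|B\|\,\mathcal{C}(r,t)$ for operators at distance $r$, a relation $r=g(t)$ is a light-cone 2 (LC2) for this bound if $\lim_{t\to\infty} t\int_{g(t)}^\infty r^{d-1}\mathcal{C}(r,t)\,dr=0$. It is a power-law LC2 if $g(t)=t^\gamma$. *)

(* Defs.v *)
From HB Require Import structures.
From mathcomp Require Import all_boot all_order all_algebra.
From mathcomp Require Import finmap.
From mathcomp Require Import complex.
From mathcomp Require Import all_classical all_reals all_analysis.

Set Implicit Arguments.
Unset Strict Implicit.
Unset Printing Implicit Defensive.

Import Order.TTheory GRing.Theory Num.Theory.
Import numFieldNormedType.Exports.

Local Open Scope classical_set_scope.
Local Open Scope ring_scope.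
Local Open Scope complex_scope.

Section Lattice.
Context {R : realType} {d : nat} {L : choiceType}.
Variable pos : L -> 'rV[R]_d.
Implicit Types (x y : L).

(* The library norm on 'rV[R]_d is the sup norm, hence the explicit formula. *)
Definition dist x y : R :=
  Num.sqrt (\sum_(i < d) (pos x 0 i - pos y 0 i) ^+ 2).

(* The infimum is a minimum when X and Y are nonempty and X is finite, since
   the sites are at mutual distance at least 1. *)
Definition setdist (X Y : set L) : R := inf [set dist x y | x in X & y in Y].

Definition diam (Z : set L) : \bar R :=
  ereal_sup [set (dist x y)%:E | x in Z & y in Z].

End Lattice.

Section SpinSystem.
Context {R : realType} {L : choiceType}.

(* The Hilbert space of the site x is C^(q x + 1), with its canonical basis
   indexed by the ordinals below q x + 1. *)
Variable q : L -> nat.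

Local Notation C := R[i].

(* Product basis states of the whole lattice, and of a finite region Z. *)
Definition conf : Type := forall x : L, 'I_(q x).+1.

Definition lconf (Z : {fset L}) : finType :=
  {dffun forall x : Z, 'I_(q (val x)).+1}.

Definition restr_conf (Z : {fset L}) (s : conf) : lconf Z :=
  finfun (fun x : Z => s (val x)).

Definition patch_conf (Z : {fset L}) (c : lconf Z) (s : conf) : conf :=
  fun x => match @idP (x \in Z) with
           | ReflectT xZ => c [` xZ]%fset
           | ReflectF _ => s x
           end.

(* Operators act on the Hilbert space l^2(conf).  For a finite lattice this is
   the tensor product of the local spaces; for an infinite one it carries a
   faithful representation of the quasi-local algebra, so that norms computed
   in it are the norms of that algebra.  An operator is encoded as a map on all
   functions conf -> C, but only its values on l^2(conf) are relevant. *)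
Definition state : Type := conf -> C.
Definition operator : Type := state -> state.

Definition l2norm (psi : state) : \bar R :=
  sqrte (\esum_(s in [set: conf]) (Normc.normc (psi s) ^+ 2)%:E).

(* The bound is required on all of l^2(conf), not on the unit ball only, because
   the type operator does not enforce linearity: this way, a limit of linear
   operators for opnorm is automatically linear on l^2(conf). *)
Definition opnorm (T : operator) : \bar R :=
  ereal_inf [set M%:E | M in [set M : R | 0 <= M /\
    forall psi, (l2norm psi < +oo -> l2norm (T psi) <= M%:E * l2norm psi)%E]].

Definition opsub (T U : operator) : operator := fun psi s => T psi s - U psi s.

Definition commutator (T U : operator) : operator :=
  opsub (T \o U) (U \o T).

(* a (x) 1, where the matrix a acts on the tensor product of the spaces of the
   sites of Z and 1 is the identity on all the other sites. *)
Definition amplify (Z : {fset L}) (a : 'M[C]_#|lconf Z|) : operator :=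
  fun psi s => \sum_(c : lconf Z)
    a (enum_rank (restr_conf Z s)) (enum_rank c) * psi (patch_conf c s).

Definition local_on (Z : {fset L}) (T : operator) : Prop :=
  exists a : 'M[C]_#|lconf Z|, T = amplify a.

(* Observables of a possibly infinite region Y: norm limits of observables
   of finite subregions.  On l^2(conf), this is the same as local_on Y when Y
   is finite. *)
Definition supported_on (Y : set L) (T : operator) : Prop :=
  forall e : R, 0 < e -> exists (Z : {fset L}) (U : operator),
    [/\ [set` Z] `<=` Y, local_on Z U & (opnorm (opsub T U) <= e%:E)%E].

(* The terms H_Z of a Hamiltonian.  Only finite Z are needed: an infinite Z
   has infinite diameter, so that a bound f(R) <= J R^(-alpha) for all R > 0
   forces H_Z = 0. *)
Definition interaction : Type := forall Z : {fset L}, 'M[C]_#|lconf Z|.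

Variable H : interaction.

Definition hnorm (Z : {fset L}) : \bar R := opnorm (amplify (H Z)).

Definition hamiltonian (V : {fset L}) : operator :=
  fun psi s => \sum_(Z <- fpowerset V) amplify (H Z) psi s.

Definition clim (u : nat -> C) : C :=
  limn (fun n => complex.Re (u n)) +i* limn (fun n => complex.Im (u n)).

(* The exponential series is summed pointwise, which makes sense because
   T will be an operator acting on finitely many sites. *)
Definition opexp (T : operator) : operator :=
  fun psi s => clim (fun n => \sum_(k < n) (k`!%:R)^-1 * iter k T psi s).

Definition propagator (V : {fset L}) (t : R) : operator :=
  opexp (fun psi s => (0 +i* t) * hamiltonian V psi s).

Definition heisenberg_fin (V : {fset L}) (t : R) (A : operator) : operator :=
  propagator V t \o A \o propagator V (- t).

(* T = tau_t^H(A): norm limit along the finite regions V ordered by inclusion.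
   For a finite lattice the limit is the value at V = the whole lattice. *)
Definition is_heisenberg (t : R) (A T : operator) : Prop :=
  forall e : R, 0 < e -> exists V0 : {fset L}, forall V : {fset L},
    (V0 `<=` V)%fset -> (opnorm (opsub (heisenberg_fin V t A) T) <= e%:E)%E.

Definition total_coupling : \bar R :=
  ereal_sup [set \esum_(y in [set: L])
                   \esum_(Z in [set Z : {fset L} | x \in Z /\ y \in Z]) hnorm Z
            | x in [set: L]].

Section Metric.
Context {d : nat}.
Variable pos : L -> 'rV[R]_d.

Definition tail_coupling (r : R) : \bar R :=
  ereal_sup [set \esum_(Z in [set Z : {fset L} |
                        z \in Z /\ (r%:E <= diam pos [set` Z])%E]) hnorm Z
            | z in [set: L]].

Definition lieb_robinson (X : {fset L}) (C : R -> R -> R) : Prop :=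
  forall (t : R) (Y : set L) (A B T : operator),
    0 <= t -> Y !=set0 -> 0 < setdist pos [set` X] Y ->
    local_on X A -> supported_on Y B -> is_heisenberg t A T ->
    (opnorm (commutator T B)
       <= opnorm A * opnorm B * (C (setdist pos [set` X] Y) t)%:E)%E.

End Metric.
End SpinSystem.

Arguments interaction R {L} q.

Section LightCone.
Context {R : realType}.
Variable d : nat.

(* n is the number |X| of sites of X. *)
Definition lr_function (n : nat) (alpha sigma v K r t : R) : R :=
  2 * n%:R * expR (v * t - r `^ (1 - sigma)) +
  K * ((v * t + (v * t) `^ (1 + d%:R / (1 - sigma))) / r `^ (sigma * alpha)).

Definition is_LC2 (C : R -> R -> R) (g : R -> R) : Prop :=
  (t%:E * \int[lebesgue_measure]_(r in `]g t, +oo[) (r ^+ d.-1 * C r t)%:E)%E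
    @[t --> +oo] --> 0%E.

Definition beta_LC2_of (C : R -> R -> R) : \bar R :=
  ereal_inf [set gamma%:E | gamma in
               [set gamma : R | 0 < gamma /\ is_LC2 C (fun t => t `^ gamma)]].

Definition sigma_range (alpha : R) : set R :=
  [set sigma | (d%:R + 1) / (alpha + 1) < sigma < 1].

Definition beta_LC2 (alpha : R) (C : R -> R -> R -> R) : \bar R :=
  ereal_inf [set beta_LC2_of (C sigma) | sigma in sigma_range alpha].

Definition alpha_M : R := 3 * d%:R / 2 * (1 + Num.sqrt (1 + 8 / (9 * d%:R))).

Definition beta_formula (alpha : R) : R :=
  if alpha < alpha_M then
    2 / (alpha - d%:R) ^+ 2 *
      (alpha - d%:R +
       d%:R * alpha * (1 + Num.sqrt (1 + 2 / d%:R - 2 / alpha)))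
  else (alpha + 2) / (alpha - 2 * d%:R).

End LightCone.

(* Main.v *)
(** The dynamics of a finite volume [V] is handled with matrices, identified
    with operators on [l^2(conf)] by [amplify].  If the Hamiltonian has range
    [R], the commutator of [b] with an evolved observable grows, up to a unitary
    conjugation, only through the terms that meet the region of [b]; a discrete
    Gronwall argument with weights [exp (- d(x, Y) / R)] gives the bound
    [2 |X| exp (v t - r / R)], uniformly in [V].

    For the full Hamiltonian, put [R = rho ^ sigma] at distance [rho].  Duhamel's
    formula bounds the cost of the terms of diameter at least [R] by
    [t J R^(-alpha)] times the sum over the sites [z] of the growth of the
    evolved observable at [z].  The short-range bound inserted in that sum yields
    an inequality [M <= C + M / 2] for the best constant [M] in
    [sum <= M max(1, w t)^(d / (1 - sigma))], hence an a priori bound on the sum,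
    and, inserting it once more, the announced [C_sigma], uniformly in [V].
    The same a priori bound shows that the finite-volume dynamics are Cauchy.

    For the light cone, [r = t^gamma] is an LC2 for [C_sigma] when [gamma]
    exceeds both [1 / u] and [(2 + d / u) / (sigma alpha - d)], [u = 1 - sigma],
    and only when it is at least both.  The second function of [u] is minimal at
    [u* = (alpha - d) / (alpha (s + 1))], [s = sqrt (1 + 2 / d - 2 / alpha)];
    it dominates [1 / u] there iff [alpha <= alpha_M], and otherwise the optimum
    is where the two functions cross, at [u = (alpha - 2 d) / (alpha + 2)]. *)

Require Import Defs.
From HB Require Import structures.
From mathcomp Require Import all_boot all_order all_algebra.
From mathcomp Require Import finmap.
From mathcomp Require Import complex.
From mathcomp Require Import ring lra.
From mathcomp Require Import all_classical all_reals all_analysis.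
From mathcomp Require Import measurable_realfun.

Set Implicit Arguments.
Unset Strict Implicit.
Unset Printing Implicit Defensive.

Import Order.TTheory GRing.Theory Num.Theory.
Import numFieldNormedType.Exports.

Local Open Scope classical_set_scope.
Local Open Scope ring_scope.
Local Open Scope complex_scope.

(** * Norms of operators *)

(** The condition on [sigma] amounts to [d + (1 - sigma) < sigma * alpha], and this closes the
    estimate. Duhamel's formula loses a factor [t]; the sum of the distances to the power
    [- sigma * alpha] over the sites beyond the short-range cone, of radius
    [(w t) ^ (1 / (1 - sigma))], decays faster than [1 / (w t)]. The loss is thus compensated, and a
    large [w] brings the coefficient of [M] down to [1/2]. That some finite [M] exists comes from
    the finite volume: the starting value is proportional to [|V|], and iteration halves it away, so
    nothing depends on [V] in the end.

    A term on many sites enters a commutator as a whole. It is charged to its site closest to [X],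
    which is why the growth at a site is a supremum over observables supported at least as far from
    [X].

    No derivative or integral of matrix-valued functions occurs: evolutions are cut into short steps
    with second-order Taylor errors, and the number of steps tends to infinity. Operators of the
    infinite system are maps that need not be linear, so in the limit a composition is distributed
    over a difference only behind local operators. *)

Section ComplexModulus.
Context {R : realType}.
Local Notation C := R[i].
Implicit Types z w : C.

Lemma normc_ge0 z : 0 <= Normc.normc z.
Proof. by case: z => a b; exact: sqrtr_ge0. Qed.

Lemma normc_real (x : R) : Normc.normc x%:C = `|x|.
Proof. by rewrite /Normc.normc /= expr0n addr0 sqrtr_sqr. Qed.

Lemma normc_imag (x : R) : Normc.normc (0 +i* x) = `|x|.
Proof. by rewrite /Normc.normc /= expr0n add0r sqrtr_sqr. Qed.

Lemma normc_abs z : (Normc.normc z)%:C = `|z|.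
Proof. by []. Qed.

Lemma ler_normc_sum (I : Type) (r : seq I) (P : pred I) (F : I -> C) :
  Normc.normc (\sum_(i <- r | P i) F i) <= \sum_(i <- r | P i) Normc.normc (F i).
Proof.
elim/big_rec2 : _ => [|i y x _ yx]; first by rewrite Normc.normc0.
by rewrite (le_trans (le_normcD _ _))// lerD2l.
Qed.

(* Young's form of the triangle inequality: it replaces Minkowski's inequality
   in [l^2(conf)], since it can be summed term by term. *)
Lemma normcD_young (e : R) z w : 0 < e ->
  Normc.normc (z + w) ^+ 2 <=
  (1 + e) * Normc.normc z ^+ 2 + (1 + e^-1) * Normc.normc w ^+ 2.
Proof.
move=> e0; have := le_normcD z w.
move: (normc_ge0 (z + w)) (normc_ge0 z) (normc_ge0 w).
move: (Normc.normc (z + w)) (Normc.normc z) (Normc.normc w) => c a b c0 a0 b0 cab.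
apply: (@le_trans _ _ ((a + b) ^+ 2)); first by rewrite ler_pXn2r ?nnegrE ?addr_ge0.
have : 0 <= (e * a - b) ^+ 2 / e by rewrite divr_ge0 ?sqr_ge0 ?ltW.
move=> h; rewrite -subr_ge0.
have -> : (1 + e) * a ^+ 2 + (1 + e^-1) * b ^+ 2 - (a + b) ^+ 2 =
          (e * a - b) ^+ 2 / e by field; rewrite gt_eqF.
exact: h.
Qed.

End ComplexModulus.

Lemma esumZ (R : realType) (I : choiceType) (A : set I) (c : R) (a : I -> \bar R) :
  0 <= c -> (forall i, A i -> 0 <= a i)%E ->
  (\esum_(i in A) (c%:E * a i) = c%:E * \esum_(i in A) a i)%E.
Proof.
move=> c0 a0; rewrite /esum -ereal_supZl//; last first.
  by apply/set0P; exists 0%E; exists set0; [exact: fsets_set0|rewrite fsbig_set0].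
have E F : fsets A F -> (\sum_(i \in F) (c%:E * a i) = c%:E * \sum_(i \in F) a i)%E.
  move=> [finF FA]; rewrite !fsbig_finite//= big_seq [in RHS]big_seq ge0_sume_distrr//.
  by move=> i; rewrite in_fset_set// inE => /FA; exact: a0.
congr ereal_sup; apply/seteqP; split=> [_ [F AF <-]|_ [_ [F AF <-] <-]].
  by rewrite E//; exists (\sum_(i \in F) a i)%E => //; exists F.
by exists F => //; rewrite E.
Qed.

Section OperatorNorm.
Context {R : realType} {L : choiceType} {q : L -> nat}.
Local Notation C := R[i].
Local Notation state := (@state R L q).
Local Notation operator := (@operator R L q).
Implicit Types (T U : operator) (psi : state).

Definition l2sq psi : \bar R :=
  (\esum_(s in [set: conf q]) (Normc.normc (psi s) ^+ 2)%:E)%E.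

Lemma l2sq_ge0 psi : (0 <= l2sq psi)%E.
Proof. by apply: esum_ge0 => s _; rewrite lee_fin sqr_ge0. Qed.

Lemma l2norm_lty psi : (l2norm psi < +oo)%E = (l2sq psi < +oo)%E.
Proof.
rewrite /l2norm -/(l2sq psi) -!ge0_fin_numE ?sqrte_ge0 ?l2sq_ge0//.
by rewrite sqrte_fin_num// l2sq_ge0.
Qed.

(** Squares keep the bound linear in [l2sq psi], so that it can be checked by termwise comparison of
    sums; for [0 <= M] it means [opnorm T <= M]. *)
Definition bounded_by T (M : R) : Prop :=
  forall psi, (l2sq psi < +oo)%E -> (l2sq (T psi) <= (M ^+ 2)%:E * l2sq psi)%E.

Lemma bounded_byE T M : 0 <= M -> bounded_by T M <->
  forall psi, (l2norm psi < +oo -> l2norm (T psi) <= M%:E * l2norm psi)%E.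
Proof.
move=> M0; have E psi : (l2norm (T psi) <= M%:E * l2norm psi)%E =
    (l2sq (T psi) <= (M ^+ 2)%:E * l2sq psi)%E.
  rewrite /l2norm -!/(l2sq _) (_ : M%:E = sqrte (M ^+ 2)%:E); last first.
    by rewrite /= sqrtr_sqr ger0_norm.
  by rewrite -sqrteM ?lee_fin ?sqr_ge0// lee_sqrt// mule_ge0 ?lee_fin ?sqr_ge0 ?l2sq_ge0.
by split=> h psi; rewrite ?l2norm_lty ?E -?l2norm_lty -?E; [rewrite l2norm_lty E; exact: h | exact: h].
Qed.

Lemma bounded_byW T M M' : 0 <= M <= M' -> bounded_by T M -> bounded_by T M'.
Proof.
move=> /andP[M0 MM'] h psi psioo; apply: (le_trans (h _ psioo)).
rewrite lee_wpmul2r ?l2sq_ge0// lee_fin ler_pXn2r ?nnegrE//.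
exact: le_trans MM'.
Qed.

Lemma opnorm_ge0 T : (0 <= opnorm T)%E.
Proof. by apply: le_ereal_inf_tmp => _ [M [M0 _] <-]; rewrite lee_fin. Qed.

(** The infimum in [opnorm] is attained: for a fixed [psi] of finite norm, the bounds with the
    constants [M + e] pass to the limit. *)
Lemma opnorm_le T M : 0 <= M -> (opnorm T <= M%:E)%E <-> bounded_by T M.
Proof.
move=> M0; split; last first.
  move=> h; apply: ereal_inf_lbound; exists M => //; split => //.
  exact/bounded_byE.
move=> h psi psioo.
have psif : l2sq psi \is a fin_num by rewrite ge0_fin_numE ?l2sq_ge0.
set m := fine (l2sq psi).
have psiE : l2sq psi = m%:E by rewrite fineK.
have m0 : 0 <= m by rewrite fine_ge0// l2sq_ge0.
have H e : 0 < e -> (l2sq (T psi) <= ((M + e) ^+ 2 * m)%:E)%E.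
  move=> e0.
  have /ereal_inf_lt : (opnorm T < (M + e)%:E)%E.
    by rewrite (le_lt_trans h)// lte_fin ltrDl.
  move=> [_ [M' [M'0 hM'] <-]]; rewrite lte_fin => M'M.
  have hb : bounded_by T M' by apply/bounded_byE.
  rewrite EFinM -psiE; apply: bounded_byW psioo; [|exact: hb].
  by rewrite M'0 ltW.
have Tf : l2sq (T psi) \is a fin_num.
  by rewrite ge0_fin_numE ?l2sq_ge0// (le_lt_trans (H 1 ltr01))// ltry.
rewrite psiE -(fineK Tf) -EFinM lee_fin.
apply/ler_addgt0Pr => e e0.
(* As [e' <= 1], replacing [M] by [M + e'] costs at most [e' * (2 * M + 1) * m]; the [1] keeps [k]
   positive. *)
set k := 1 + (2 * M + 1) * m.
have k0 : 0 < k by rewrite /k ltr_pwDl// mulr_ge0// addr_ge0// mulr_ge0.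
set e' := Num.min 1 (e / k).
have e'0 : 0 < e' by rewrite lt_min ltr01 divr_gt0.
have := H _ e'0; rewrite -(fineK Tf) lee_fin => /le_trans; apply.
have e'1 : e' <= 1 by rewrite ge_min lexx.
have e'k : e' * k <= e by rewrite -ler_pdivlMr// ge_min lexx orbT.
rewrite -subr_ge0 (_ : _ - _ = (e - e' * k) + e' + (1 - e') * (e' * m)); last first.
  by rewrite /k; ring.
apply: addr_ge0; first by rewrite addr_ge0 ?subr_ge0// ltW.
by rewrite !mulr_ge0 ?subr_ge0// ltW.
Qed.

Lemma opnorm_fin T M : 0 <= M -> bounded_by T M -> opnorm T \is a fin_num.
Proof.
move=> M0 /(opnorm_le _ M0) h; rewrite ge0_fin_numE ?opnorm_ge0//.
exact: le_lt_trans h (ltry _).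
Qed.

Lemma bounded_by_opnorm T : opnorm T \is a fin_num -> bounded_by T (fine (opnorm T)).
Proof. by move=> fT; apply/opnorm_le; rewrite ?fineK// fine_ge0// opnorm_ge0. Qed.

Lemma bounded_by_lty T M psi : bounded_by T M -> (l2sq psi < +oo)%E ->
  (l2sq (T psi) < +oo)%E.
Proof.
move=> h psioo; apply: (le_lt_trans (h _ psioo)).
have : l2sq psi \is a fin_num by rewrite ge0_fin_numE ?l2sq_ge0.
by move=> /fineK <-; rewrite -EFinM ltry.
Qed.

Lemma bounded_by_comp T U M K :
  bounded_by T M -> bounded_by U K -> bounded_by (T \o U) (M * K).
Proof.
move=> hT hU psi psioo /=.
apply: (le_trans (hT _ (bounded_by_lty hU psioo))).
by rewrite [(M * K) ^+ 2]exprMn [X in (_ <= X * _)%E]EFinM -[X in (_ <= X)%E]muleA lee_wpmul2l ?lee_fin ?sqr_ge0// hU.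
Qed.

Lemma bounded_by_scale T M (c : C) : bounded_by T M ->
  bounded_by (fun psi s => c * T psi s) (Normc.normc c * M).
Proof.
move=> hT psi psioo.
have -> : l2sq (fun s => c * T psi s) = ((Normc.normc c ^+ 2)%:E * l2sq (T psi))%E.
  rewrite /l2sq -esumZ ?sqr_ge0//; last by move=> s _; rewrite lee_fin sqr_ge0.
  by apply: eq_esum => s _; rewrite Normc.normcM exprMn EFinM.
by rewrite [(_ * M) ^+ 2]exprMn [X in (_ <= X * _)%E]EFinM -[X in (_ <= X)%E]muleA lee_wpmul2l ?lee_fin ?sqr_ge0// hT.
Qed.

Lemma bounded_by_add T U M K : 0 <= M -> 0 <= K ->
  bounded_by T M -> bounded_by U K ->
  bounded_by (fun psi s => T psi s + U psi s) (M + K).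
Proof.
(* Young's inequality with ratio [K' / M'] makes the two weighted squares add up to exactly
   [(M' + K') ^ 2]. It needs positive constants; the general case enlarges both by [e / 2]. *)
have pos_case M' K' : 0 < M' -> 0 < K' -> bounded_by T M' -> bounded_by U K' ->
    bounded_by (fun psi s => T psi s + U psi s) (M' + K').
  move=> M0 K0 hT hU psi psioo.
  apply: (@le_trans _ _ ((1 + K' / M')%:E * l2sq (T psi) +
                         (1 + (K' / M')^-1)%:E * l2sq (U psi))%E).
    have c1 : 0 <= 1 + K' / M' by rewrite addr_ge0// divr_ge0// ltW.
    have c2 : 0 <= 1 + (K' / M')^-1 by rewrite addr_ge0// invr_ge0 divr_ge0// ltW.
    rewrite /l2sq -!esumZ//; try by move=> s _; rewrite lee_fin sqr_ge0.
    rewrite -esumD//; try by move=> s _; rewrite -EFinM lee_fin mulr_ge0// sqr_ge0.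
    apply: le_esum => s _; rewrite -!EFinM -EFinD lee_fin.
    by apply: normcD_young; rewrite divr_gt0.
  have psif : l2sq psi \is a fin_num by rewrite ge0_fin_numE ?l2sq_ge0.
  apply: (@le_trans _ _ ((1 + K' / M')%:E * ((M' ^+ 2)%:E * l2sq psi) +
                         (1 + (K' / M')^-1)%:E * ((K' ^+ 2)%:E * l2sq psi))%E).
    apply: leeD; apply: lee_wpmul2l; first last.
    - exact: (hU psi).
    - by rewrite lee_fin addr_ge0// invr_ge0 divr_ge0// ltW.
    - exact: (hT psi).
    - by rewrite lee_fin addr_ge0// divr_ge0// ltW.
  rewrite -(fineK psif) -!EFinM -!EFinD lee_fin.
  rewrite le_eqVlt; apply/orP; left; apply/eqP; field.
  by rewrite !gt_eqF.
move=> M0 K0 hT hU; apply/opnorm_le; first by rewrite addr_ge0.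
apply/lee_addgt0Pr => e e0.
have e2 : 0 < e / 2 by rewrite divr_gt0.
rewrite -EFinD (_ : M + K + e = (M + e / 2) + (K + e / 2)); last by field.
apply/opnorm_le; first by rewrite !addr_ge0// ltW.
apply: pos_case; rewrite ?ltr_wpDl//.
- by apply: bounded_byW hT; rewrite M0 lerDl ltW.
- by apply: bounded_byW hU; rewrite K0 lerDl ltW.
Qed.

Lemma bounded_by_opsub T U M K : 0 <= M -> 0 <= K ->
  bounded_by T M -> bounded_by U K -> bounded_by (opsub T U) (M + K).
Proof.
move=> M0 K0 hT hU.
have := bounded_by_scale (-1) hU; rewrite normcN Normc.normc1 mul1r => hU'.
have := bounded_by_add M0 K0 hT hU'; congr bounded_by.
by apply/funext => psi; apply/funext => s; rewrite mulN1r.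
Qed.

End OperatorNorm.

Lemma esum_finType (R : realType) (I : finType) (f : I -> \bar R) :
  (forall i, 0 <= f i)%E -> (\esum_(i in [set: I]) f i = \sum_i f i)%E.
Proof.
move=> f0; transitivity (\sum_(i \in [set: I]) f i)%E; first by rewrite esum_fset//; exact: finite_finset.
rewrite fsbig_finite//=.
rewrite [RHS](@bigID _ _ _ _ _ (fun i => i \in fset_set [set: I])) /=.
rewrite [X in (_ + X)%E]big1 ?adde0; last first.
  move=> i; rewrite in_fset_set; last exact: finite_finset.
  by move=> /negP[]; apply/mem_set.
rewrite -[RHS]big_filter; apply: perm_big; apply: uniq_perm; rewrite ?fset_uniq ?filter_uniq ?index_enum_uniq// => i.
by rewrite mem_filter mem_index_enum andbT.
Qed.

(** * Local operators as matrices *)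

Section Configurations.
Context {L : choiceType} {q : L -> nat}.
Implicit Types (Z W Y : {fset L}) (s : conf q).

Lemma patch_in Z (c : lconf q Z) s x (xZ : x \in Z) :
  patch_conf c s x = c [` xZ]%fset.
Proof.
rewrite /patch_conf; case: {-}_ / (@idP (x \in Z)) => // xZ'.
by rewrite (bool_irrelevance xZ' xZ).
Qed.

Lemma patch_out Z (c : lconf q Z) s x : x \notin Z -> patch_conf c s x = s x.
Proof. by rewrite /patch_conf; case: {-}_ / (@idP (x \in Z)) => // xZ /negP. Qed.

Lemma patch_restr Z s : patch_conf (restr_conf Z s) s = s.
Proof.
apply: functional_extensionality_dep => x.
have [xZ|xZ] := boolP (x \in Z); last by rewrite patch_out.
by rewrite patch_in ffunE.
Qed.

Lemma eq_restr Z s s' : (forall x, x \in Z -> s x = s' x) ->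
  restr_conf Z s = restr_conf Z s'.
Proof. by move=> h; apply/ffunP => x; rewrite !ffunE h// fsvalP. Qed.

Lemma restr_eq Z s s' x : restr_conf Z s = restr_conf Z s' -> x \in Z -> s x = s' x.
Proof. by move=> h xZ; rewrite -(patch_restr Z s) h patch_in ffunE. Qed.

Lemma restr_patch Z (c : lconf q Z) s : restr_conf Z (patch_conf c s) = c.
Proof.
by apply/ffunP => -[x xZ]; rewrite ffunE /= patch_in.
Qed.

Lemma patch_patch Z (c c' : lconf q Z) s :
  patch_conf c (patch_conf c' s) = patch_conf c s.
Proof.
apply: functional_extensionality_dep => x.
have [xZ|xZ] := boolP (x \in Z); first by rewrite !(patch_in _ _ xZ).
by rewrite !patch_out.
Qed.

Lemma patch_comm Z Y (c : lconf q Z) (c' : lconf q Y) s : [disjoint Z & Y]%fset ->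
  patch_conf c (patch_conf c' s) = patch_conf c' (patch_conf c s).
Proof.
move=> /fdisjointP ZY; apply: functional_extensionality_dep => x.
have [xZ|xZ] := boolP (x \in Z).
  by rewrite patch_in patch_out ?ZY// patch_in.
rewrite patch_out//; have [xY|xY] := boolP (x \in Y); first by rewrite !patch_in.
by rewrite !patch_out.
Qed.

Lemma restr_patch_disj Z Y (c : lconf q Z) s : [disjoint Z & Y]%fset ->
  restr_conf Y (patch_conf c s) = restr_conf Y s.
Proof.
move=> ZY; apply: eq_restr => x xY; apply: patch_out.
by apply: contraL xY => xZ; move/fdisjointP : ZY => ->.
Qed.

End Configurations.

Section Amplify.
Context {R : realType} {L : choiceType} {q : L -> nat}.
Local Notation C := R[i].
Local Notation state := (@state R L q).
Local Notation operator := (@operator R L q).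
Local Notation mxop Z := 'M[R[i]]_#|lconf q Z|.
Implicit Types (Z W Y : {fset L}) (psi : state) (s : conf q).

Lemma amplifyM Z (a b : mxop Z) : amplify (a *m b) = amplify a \o amplify b.
Proof.
apply/funext => psi; apply/funext => s; rewrite /amplify /=.
under [RHS]eq_bigr => c _ do rewrite restr_patch mulr_sumr.
rewrite exchange_big /=; apply: eq_bigr => c _.
rewrite mxE mulr_suml (reindex (@enum_rank (lconf q Z))) /=; last first.
  by apply: onW_bij; exact: enum_rank_bij.
by apply: eq_bigr => c' _; rewrite patch_patch mulrA.
Qed.

Lemma amplifyD Z (a b : mxop Z) :
  amplify (a + b) = fun psi s => amplify a psi s + amplify b psi s.
Proof.
apply/funext => psi; apply/funext => s; rewrite /amplify -big_split /=.
by apply: eq_bigr => c _; rewrite mxE mulrDl.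
Qed.

Lemma amplifyZ Z (k : C) (a : mxop Z) :
  amplify (k *: a) = fun psi s => k * amplify a psi s.
Proof.
apply/funext => psi; apply/funext => s; rewrite /amplify mulr_sumr.
by apply: eq_bigr => c _; rewrite mxE mulrA.
Qed.

Lemma amplifyB Z (a b : mxop Z) : amplify (a - b) = opsub (amplify a) (amplify b).
Proof.
apply/funext => psi; apply/funext => s; rewrite /opsub /amplify -sumrB.
by apply: eq_bigr => c _; rewrite !mxE mulrBl.
Qed.

Lemma amplify_sum Z (I : Type) (r : seq I) (P : pred I) (F : I -> mxop Z) :
  amplify (\sum_(i <- r | P i) F i) =
  fun psi s => \sum_(i <- r | P i) amplify (F i) psi s.
Proof.
apply/funext => psi; apply/funext => s; rewrite /amplify exchange_big /=.
by apply: eq_bigr => c _; rewrite summxE mulr_suml.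
Qed.

Lemma amplify1 Z : amplify (1%:M : mxop Z) = id.
Proof.
apply/funext => psi; apply/funext => s; rewrite /amplify.
rewrite (bigD1 (restr_conf Z s)) //= big1 ?addr0 => [|c cs].
  by rewrite mxE eqxx mul1r patch_restr.
by rewrite mxE (inj_eq enum_rank_inj) eq_sym (negPf cs) mul0r.
Qed.

Definition indicator_state Z (c : lconf q Z) : state :=
  fun s => (restr_conf Z s == c)%:R.

Definition ground : conf q := fun x => ord0.

(* The matrix of an operator in the basis of the configurations of [W].  The
   function [indicator_state c] is not in [l^2(conf)], but operators act on all
   functions. *)
Definition mx_of W (T : operator) : mxop W :=
  \matrix_(i, j) T (indicator_state (enum_val j)) (patch_conf (enum_val i) ground).

Lemma mx_ofE W T (c c' : lconf q W) : mx_of W T (enum_rank c) (enum_rank c') =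
  T (indicator_state c') (patch_conf c ground).
Proof. by rewrite mxE !enum_rankK. Qed.

Lemma amplify_indicator Z (a : mxop Z) (c c' : lconf q Z) :
  amplify a (indicator_state c') (patch_conf c ground) = a (enum_rank c) (enum_rank c').
Proof.
rewrite /amplify restr_patch (bigD1 c') //= big1 ?addr0 => [|d dc].
  by rewrite /indicator_state restr_patch eqxx mulr1.
by rewrite /indicator_state restr_patch (negPf dc) mulr0.
Qed.

Lemma mx_ofK Z (a : mxop Z) : mx_of Z (amplify a) = a.
Proof.
apply/matrixP => i j; rewrite -(enum_valK i) -(enum_valK j).
by rewrite mx_ofE amplify_indicator.
Qed.

Lemma amplify_inj Z : injective (@amplify R L q Z).
Proof. exact: can_inj (@mx_ofK Z). Qed.

(** Rewriting an operator of [Z] in the basis of a larger region leaves the operator unchanged: all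
    local operators can be moved into one matrix algebra. *)
Lemma amplify_mx_of Z W (a : mxop Z) : (Z `<=` W)%fset ->
  amplify (mx_of W (amplify a)) = amplify a.
Proof.
move=> /fsubsetP ZW; apply/funext => psi; apply/funext => s.
rewrite {1}/amplify.
under eq_bigr => c _ do rewrite mx_ofE {1}/amplify mulr_suml.
rewrite exchange_big /=; apply: eq_bigr => c _.
have pE s' : restr_conf W s' = restr_conf W s ->
    restr_conf W (patch_conf c s') = restr_conf W (patch_conf c s).
  move=> h; apply: eq_restr => x xW; have [xZ|xZ] := boolP (x \in Z).
    by rewrite !patch_in.
  by rewrite !patch_out// (restr_eq h).
(* Among the configurations of [W], only the one reached from [s] by the patch [c] contributes. *)
rewrite (bigD1 (restr_conf W (patch_conf c s))) //= big1 ?addr0 => [|d dc].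
  rewrite /indicator_state pE ?restr_patch// eqxx mulr1; congr (a _ _ * psi _).
    by congr enum_rank; apply: eq_restr => x xZ; rewrite patch_in ?ZW// => xW; rewrite ffunE.
  apply: functional_extensionality_dep => x; have [xW|xW] := boolP (x \in W).
    by rewrite patch_in ffunE.
  by rewrite !patch_out//; apply: contra xW; exact: ZW.
rewrite /indicator_state pE ?restr_patch//.
by rewrite eq_sym (negPf dc) mulr0 mul0r.
Qed.

Lemma amplify_comm Z Y (a : mxop Z) (b : mxop Y) : [disjoint Z & Y]%fset ->
  amplify a \o amplify b = amplify b \o amplify a.
Proof.
move=> ZY; have YZ : [disjoint Y & Z]%fset by rewrite fdisjoint_sym.
apply/funext => psi; apply/funext => s; rewrite /amplify /=.
under eq_bigr do rewrite mulr_sumr.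
under [RHS]eq_bigr do rewrite mulr_sumr.
rewrite exchange_big /=; apply: eq_bigr => c _; apply: eq_bigr => c' _.
by rewrite !restr_patch_disj// patch_comm// mulrCA.
Qed.

(** A configuration is a pair formed by its restriction to [Z] and its values outside, the latter
    represented by the configuration [b] that equals [ground] on [Z]. *)
Lemma l2sq_fiber Z psi : l2sq psi =
  (\esum_(b in [set s | restr_conf Z s = restr_conf Z ground])
     \sum_(c : lconf q Z) (Normc.normc (psi (patch_conf c b)) ^+ 2)%:E)%E.
Proof.
have nn s : (0 <= (Normc.normc (psi s) ^+ 2)%:E)%E by rewrite lee_fin sqr_ge0.
under eq_esum => b _ do rewrite -esum_finType//.
rewrite esum_esum//= /l2sq.
rewrite (@reindex_esum _ _ _ ([set s | restr_conf Z s = restr_conf Z ground] `*``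
    (fun=> [set: lconf q Z])) _ (fun k => patch_conf k.2 k.1))//.
split => //.
- move=> [s c] [s' c'] /set_mem /= [h _] /set_mem /= [h' _] e.
  have cc' : c = c' by rewrite -(restr_patch c s) e restr_patch.
  congr (_, _) => //; apply: functional_extensionality_dep => x.
  have [xZ|xZ] := boolP (x \in Z); first by rewrite (restr_eq h)// (restr_eq h').
  by rewrite -(patch_out c s xZ) e patch_out.
- move=> s _; exists (patch_conf (restr_conf Z ground) s, restr_conf Z s) => /=.
    by split => //=; rewrite restr_patch.
  by rewrite patch_patch patch_restr.
Qed.

(** [amplify a] acts as the matrix [a] on each fibre separately, so a finite-dimensional bound
    suffices. *)
Lemma amplify_bounded Z (a : mxop Z) (M : R) : 0 <= M ->
  (forall v : lconf q Z -> C,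
     \sum_c Normc.normc (\sum_c' a (enum_rank c) (enum_rank c') * v c') ^+ 2 <=
     M ^+ 2 * \sum_c Normc.normc (v c) ^+ 2) ->
  bounded_by (amplify a) M.
Proof.
move=> M0 h psi _; rewrite !(l2sq_fiber Z) -esumZ ?sqr_ge0//; last first.
  by move=> b _; apply: sume_ge0 => c _; rewrite lee_fin sqr_ge0.
apply: le_esum => b _; rewrite !sumEFin -EFinM lee_fin.
apply: le_trans (h (fun c => psi (patch_conf c b))); rewrite le_eqVlt; apply/orP; left.
apply/eqP; apply: eq_bigr => c _; congr (Normc.normc _ ^+ 2).
by rewrite /amplify restr_patch; apply: eq_bigr => c' _; rewrite patch_patch.
Qed.

End Amplify.

(** * Unitary groups generated by hermitian matrices *)

Section Cis.
Context {R : realType}.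
Local Notation C := R[i].
Implicit Types (x y t : R).

Definition cis x : C := cos x +i* sin x.

Lemma cis0 : cis 0 = 1.
Proof. by rewrite /cis cos0 sin0. Qed.

Lemma cisD x y : cis (x + y) = cis x * cis y.
Proof.
rewrite /cis cosD sinD; apply/eqP; rewrite eq_complex /= eqxx/=.
by rewrite addrC.
Qed.

Lemma cis_conj x : (cis x)^* = cis (- x).
Proof. by rewrite /cis cosN sinN. Qed.

Lemma cos_lip x : 0 <= x -> exists2 c, 0 <= c <= x & cos x - 1 = - sin c * x.
Proof.
move=> x0; have cf : {within `[0, x], continuous (@cos R)}.
  exact/continuous_subspaceT/continuous_cos.
have [c] := @MVT_segment R cos (- sin) 0 x x0 (fun y _ => is_derive_cos y) cf.
by rewrite in_itv /= cos0 subr0 => cx e; exists c.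
Qed.

Lemma sin_lip x : 0 <= x ->
  exists2 c, 0 <= c <= x & sin x - x = (cos c - 1) * x.
Proof.
move=> x0; have cf : {within `[0, x], continuous (@sin R)}.
  exact/continuous_subspaceT/continuous_sin.
have [c] := @MVT_segment R sin cos 0 x x0 (fun y _ => is_derive_sin y) cf.
rewrite in_itv /= sin0 !subr0 => cx e; exists c => //.
by rewrite e mulrBl mul1r.
Qed.

Lemma abs_sin_le x : 0 <= x -> `|sin x| <= x.
Proof.
move=> x0; have [c cx e] := sin_lip x0.
have -> : sin x = cos c * x by apply: (addIr (- x)); rewrite e mulrBl mul1r.
by rewrite normrM (ger0_norm x0) ler_piMl// cos_max.
Qed.

Lemma abs_cos1_le x : 0 <= x -> `|cos x - 1| <= x.
Proof.
move=> x0; have [c cx ->] := cos_lip x0.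
by rewrite normrM normrN (ger0_norm x0) ler_piMl// sin_max.
Qed.

Lemma cis_taylor_ge0 x : 0 <= x ->
  Normc.normc (cis x - 1 - (0 +i* x)) <= 2 * x ^+ 2.
Proof.
move=> x0; have -> : cis x - 1 - (0 +i* x) = (cos x - 1) +i* (sin x - x).
  by apply/eqP; rewrite eq_complex /= !subr0 !eqxx.
have -> : (cos x - 1) +i* (sin x - x) = (cos x - 1)%:C + (0 +i* (sin x - x)).
  by apply/eqP; rewrite eq_complex /= addr0 add0r !eqxx.
rewrite (le_trans (le_normcD _ _))// normc_real normc_imag.
have [c /andP[c0 cx] ->] := cos_lip x0; have [c' /andP[c'0 c'x] ->] := sin_lip x0.
rewrite !normrM normrN (ger0_norm x0) mulr_natl mulr2n expr2.
apply: lerD; apply: ler_wpM2r => //.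
- exact: le_trans (abs_sin_le c0) cx.
- exact: le_trans (abs_cos1_le c'0) c'x.
Qed.

Lemma normc_conj (z : C) : Normc.normc z^* = Normc.normc z.
Proof. by case: z => a b; rewrite /Normc.normc /= sqrrN. Qed.

Lemma cis_taylor x : Normc.normc (cis x - 1 - (0 +i* x)) <= 2 * x ^+ 2.
Proof.
have [x0|x0] := leP 0 x; first exact: cis_taylor_ge0.
have := @cis_taylor_ge0 (- x); rewrite oppr_ge0 ltW// sqrrN => /(_ isT).
rewrite -[in X in X -> _]normc_conj -cis_conj; congr (Normc.normc _ <= _).
by apply/eqP; rewrite eq_complex /= !opprD !opprK !oppr0 !eqxx.
Qed.

Lemma Re_sum (I : Type) (r : seq I) (P : pred I) (v : I -> C) :
  complex.Re (\sum_(i <- r | P i) v i) = \sum_(i <- r | P i) complex.Re (v i).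
Proof.
elim: r => [|i r IH]; first by rewrite !big_nil.
by rewrite !big_cons; case: (P i) => //; rewrite -IH; case: (v i) (bigop _ _ _) => ? ? [].
Qed.

Lemma Im_sum (I : Type) (r : seq I) (P : pred I) (v : I -> C) :
  complex.Im (\sum_(i <- r | P i) v i) = \sum_(i <- r | P i) complex.Im (v i).
Proof.
elim: r => [|i r IH]; first by rewrite !big_nil.
by rewrite !big_cons; case: (P i) => //; rewrite -IH; case: (v i) (bigop _ _ _) => ? ? [].
Qed.

(** By components, because [clim] takes the limits of the real and imaginary parts separately. *)
Definition ccvg (u : nat -> C) (z : C) : Prop :=
  (fun n => complex.Re (u n)) @ \oo --> complex.Re z /\
  (fun n => complex.Im (u n)) @ \oo --> complex.Im z.

Lemma ccvg_clim u z : ccvg u z -> clim u = z.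
Proof.
case: z => a b [/= ua ub]; rewrite /clim.
by rewrite (cvg_lim _ ua)// (cvg_lim _ ub).
Qed.

Lemma ccvg_cst z : ccvg (fun=> z) z.
Proof. by split; exact: cvg_cst. Qed.

Lemma ccvgD u v z w : ccvg u z -> ccvg v w -> ccvg (fun n => u n + v n) (z + w).
Proof.
have ReD (x y : C) : complex.Re (x + y) = complex.Re x + complex.Re y.
  by case: x y => ? ? [].
have ImD (x y : C) : complex.Im (x + y) = complex.Im x + complex.Im y.
  by case: x y => ? ? [].
move=> [u1 u2] [v1 v2]; split; rewrite ?ReD ?ImD.
  by under eq_fun do rewrite ReD; exact: cvgD.
by under eq_fun do rewrite ImD; exact: cvgD.
Qed.

Lemma ccvg_sum (I : Type) (r : seq I) (u : I -> nat -> C) (z : I -> C) :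
  (forall i, ccvg (u i) (z i)) ->
  ccvg (fun n => \sum_(i <- r) u i n) (\sum_(i <- r) z i).
Proof.
move=> uz; elim: r => [|i r IH].
  rewrite big_nil; under eq_fun do rewrite big_nil; exact: ccvg_cst.
by rewrite big_cons; under eq_fun do rewrite big_cons; exact: ccvgD.
Qed.

Lemma ccvgM u v z w : ccvg u z -> ccvg v w -> ccvg (fun n => u n * v n) (z * w).
Proof.
move=> [u1 u2] [v1 v2]; split.
- have -> : (fun n => complex.Re (u n * v n)) = (fun n =>
    complex.Re (u n) * complex.Re (v n) - complex.Im (u n) * complex.Im (v n)).
    by apply/funext => n; case: (u n) (v n) => ? ? [].
  have -> : complex.Re (z * w) =
    complex.Re z * complex.Re w - complex.Im z * complex.Im w.
    by case: (z) (w) => ? ? [].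
  by apply: cvgB; exact: cvgM.
- have -> : (fun n => complex.Im (u n * v n)) = (fun n =>
    complex.Re (u n) * complex.Im (v n) + complex.Im (u n) * complex.Re (v n)).
    by apply/funext => n; case: (u n) (v n) => ? ? [].
  have -> : complex.Im (z * w) =
    complex.Re z * complex.Im w + complex.Im z * complex.Re w.
    by case: (z) (w) => ? ? [].
  by apply: cvgD; exact: cvgM.
Qed.

Lemma cis_series x :
  ccvg (fun n => \sum_(k < n) (k`!%:R)^-1 * (0 +i* x) ^+ k) (cis x).
Proof.
have E k : (k`!%:R)^-1 * (0 +i* x) ^+ k = cos_coeff x k +i* sin_coeff x k :> C.
  have iE : (0 +i* x) = 'i%C * x%:C :> C.
    by apply/eqP; rewrite eq_complex /= !mul0r !mul1r subr0 add0r !eqxx.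
  have pE : 'i%C ^+ k = ((~~ odd k)%:R * (-1) ^+ k./2) +i*
      ((odd k)%:R * (-1) ^+ k.-1./2) :> C.
    rewrite -{1}(odd_double_half k) exprD -mul2n exprM sqr_i.
    have -> : (-1) ^+ k./2 = ((-1) ^+ k./2)%:C :> C by rewrite rmorphXn rmorphN1.
    case: (boolP (odd k)) => ok /=.
      have -> : k.-1./2 = k./2.
        by rewrite -{1}(odd_double_half k) ok add1n /= doubleK.
      by apply/eqP; rewrite eq_complex /= !mul0r !mul1r !subr0 add0r !eqxx.
    by apply/eqP; rewrite eq_complex /= !mul0r !mul1r !subr0 ?add0r ?addr0 !eqxx.
  rewrite iE exprMn pE -rmorphXn -(rmorph_nat (real_complex R)) -fmorphV.
  apply/eqP; rewrite eq_complex /= /cos_coeff /sin_coeff /=.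
  by rewrite -?exprnP; apply/andP; split; apply/eqP; ring.
under eq_fun => n do under eq_bigr => k _ do rewrite E.
split => /=.
- have -> : (fun n => complex.Re (\sum_(i < n) (cos_coeff x i +i* sin_coeff x i))) =
      series (cos_coeff x).
    apply/funext => n; rewrite /series /= big_mkord.
    by rewrite Re_sum.
  by rewrite unlock; exact: is_cvg_series_cos_coeff.
- have -> : (fun n => complex.Im (\sum_(i < n) (cos_coeff x i +i* sin_coeff x i))) =
      series (sin_coeff x).
    apply/funext => n; rewrite /series /= big_mkord.
    by rewrite Im_sum.
  by rewrite unlock; exact: is_cvg_series_sin_coeff.
Qed.

End Cis.

Local Notation "M ^t*" := (map_mx (@Num.conj _) (M ^T)) (at level 30).

(** All estimates on the matrix dynamics use only these five properties. The last one makes unitary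
    conjugation an isometry. *)
Record operator_norm {R : realType} {n : nat} (N : 'M[R[i]]_n -> R) : Prop := {
  opn_ge0 : forall a, 0 <= N a;
  opnD : forall a b, N (a + b) <= N a + N b;
  opnZ : forall c a, N (c *: a) <= Normc.normc c * N a;
  opnM : forall a b, N (a *m b) <= N a * N b;
  opn_unitary : forall u, u \is unitarymx -> N u <= 1 }.

Section OperatorNormTheory.
Context {R : realType} {n : nat} (N : 'M[R[i]]_n -> R).
Hypothesis HN : operator_norm N.
Implicit Types a b : 'M[R[i]]_n.

Lemma opn0 : N 0 = 0.
Proof.
apply/eqP; rewrite eq_le opn_ge0// andbT.
by have := opnZ HN 0 0; rewrite scale0r Normc.normc0 mul0r.
Qed.

Lemma opnN a : N (- a) = N a.
Proof.
have H b : N (- b) <= N b.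
  by have := opnZ HN (-1) b; rewrite scaleN1r normcN Normc.normc1 mul1r.
by apply/eqP; rewrite eq_le H /= -{1}(opprK a) H.
Qed.

Lemma opnB a b : N (a - b) <= N a + N b.
Proof. by rewrite -(opnN b); exact: opnD. Qed.

Lemma opn_sum (I : Type) (r : seq I) (P : pred I) (F : I -> 'M[R[i]]_n) :
  N (\sum_(i <- r | P i) F i) <= \sum_(i <- r | P i) N (F i).
Proof.
elim/big_rec2 : _ => [|i y x _ yx]; first by rewrite opn0.
by rewrite (le_trans (opnD HN _ _))// lerD2l.
Qed.

Lemma opn1 : N 1%:M <= 1.
Proof.
by apply: opn_unitary => //; apply/unitarymxP; rewrite trmx1 map_mx1 mulmx1.
Qed.

Lemma opnM_le a b x y : N a <= x -> N b <= y -> N (a *m b) <= x * y.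
Proof.
move=> ax bY; apply: le_trans (opnM HN _ _) _.
by apply: ler_pM => //; exact: opn_ge0.
Qed.

End OperatorNormTheory.

Section SpectralCalculus.
Context {R : realType} {n : nat}.
Local Notation C := R[i].
Implicit Types (h : 'M[C]_n) (v w : 'rV[C]_n).

(** For a hermitian [h], the functional calculus: this is [F(h)] when [v] lists the values of [F] at
    the eigenvalues. *)
Definition spectral_calc h v : 'M[C]_n :=
  invmx (spectralmx h) *m diag_mx v *m spectralmx h.

End SpectralCalculus.

(* Locked: unfolding it down to matrix products makes unification diverge. *)
HB.lock Definition expmx {R : realType} {n : nat} (h : 'M[R[i]]_n) (t : R) :
    'M[R[i]]_n :=
  spectral_calc h (\row_j cis (t * complex.Re (spectral_diag h 0 j))).
Canonical expmx_unlockable := Unlockable expmx.unlock.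

Section Exponential.
Context {R : realType} {n : nat}.
Local Notation C := R[i].
Implicit Types (h : 'M[C]_n) (v w : 'rV[C]_n).

Lemma spectral_calcM h v w :
  spectral_calc h v *m spectral_calc h w = spectral_calc h (\row_j (v 0 j * w 0 j)).
Proof.
rewrite /spectral_calc !mulmxA (mulmxK (spectral_unit h)).
by rewrite -(mulmxA _ (diag_mx v)) mulmx_diag.
Qed.

Lemma spectral_calcE h v i j : spectral_calc h v i j =
  \sum_k invmx (spectralmx h) i k * v 0 k * spectralmx h k j.
Proof.
rewrite /spectral_calc mxE; apply: eq_bigr => k _; congr (_ * _).
by rewrite mul_mx_diag mxE.
Qed.

Lemma spectral_calcB h v w :
  spectral_calc h v - spectral_calc h w = spectral_calc h (v - w).
Proof. by rewrite /spectral_calc linearB /= mulmxBr mulmxBl. Qed.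

Lemma spectral_calcZ h c v : c *: spectral_calc h v = spectral_calc h (c *: v).
Proof. by rewrite /spectral_calc linearZ /= -scalemxAr -scalemxAl. Qed.

Lemma spectral_calc1 h : spectral_calc h (const_mx 1) = 1%:M.
Proof. by rewrite /spectral_calc diag_const_mx mulmx1 mulVmx// spectral_unit. Qed.

Lemma spectral_calc_herm h : h \is hermsymmx ->
  h = spectral_calc h (\row_j (complex.Re (spectral_diag h 0 j))%:C).
Proof.
move=> hh; have /orthomx_spectralP {1}-> := hermitian_normalmx hh.
suff {1}-> : spectral_diag h = \row_j (complex.Re (spectral_diag h 0 j))%:C by [].
apply/rowP => j; rewrite mxE.
have /mxOverP /(_ 0 j) := hermitian_spectral_diag_real hh.
by move=> /RRe_real ->.
Qed.

Lemma expmxE h t i j : expmx h t i j = \sum_k invmx (spectralmx h) i k *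
  cis (t * complex.Re (spectral_diag h 0 k)) * spectralmx h k j.
Proof. by rewrite unlock spectral_calcE; apply: eq_bigr => k _; rewrite mxE. Qed.

Lemma expmx_unitary h t : expmx h t \is unitarymx.
Proof.
rewrite unlock /spectral_calc !mul_unitarymx ?spectral_unitarymx//.
  by rewrite invmx_unitary ?trmxC_unitary spectral_unitarymx.
apply/unitarymxP; rewrite tr_diag_mx map_diag_mx mulmx_diag -diag_const_mx.
congr diag_mx; apply/rowP => j; rewrite !mxE.
set x := t * _; transitivity (cis x * cis (- x)); last by rewrite -cisD subrr cis0.
by congr (_ * _); exact: cis_conj.
Qed.

Lemma expmx0 h : expmx h 0 = 1%:M.
Proof.
rewrite -(spectral_calc1 h) unlock; congr (spectral_calc h _).
by apply/rowP => j; rewrite !mxE mul0r cis0.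
Qed.

Lemma expmxD h s t : expmx h (s + t) = expmx h s *m expmx h t.
Proof.
rewrite unlock spectral_calcM; congr (spectral_calc h _).
by apply/rowP => j; rewrite !mxE mulrDl cisD.
Qed.

(** The remainder is a combination of the spectral projections [D j], with coefficients controlled
    by the scalar estimate [cis_taylor] at each eigenvalue. *)
Lemma expmx_taylor (N : 'M[C]_n -> R) h : operator_norm N -> h \is hermsymmx ->
  exists2 K, 0 <= K & forall e : R,
    N (expmx h e - 1%:M - (0 +i* e) *: h) <= K * e ^+ 2.
Proof.
move=> HN hh; set l := fun j => complex.Re (spectral_diag h 0 j).
set D := fun j => spectral_calc h (delta_mx 0 j).
exists (\sum_j 2 * l j ^+ 2 * N (D j)).
  by apply: sumr_ge0 => j _; rewrite mulr_ge0 ?opn_ge0// mulr_ge0// sqr_ge0.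
move=> e; set v := \row_j (cis (e * l j) - 1 - (0 +i* (e * l j))).
have -> : expmx h e - 1%:M - (0 +i* e) *: h = spectral_calc h v.
  rewrite {2}(spectral_calc_herm hh) -(spectral_calc1 h) spectral_calcZ unlock.
  rewrite !spectral_calcB; congr (spectral_calc h _); apply/rowP => j.
  rewrite !mxE; congr (_ - _); apply/eqP; rewrite eq_complex /=.
  by rewrite !mul0r mulr0 subrr add0r !eqxx.
have -> : spectral_calc h v = \sum_j v 0 j *: D j.
  rewrite {1}(row_sum_delta v) /spectral_calc linear_sum /= mulmx_sumr mulmx_suml.
  by apply: eq_bigr => j _; rewrite /D spectral_calcZ.
apply: le_trans (opn_sum HN _ _ _) _; rewrite mulr_suml; apply: ler_sum => j _.
apply: le_trans (opnZ HN _ _) _; rewrite mulrAC ler_wpM2r ?opn_ge0//.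
by rewrite mxE (le_trans (cis_taylor _))// exprMn mulrCA mulrC [_ * l j ^+ 2]mulrC mulrA.
Qed.

End Exponential.

(** The iterates of [i t h] are its spectral calculus with the powers [(i t l) ^ k]; the exponential
    series therefore reduces to the series of [cis] at each eigenvalue. *)
Lemma opexp_amplify {R : realType} {L : choiceType} {q : L -> nat} (Z : {fset L})
    (h : 'M[R[i]]_#|lconf q Z|) (t : R) : h \is hermsymmx ->
  opexp (fun psi s => (0 +i* t) * amplify h psi s) = amplify (expmx h t).
Proof.
move=> hh; set T := (X in opexp X); apply/funext => psi; apply/funext => s.
set l := fun j => complex.Re (spectral_diag h 0 j).
have thE : (0 +i* t) *: h = spectral_calc h (\row_j (0 +i* (t * l j))).
  rewrite {1}(spectral_calc_herm hh) spectral_calcZ; congr (spectral_calc h _).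
  apply/rowP => j; rewrite !mxE; apply/eqP; rewrite eq_complex /=.
  by rewrite !mul0r mulr0 subrr add0r !eqxx.
have iterE k : iter k T psi =
    amplify (spectral_calc h (\row_j (0 +i* (t * l j)) ^+ k)) psi.
  elim: k => [|k IH].
    rewrite (_ : \row_j _ = const_mx 1) ?spectral_calc1 ?amplify1//.
    by apply/rowP => j; rewrite !mxE expr0.
  rewrite iterS IH /T -[RHS]/((amplify _) psi).
  rewrite (_ : \row_j (0 +i* (t * l j)) ^+ k.+1 = \row_j ((\row_j (0 +i* (t * l j))) 0 j *
                  (\row_j ((0 +i* (t * l j)) ^+ k)) 0 j)); last first.
    by apply/rowP => j; rewrite !mxE exprS.
  by rewrite -spectral_calcM -thE -scalemxAl amplifyZ amplifyM.
rewrite /opexp; apply: ccvg_clim; rewrite [X in ccvg X _](_ : _ = fun m =>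
    \sum_(c : lconf q Z) (\sum_k
      invmx (spectralmx h) (enum_rank (restr_conf Z s)) k *
      (\sum_(i < m) (i`!%:R)^-1 * (0 +i* (t * l k)) ^+ i) *
      spectralmx h k (enum_rank c)) * psi (patch_conf c s)).
  rewrite /amplify; apply: ccvg_sum => c; apply: ccvgM; last exact: ccvg_cst.
  rewrite expmxE; apply: ccvg_sum => k.
  apply: ccvgM; last exact: ccvg_cst.
  by apply: ccvgM; [exact: ccvg_cst|exact: cis_series].
apply/funext => m; under eq_bigr => i _ do rewrite iterE /amplify mulr_sumr.
rewrite exchange_big /=; apply: eq_bigr => c _.
under eq_bigr => i _ do rewrite mulrA; rewrite -mulr_suml; congr (_ * _).
transitivity (\sum_(i < m) \sum_k (i`!%:R)^-1 *
    (invmx (spectralmx h) (enum_rank (restr_conf Z s)) k *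
     (0 +i* (t * l k)) ^+ i * spectralmx h k (enum_rank c))).
  apply: eq_bigr => i _; rewrite -mulr_sumr; congr (_ * _).
  by apply: etrans (spectral_calcE _ _ _ _) _; apply: eq_bigr => k _; rewrite mxE.
rewrite exchange_big /=; apply: eq_bigr => k _.
by rewrite mulr_sumr mulr_suml; apply: eq_bigr => i _; ring.
Qed.

Lemma addmxE (V : nmodType) m n (a b : 'M[V]_(m, n)) i j : (a + b) i j = a i j + b i j.
Proof. by rewrite mxE. Qed.

Lemma oppmxE (V : zmodType) m n (a : 'M[V]_(m, n)) i j : (- a) i j = - a i j.
Proof. by rewrite mxE. Qed.

Section MatrixRing.
Context {R : realType} {n : nat}.
Implicit Types a b c : 'M[R[i]]_n.

Lemma mxrDl a b c : (a + b) *m c = a *m c + b *m c. Proof. exact: mulmxDl. Qed.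
Lemma mxrDr a b c : c *m (a + b) = c *m a + c *m b. Proof. exact: mulmxDr. Qed.
Lemma mxrNl a b : (- a) *m b = - (a *m b). Proof. exact: mulNmx. Qed.
Lemma mxrNr a b : a *m (- b) = - (a *m b). Proof. exact: mulmxN. Qed.
Lemma mxr1l a : 1%:M *m a = a. Proof. exact: mul1mx. Qed.
Lemma mxr1r a : a *m 1%:M = a. Proof. exact: mulmx1. Qed.
Lemma mxrA a b c : a *m (b *m c) = a *m b *m c. Proof. exact: mulmxA. Qed.

End MatrixRing.

(* Matrix identities in normal form are linear in their monomials, so [ring]
   settles them entrywise once the products are generalized. *)
Ltac nc_ring :=
  rewrite ?(mxrDl, mxrDr, mxrNl, mxrNr, mxr1r, mxr1l, mxrA);
  repeat match goal with |- context [@mulmx ?T ?m ?n ?p ?a ?b] =>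
    generalize (@mulmx T m n p a b); intro end;
  apply/matrixP => ? ?; rewrite ?(addmxE, oppmxE); ring.

(** The limit of infinitely many time steps: [c / n] is the accumulated error, and [t <= n] makes
    the step [t / n] at most [1]. *)
Lemma ler_add_inv_nat (R : realType) (x y t c : R) :
  (forall n, (0 < n)%N -> t <= n%:R -> x <= y + c / n%:R) -> x <= y.
Proof.
move=> h; apply/ler_addgt0Pr => e e0.
pose n := (Num.truncn (Num.max t (c / e))).+1.
have : Num.max t (c / e) < n%:R by exact: truncnS_gt.
rewrite gt_max => /andP[tn cn]; have := h n isT (ltW tn) => /le_trans; apply.
rewrite lerD2l ler_pdivrMr ?ltr0n// mulrC -ler_pdivrMr//; exact: ltW.
Qed.

HB.lock Definition comm {R : realType} {n : nat} (a b : 'M[R[i]]_n) : 'M[R[i]]_n :=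
  a *m b - b *m a.

HB.lock Definition tau {R : realType} {n : nat} (h : 'M[R[i]]_n) (t : R)
    (a : 'M[R[i]]_n) : 'M[R[i]]_n :=
  expmx h t *m a *m expmx h (- t).

(** * Heisenberg evolution of matrices *)

Section Dynamics.
Context {R : realType} {n : nat}.
Local Notation C := R[i].
Implicit Types (h a b k : 'M[C]_n) (s t e : R).

Lemma commE a b : comm a b = a *m b - b *m a.
Proof. by rewrite comm.unlock. Qed.

Lemma tauE h t a : tau h t a = expmx h t *m a *m expmx h (- t).
Proof. by rewrite tau.unlock. Qed.

Lemma expmxK h t : expmx h (- t) *m expmx h t = 1%:M.
Proof. by rewrite -expmxD addNr expmx0. Qed.

Lemma expmxNK h t : expmx h t *m expmx h (- t) = 1%:M.
Proof. by rewrite -expmxD subrr expmx0. Qed.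

Lemma tau0 h a : tau h 0 a = a.
Proof. by rewrite !tauE oppr0 expmx0 mul1mx mulmx1. Qed.

Lemma tauD h s t a : tau h (s + t) a = tau h s (tau h t a).
Proof.
rewrite !tauE opprD expmxD [- s - t]addrC expmxD.
move: (expmx h s) (expmx h t) (expmx h (- t)) (expmx h (- s)) => u v v' u'.
by rewrite !mulmxA.
Qed.

Lemma tauM h t a b : tau h t (a *m b) = tau h t a *m tau h t b.
Proof.
rewrite !tauE; move: (expmxK h t); move: (expmx h t) (expmx h (- t)) => u u' uu'.
by rewrite -!mulmxA (mulmxA u' u) uu' mul1mx.
Qed.

Lemma tau1 h t : tau h t 1%:M = 1%:M.
Proof. by rewrite !tauE mulmx1 expmxNK. Qed.

Lemma tau_add h t a b : tau h t (a + b) = tau h t a + tau h t b.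
Proof. by rewrite !tauE mulmxDr mulmxDl. Qed.

Lemma tauB h t a b : tau h t (a - b) = tau h t a - tau h t b.
Proof. by rewrite !tauE mulmxBr mulmxBl. Qed.

Lemma tauZ h t c a : tau h t (c *: a) = c *: tau h t a.
Proof. by rewrite !tauE -scalemxAr -scalemxAl. Qed.

Lemma tau_sum h t (I : Type) (r : seq I) (P : pred I) (F : I -> 'M[C]_n) :
  tau h t (\sum_(i <- r | P i) F i) = \sum_(i <- r | P i) tau h t (F i).
Proof. by rewrite tauE mulmx_sumr mulmx_suml; apply: eq_bigr => i _; rewrite tauE. Qed.

Lemma tau_comm h t a b : tau h t (comm a b) = comm (tau h t a) (tau h t b).
Proof. by rewrite !commE tauB !tauM. Qed.

Lemma commDl a a' b : comm (a + a') b = comm a b + comm a' b.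
Proof. by rewrite !commE; nc_ring. Qed.

Lemma commBl a a' b : comm (a - a') b = comm a b - comm a' b.
Proof. by rewrite !commE; nc_ring. Qed.

Lemma commZl c a b : comm (c *: a) b = c *: comm a b.
Proof. by rewrite !commE scalerBr -scalemxAl -scalemxAr. Qed.

Lemma commC a b : comm a b = - comm b a.
Proof. by rewrite !commE opprB. Qed.

Lemma comm_suml (I : Type) (r : seq I) (P : pred I) (F : I -> 'M[C]_n) b :
  comm (\sum_(i <- r | P i) F i) b = \sum_(i <- r | P i) comm (F i) b.
Proof.
by rewrite commE mulmx_sumr mulmx_suml -sumrB; apply: eq_bigr => i _; rewrite commE.
Qed.

Lemma comm_jacobi a b k :
  comm (comm a b) k = comm a (comm b k) - comm b (comm a k).
Proof. by rewrite !commE; nc_ring. Qed.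

Section Norm.
Context (N : 'M[C]_n -> R) (HN : operator_norm N).

Lemma opn_comm a b : N (comm a b) <= 2 * N a * N b.
Proof.
rewrite !commE (le_trans (opnB HN _ _))// -mulrA mulr_natl mulr2n.
by apply: lerD; [exact: opnM|rewrite mulrC; exact: opnM].
Qed.

Lemma opn_tau_le h t a : N (tau h t a) <= N a.
Proof.
rewrite tauE; have U s : N (expmx h s) <= 1 by exact/opn_unitary/expmx_unitary.
apply: (@le_trans _ _ (1 * N a * 1)); last by rewrite mul1r mulr1.
by apply: (opnM_le HN) => //; apply: (opnM_le HN).
Qed.

Lemma opn_tau h t a : N (tau h t a) = N a.
Proof.
apply/eqP; rewrite eq_le opn_tau_le /=.
by rewrite -{1}(tau0 h a) -(addNr t) tauD opn_tau_le.
Qed.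

Lemma tau_taylor h : h \is hermsymmx -> exists2 K, 0 <= K &
  forall a e, 0 <= e <= 1 ->
    N (tau h e a - a - (0 +i* e) *: comm h a) <= K * e ^+ 2 * N a.
Proof.
move=> hh; have [K K0 hK] := expmx_taylor HN hh.
exists (K + (1 + N h) * K + N h ^+ 2).
  by rewrite !addr_ge0 ?mulr_ge0 ?addr_ge0 ?sqr_ge0 ?opn_ge0.
move=> a e /andP[e0 e1]; set x := (0 +i* e) *: h.
have Nx : N x <= e * N h.
  by rewrite (le_trans (opnZ HN _ _))// normc_imag ger0_norm.
have Nx' : N x <= N h by rewrite (le_trans Nx)// ler_piMl ?opn_ge0.
set u := expmx h e; set u' := expmx h (- e).
have Nu' : N u' <= 1 by exact/opn_unitary/expmx_unitary.
have hu : N (u - 1%:M - x) <= K * e ^+ 2 by exact: hK.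
have hu' : N (u' - 1%:M + x) <= K * e ^+ 2.
  have := hK (- e); rewrite sqrrN; congr (N (_ + _) <= _).
  rewrite /x -scaleNr; congr (_ *: _).
  by apply/eqP; rewrite eq_complex /= oppr0 opprK !eqxx.
(* Telescoping from [u a u'] to [(1 + x) a (1 - x)], the product of the first-order expansions;
   [x a x] is its second-order part. *)
have -> : tau h e a - a - (0 +i* e) *: comm h a =
    (u - 1%:M - x) *m a *m u' + (1%:M + x) *m a *m (u' - 1%:M + x) - x *m a *m x.
  rewrite -commZl tauE !commE -/u -/u' -/x; move: (u) (u') (x) => *; nc_ring.
have Na := opn_ge0 HN a.
have b1 : N ((u - 1%:M - x) *m a *m u') <= K * e ^+ 2 * N a * 1.
  by apply: (opnM_le HN) => //; apply: (opnM_le HN).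
have b2 : N ((1%:M + x) *m a *m (u' - 1%:M + x)) <= (1 + N h) * N a * (K * e ^+ 2).
  apply: (opnM_le HN) => //; apply: (opnM_le HN) => //.
  by rewrite (le_trans (opnD HN _ _))// lerD// opn1.
have b3 : N (x *m a *m x) <= e * N h * N a * (e * N h).
  by apply: (opnM_le HN) => //; apply: (opnM_le HN).
apply: le_trans (opnB HN _ _) _; apply: le_trans (lerD (opnD HN _ _) (lexx _)) _.
apply: le_trans (lerD (lerD b1 b2) b3) _.
by rewrite le_eqVlt; apply/orP; left; apply/eqP; ring.
Qed.

(** Over a step [e] the two evolutions of the same matrix differ by [e [h - k, .]] up to second
    order; since [tau k] is an isometry, the differences of the steps add up without
    amplification. *)
Lemma tau_duhamel h k a t (M : R) : h \is hermsymmx -> k \is hermsymmx -> 0 <= t ->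
  (forall s, 0 <= s <= t -> N (comm (h - k) (tau h s a)) <= M) ->
  N (tau h t a - tau k t a) <= t * M.
Proof.
move=> hh kk t0 hM.
have [K K0 hK] := tau_taylor hh; have [K' K'0 hK'] := tau_taylor kk.
have step b e : 0 <= e <= 1 -> N (tau h e b - tau k e b) <=
    e * N (comm (h - k) b) + (K + K') * e ^+ 2 * N b.
  move=> e01; have /andP[e0 e1] := e01.
  have -> : tau h e b - tau k e b = (0 +i* e) *: comm (h - k) b +
     ((tau h e b - b - (0 +i* e) *: comm h b) -
      (tau k e b - b - (0 +i* e) *: comm k b)).
    rewrite commBl scalerBr.
    by move: (_ *: comm h b) (_ *: comm k b) (tau h e b) (tau k e b) => *; nc_ring.
  apply: le_trans (opnD HN _ _) _; apply: lerD.
    by rewrite (le_trans (opnZ HN _ _))// normc_imag ger0_norm.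
  have -> : (K + K') * e ^+ 2 * N b = K * e ^+ 2 * N b + K' * e ^+ 2 * N b by ring.
  by apply: le_trans (opnB HN _ _) _; apply: lerD; [exact: hK|exact: hK'].
apply: (@ler_add_inv_nat _ _ _ t ((K + K') * t ^+ 2 * N a)) => m m0 tm.
have m0' : 0 < m%:R :> R by rewrite ltr0n.
set e := t / m%:R.
have e01 : 0 <= e <= 1 by rewrite divr_ge0 //= ler_pdivrMr// mul1r.
have me : m%:R * e = t by rewrite /e mulrC mulfVK// gt_eqF.
have H j : (j <= m)%N -> N (tau h (j%:R * e) a - tau k (j%:R * e) a) <=
    j%:R * (e * M + (K + K') * e ^+ 2 * N a).
  elim: j => [_|j IH jm]; first by rewrite !mul0r !tau0 subrr (opn0 HN).
  set b := tau h (j%:R * e) a.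
  (* The new step compares [h] and [k] on [tau h (j e) a], where [hM] applies; the old difference is
     only transported by [tau k]. *)
  have -> : tau h (j.+1%:R * e) a - tau k (j.+1%:R * e) a =
      (tau h e b - tau k e b) + tau k e (b - tau k (j%:R * e) a).
    have -> : j.+1%:R * e = e + j%:R * e by rewrite -natr1 mulrDl mul1r addrC.
    rewrite (tauD h e) (tauD k e) -/b tauB.
    by rewrite addrA subrK.
  apply: le_trans (opnD HN _ _) _.
  rewrite -natr1 mulrDl mul1r addrC; apply: lerD.
    by rewrite opn_tau; apply: IH; exact: ltnW.
  apply: le_trans (step _ _ e01) _; apply: lerD.
    rewrite ler_wpM2l//; first by case/andP: e01.
    apply: hM; case/andP: e01 => e0 _.
    rewrite mulr_ge0// -me ler_wpM2r// ler_nat; exact: ltnW.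
  by rewrite opn_tau.
have := H m (leqnn m); rewrite me => /le_trans; apply.
rewrite le_eqVlt; apply/orP; left; apply/eqP; rewrite /e; field.
by rewrite gt_eqF.
Qed.

End Norm.
End Dynamics.

Section Hermitian.
Context {R : realType} {n : nat}.
Local Notation C := R[i].
Implicit Types (h : 'M[C]_n).

Lemma hermsymmxP h : reflect (h ^t* = h) (h \is hermsymmx).
Proof.
by rewrite is_hermitianmxE expr0 scale1r eq_sym; exact: eqP.
Qed.

Lemma hermsymmx0 : (0 : 'M[C]_n) \is hermsymmx.
Proof. by apply/hermsymmxP; rewrite trmx0 map_mx0. Qed.

Lemma hermsymmx_sum (I : eqType) (r : seq I) (P : pred I) (F : I -> 'M[C]_n) :
  (forall i, i \in r -> F i \is hermsymmx) ->
  \sum_(i <- r | P i) F i \is hermsymmx.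
Proof.
move=> HF; rewrite big_seq_cond; elim/big_rec : _ => [|i x /andP[ir _] hx].
  exact: hermsymmx0.
move: hx (HF i ir) => /hermsymmxP hx /hermsymmxP hi.
by apply/hermsymmxP; rewrite linearD /= map_mxD hx hi.
Qed.

End Hermitian.

(** A term that meets [X] is counted on the right at least once, at a common site. *)
Lemma ler_sum_meet (R : realType) (L : choiceType) (fam : seq {fset L})
    (X : {fset L}) (P : pred {fset L}) (f : {fset L} -> R) : (forall Z, 0 <= f Z) ->
  \sum_(Z <- fam | P Z && ~~ [disjoint Z & X]%fset) f Z <=
  \sum_(x <- X) \sum_(Z <- fam | P Z && (x \in Z)) f Z.
Proof.
move=> f0; under [leRHS]eq_bigr do rewrite big_mkcond.
rewrite exchange_big /= big_mkcond; apply: ler_sum => Z _.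
have nn x : 0 <= (if P Z && (x \in Z) then f Z else 0) by case: ifP.
case: ifP => [/andP[PZ]|_]; last by rewrite sumr_ge0.
rewrite -fsetI_eq0 => /fset0Pn[x]; rewrite inE => /andP[xZ xX].
rewrite (bigD1_seq x) ?fset_uniq//= PZ xZ /= lerDl.
by apply: sumr_ge0 => y _; have := nn y; rewrite PZ.
Qed.

(** * Interactions of finite range *)

Section FiniteRange.
Context {R : realType} {L : choiceType} {n : nat}.
Local Notation C := R[i].
Context (N : 'M[C]_n -> R) (HN : operator_norm N).
Context (fam : seq {fset L}) (hZ : {fset L} -> 'M[C]_n).
Context (loc : {fset L} -> 'M[C]_n -> Prop).
Hypothesis hZ_herm : forall Z, Z \in fam -> hZ Z \is hermsymmx.
Hypothesis hZ_loc : forall Z, Z \in fam -> loc Z (hZ Z).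
Hypothesis loc_disj : forall Z Y a b, [disjoint Z & Y]%fset ->
  loc Z a -> loc Y b -> comm a b = 0.
Hypothesis loc_fset0 : forall a b, loc fset0 a -> comm a b = 0.
Implicit Types (X Y Z : {fset L}) (a b : 'M[C]_n).

Let h := \sum_(Z <- fam) hZ Z.

Let h_herm : h \is hermsymmx. Proof. exact: hermsymmx_sum. Qed.

(* The part of the increment that commutes with the commutator itself, up to
   second order, acts by a unitary conjugation: only the terms of the Hamiltonian
   that meet [X], through their own commutators with [b], contribute. *)
Lemma comm_tau_step X : exists2 K, 0 <= K & forall a b t e,
  loc X a -> 0 <= e <= 1 ->
  N (comm (tau h (t + e) a) b) <= N (comm (tau h t a) b) +
    2 * e * N a * \sum_(Z <- fam | ~~ [disjoint Z & X]%fset) N (comm (tau h t (hZ Z)) b) +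
    K * e ^+ 2 * (N a * N b).
Proof.
set k := \sum_(Z <- fam | ~~ [disjoint Z & X]%fset) hZ Z.
have k_herm : k \is hermsymmx by exact: hermsymmx_sum.
have [K1 K10 hK1] := tau_taylor HN h_herm.
have [K2 K20 hK2] := expmx_taylor HN k_herm.
exists (2 * (2 * K2 + K2 ^+ 2 + N k ^+ 2) + 2 * K1).
  by rewrite !addr_ge0 ?mulr_ge0 ?addr_ge0 ?sqr_ge0 ?mulr_ge0.
move=> a b t e Xa /andP[e0 e1].
have commhk : comm h a = comm k a.
  rewrite /h (bigID (fun Z => [disjoint Z & X]%fset)) /= commDl comm_suml.
  rewrite big_seq_cond big1 ?add0r// => Z /andP[Zf ZX].
  exact: loc_disj ZX (hZ_loc Zf) Xa.
set T := tau h t; set F := comm (T a) b; set ie : C := 0 +i* e.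
set r := tau h e a - a - ie *: comm h a.
have Nr : N r <= K1 * e ^+ 2 * N a by apply: hK1; rewrite ?e0.
set x := ie *: T k.
(* Jacobi's identity splits [[[T k, T a], b]] into [[T k, F]], to be absorbed in a conjugation of
   [F], and the source term [[T a, [T k, b]]]. *)
have -> : comm (tau h (t + e) a) b =
    (F + comm x F) - ie *: comm (T a) (comm (T k) b) + comm (T r) b.
  have E : tau h (t + e) a = T a + ie *: comm (T k) (T a) + T r.
    rewrite tauD /T /r commhk !tauB tauZ tau_comm.
    by move: (tau h t a) (tau h t _) (_ *: _) => *; nc_ring.
  rewrite E !commDl commZl comm_jacobi scalerBr -/F /x commZl.
  by move: F (_ *: _) (_ *: _) (comm (T r) b) => *; nc_ring.
have Nie : Normc.normc ie = e by rewrite normc_imag ger0_norm.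
have NF : N F <= 2 * N a * N b.
  by rewrite (le_trans (opn_comm HN _ _))// (opn_tau HN).
have Nx : N x <= e * N k by rewrite (le_trans (opnZ HN _ _))// Nie (opn_tau HN).
(* [1 + i y T k] is within second order of a unitary, so its norm exceeds [1] only at second
   order. *)
have N1x y : `|y| = e -> N (1%:M + (0 +i* y) *: T k) <= 1 + K2 * e ^+ 2.
  move=> ye; rewrite -[X in X + _](tau1 h t) -tauZ -tau_add (opn_tau HN).
  have -> : 1%:M + (0 +i* y) *: k =
      expmx k y - (expmx k y - 1%:M - (0 +i* y) *: k) by nc_ring.
  rewrite (le_trans (opnB HN _ _))//; apply: lerD.
    exact/(opn_unitary HN)/expmx_unitary.
  by have := hK2 y; rewrite -real_normK ?num_real// ye.
have first_term : N (F + comm x F) <=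
    N F + (2 * K2 + K2 ^+ 2 + N k ^+ 2) * e ^+ 2 * (2 * N a * N b).
  (* [F + [x, F]] is [(1 + x) F (1 - x)] up to the second-order term [x F x]. *)
  have -> : F + comm x F =
      (1%:M + ie *: T k) *m F *m (1%:M + (0 +i* (- e)) *: T k) + x *m F *m x.
    have -> : (0 +i* (- e)) *: T k = - x.
      rewrite /x -scaleNr; congr (_ *: _).
      by apply/eqP; rewrite eq_complex /= oppr0 !eqxx.
    rewrite -/x commE; nc_ring.
  have b1 : N ((1%:M + ie *: T k) *m F *m (1%:M + (0 +i* (- e)) *: T k)) <=
      (1 + K2 * e ^+ 2) * N F * (1 + K2 * e ^+ 2).
    apply: (opnM_le HN); first apply: (opnM_le HN) => //.
      by apply: N1x; rewrite ger0_norm.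
    by apply: N1x; rewrite normrN ger0_norm.
  have b2 : N (x *m F *m x) <= e * N k * N F * (e * N k).
    by apply: (opnM_le HN) => //; apply: (opnM_le HN).
  apply: le_trans (opnD HN _ _) _; apply: le_trans (lerD b1 b2) _.
  have -> : (1 + K2 * e ^+ 2) * N F * (1 + K2 * e ^+ 2) + e * N k * N F * (e * N k) =
      N F + (2 * K2 + K2 ^+ 2 * e ^+ 2 + N k ^+ 2) * e ^+ 2 * N F by ring.
  rewrite lerD2l; apply: ler_pM => //; rewrite ?(opn_ge0 HN)//.
    by rewrite !mulr_ge0 ?addr_ge0 ?mulr_ge0 ?sqr_ge0 ?(opn_ge0 HN).
  rewrite ler_wpM2r ?sqr_ge0// lerD2r lerD2l ler_piMr ?sqr_ge0//.
  by rewrite expr_le1.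
have second_term : N (ie *: comm (T a) (comm (T k) b)) <= 2 * e * N a *
    \sum_(Z <- fam | ~~ [disjoint Z & X]%fset) N (comm (T (hZ Z)) b).
  rewrite (le_trans (opnZ HN _ _))// Nie [2 * e]mulrC -!mulrA ler_wpM2l// mulrA.
  rewrite (le_trans (opn_comm HN _ _))// (opn_tau HN).
  apply: ler_wpM2l; first by rewrite mulr_ge0 ?(opn_ge0 HN).
  by rewrite /T /k tau_sum comm_suml; exact: opn_sum.
have third_term : N (comm (T r) b) <= 2 * (K1 * e ^+ 2 * N a) * N b.
  rewrite (le_trans (opn_comm HN _ _))// (opn_tau HN).
  by rewrite ler_wpM2r ?(opn_ge0 HN)// ler_wpM2l.
apply: le_trans (opnD HN _ _) _.
apply: le_trans (lerD (opnB HN _ _) third_term) _.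
apply: le_trans (lerD (lerD first_term second_term) (lexx _)) _.
by rewrite le_eqVlt; apply/orP; left; apply/eqP; ring.
Qed.

(** The hypothesis on [kappa] makes the weight [S] a supersolution of the recursion in
    [comm_tau_step]: a bound by the weight of the region reproduces itself at each step with the
    factor [1 + 2 kappa e]. *)
Lemma comm_tau_weight (S : L -> R) (kappa : R) X a b t :
  (forall x, 0 < S x) -> 0 <= kappa ->
  (forall x, \sum_(Z <- fam | x \in Z) N (hZ Z) * \sum_(z <- Z) S z <= kappa * S x) ->
  (forall Y c, Y \in X :: fam -> loc Y c ->
     N (comm c b) <= 2 * N c * N b * \sum_(x <- Y) S x) ->
  loc X a -> 0 <= t ->
  N (comm (tau h t a) b) <=
    2 * N a * N b * expR (2 * kappa * t) * \sum_(x <- X) S x.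
Proof.
move=> S0 kappa0 hS init Xa t0.
have nnS Y : 0 <= \sum_(x <- Y) S x by rewrite sumr_ge0// => x _; exact: ltW.
(* The recursion passes from [X] to the regions of [fam], so one error constant must serve this
   whole finite list. *)
have [K K0 hK] : exists2 K, 0 <= K & forall Y c b' s e,
    Y \in X :: fam -> loc Y c -> 0 <= e <= 1 ->
    N (comm (tau h (s + e) c) b') <= N (comm (tau h s c) b') +
    2 * e * N c * \sum_(Z <- fam | ~~ [disjoint Z & Y]%fset) N (comm (tau h s (hZ Z)) b') +
    K * e ^+ 2 * (N c * N b').
  elim: (X :: fam) => [|Y l [K K0 hK]]; first by exists 0.
  have [K' K'0 hK'] := comm_tau_step Y; exists (K + K'); first exact: addr_ge0.
  have nn c b' e : 0 <= e ^+ 2 * (N c * N b').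
    by rewrite mulr_ge0 ?sqr_ge0 ?mulr_ge0 ?(opn_ge0 HN).
  move=> Y' c b' s e; rewrite inE => /predU1P[->|Y'l] Y'c e01.
    rewrite (le_trans (hK' _ _ _ _ Y'c e01))// lerD2l -[leLHS]mulrA -[leRHS]mulrA.
    by apply: ler_wpM2r; [exact: nn|rewrite lerDr].
  rewrite (le_trans (hK _ _ _ _ _ Y'l Y'c e01))// lerD2l -[leLHS]mulrA -[leRHS]mulrA.
  by apply: ler_wpM2r; [exact: nn|rewrite lerDl].
(* A positive lower bound on the weights turns the second-order error, which carries no weight, into
   a multiple of the weight. *)
have [m m0 hm] : exists2 m, 0 < m & forall Y, Y \in X :: fam -> Y != fset0 ->
    m <= \sum_(x <- Y) S x.
  elim: (X :: fam) => [|Y l [m m0 hm]]; first by exists 1.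
  have [->|/fset0Pn[y yY]] := eqVneq Y fset0.
    exists m => // Y'; rewrite inE => /predU1P[->|/hm//]; by rewrite eqxx.
  exists (Num.min m (S y)); first by rewrite lt_min m0 S0.
  move=> Y'; rewrite inE => /predU1P[->|Y'l] Y'0; last first.
    by rewrite ge_min hm.
  rewrite ge_min; apply/orP; right; rewrite (bigD1_seq y)//= lerDl.
  by rewrite sumr_ge0// => x _; exact: ltW.
apply: (@ler_add_inv_nat _ _ _ t (expR (2 * kappa * t) * (K * N b / m * t ^+ 2) * (N a * \sum_(x <- X) S x))) => p p0 tp.
have p0' : 0 < p%:R :> R by rewrite ltr0n.
set e := t / p%:R.
have e01 : 0 <= e <= 1 by rewrite divr_ge0 //= ler_pdivrMr// mul1r.
have /andP[e0 _] := e01.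
have pe : p%:R * e = t by rewrite /e mulrC mulfVK// gt_eqF.
pose A := expR (2 * kappa * e).
have A1 : 1 <= A by rewrite -expR0 ler_expR !mulr_ge0.
(* Growth factor after [j] steps, times the initial constant plus [j] second-order errors. *)
pose u j := A ^+ j * (2 * N b + j%:R * (K * N b / m * e ^+ 2)).
have u0 j : 0 <= u j.
  rewrite /u mulr_ge0 ?exprn_ge0 ?expR_ge0// addr_ge0 ?mulr_ge0 ?sqr_ge0 ?(opn_ge0 HN)//.
  by rewrite invr_ge0 ltW.
have H j Y c : Y \in X :: fam -> loc Y c ->
    N (comm (tau h (j%:R * e) c) b) <= u j * (N c * \sum_(x <- Y) S x).
  elim: j Y c => [|j IH] Y c YX Yc.
    rewrite /u !mul0r addr0 tau0 expr0 mul1r.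
    by apply: le_trans (init _ _ YX Yc) _; rewrite le_eqVlt; apply/orP; left; apply/eqP; ring.
  have [Y0|Y0] := eqVneq Y fset0.
    (* The weight of the empty region is [0] and cannot absorb any error; but then [c] commutes with
       everything and does not evolve. *)
    have c0 b' : comm c b' = 0 by apply: loc_fset0; rewrite -Y0.
    have cb b' : c *m b' = b' *m c by apply/eqP; rewrite -subr_eq0 -commE c0.
    have -> : tau h (j.+1%:R * e) c = c.
      rewrite tauE -cb; move: (expmxNK h (j.+1%:R * e)).
      move: (expmx _ _) (expmx _ _) => v v' vv'.
      by rewrite -mulmxA vv' mulmx1.
    by rewrite c0 (opn0 HN) mulr_ge0 ?u0// mulr_ge0 ?(opn_ge0 HN).
  rewrite -natr1 mulrDl mul1r.
  apply: le_trans (hK _ _ b (j%:R * e) e YX Yc e01) _.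
  have s1 : \sum_(Z <- fam | ~~ [disjoint Z & Y]%fset)
      N (comm (tau h (j%:R * e) (hZ Z)) b) <= u j * (kappa * \sum_(x <- Y) S x).
    apply: (@le_trans _ _ (u j * \sum_(Z <- fam | ~~ [disjoint Z & Y]%fset)
        (N (hZ Z) * \sum_(z <- Z) S z))).
      rewrite mulr_sumr big_seq_cond [leRHS]big_seq_cond; apply: ler_sum => Z /andP[Zf _].
      by apply: IH; [rewrite inE Zf orbT|exact: hZ_loc].
    rewrite ler_wpM2l// mulr_sumr.
    apply: (@le_trans _ _ (\sum_(x <- Y) \sum_(Z <- fam | x \in Z)
        (N (hZ Z) * \sum_(z <- Z) S z))).
      by apply: (@ler_sum_meet _ _ _ _ predT) => Z; rewrite mulr_ge0 ?(opn_ge0 HN).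
    by apply: ler_sum => x _.
  have s2 : K * e ^+ 2 * (N c * N b) <=
      K * N b / m * e ^+ 2 * (N c * \sum_(x <- Y) S x).
    have -> : K * e ^+ 2 * (N c * N b) = K * N b / m * e ^+ 2 * (N c * m).
      by field; rewrite gt_eqF.
    rewrite ler_wpM2l ?mulr_ge0 ?sqr_ge0 ?(opn_ge0 HN) ?invr_ge0 ?(ltW m0)//.
    by rewrite ler_wpM2l ?(opn_ge0 HN)// hm.
  set SY := \sum_(x <- Y) S x in s1 s2 *.
  have nSY0 : 0 <= SY by exact: nnS.
  have nSY : 0 <= N c * SY by rewrite mulr_ge0 ?(opn_ge0 HN).
  apply: (@le_trans _ _ ((u j * (1 + 2 * kappa * e) + K * N b / m * e ^+ 2) * (N c * SY))).
    rewrite [leRHS]mulrDl; apply: lerD => //.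
    apply: (@le_trans _ _ (u j * (N c * SY) + 2 * e * N c * (u j * (kappa * SY)))).
      apply: lerD; first exact: IH.
      by rewrite ler_wpM2l// !mulr_ge0 ?(opn_ge0 HN).
    by rewrite le_eqVlt; apply/orP; left; apply/eqP; ring.
  rewrite ler_wpM2r//.
  have nK : 0 <= K * N b / m * e ^+ 2.
    by rewrite !mulr_ge0 ?sqr_ge0 ?(opn_ge0 HN) ?invr_ge0 ?(ltW m0).
  have eA : 1 + 2 * kappa * e <= A by exact: expR_ge1Dx.
  apply: (@le_trans _ _ (u j * A + A ^+ j.+1 * (K * N b / m * e ^+ 2))).
    apply: lerD; first by rewrite ler_wpM2l.
    by rewrite ler_peMl// exprn_ege1.
  by rewrite /u le_eqVlt -natr1 [A ^+ j.+1]exprS; apply/orP; left; apply/eqP; ring.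
have := H p X a (mem_head _ _) Xa; rewrite pe => /le_trans; apply.
have Ap : A ^+ p = expR (2 * kappa * t).
  by rewrite -expRM_natl -mulrA; congr expR; rewrite -pe; ring.
rewrite /u Ap le_eqVlt; apply/orP; left; apply/eqP; rewrite /e; field.
by rewrite !gt_eqF.
Qed.

End FiniteRange.

(** * Counting sites *)

Section LatticeDistance.
Context {R : realType} {d : nat} {L : choiceType} (pos : L -> 'rV[R]_d).
Implicit Types (x y z : L) (X V : {fset L}).

Local Notation dist := (dist pos).

Lemma dist_ge0 x y : 0 <= dist x y.
Proof. exact: sqrtr_ge0. Qed.

Lemma dist_sym x y : dist x y = dist y x.
Proof. by congr Num.sqrt; apply: eq_bigr => i _; rewrite -sqrrN opprB. Qed.

Lemma distxx x : dist x x = 0.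
Proof.
rewrite /dist (_ : \sum_(i < d) _ = 0) ?sqrtr0//.
by apply: big1 => i _; rewrite subrr expr0n.
Qed.

(** Young's inequality with ratio [v / u], where [u] and [v] slightly exceed the two distances in
    order to be positive. *)
Lemma dist_triangle x y z : dist x z <= dist x y + dist y z.
Proof.
apply/ler_addgt0Pr => e e0.
set u := dist x y + e / 2; set v := dist y z + e / 2.
have e2 : 0 < e / 2 by rewrite divr_gt0.
have u0 : 0 < u by rewrite ltr_wpDl ?dist_ge0.
have v0 : 0 < v by rewrite ltr_wpDl ?dist_ge0.
have -> : dist x y + dist y z + e = u + v by rewrite /u /v; field.
have sq (A : 'I_d -> R) : 0 <= \sum_i A i ^+ 2 by rewrite sumr_ge0// => i _; rewrite sqr_ge0.
have hu : \sum_(i < d) (pos x 0 i - pos y 0 i) ^+ 2 <= u ^+ 2.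
  rewrite -(sqr_sqrtr (sq _)) -/(dist x y) ler_pXn2r ?nnegrE ?dist_ge0 ?(ltW u0)//.
  by rewrite lerDl ltW.
have hv : \sum_(i < d) (pos y 0 i - pos z 0 i) ^+ 2 <= v ^+ 2.
  rewrite -(sqr_sqrtr (sq _)) -/(dist y z) ler_pXn2r ?nnegrE ?dist_ge0 ?(ltW v0)//.
  by rewrite lerDl ltW.
rewrite -(ger0_norm (ltW (addr_gt0 u0 v0))) -sqrtr_sqr ler_wsqrtr//.
apply: (@le_trans _ _ (\sum_(i < d) ((1 + v / u) * (pos x 0 i - pos y 0 i) ^+ 2 +
    (1 + u / v) * (pos y 0 i - pos z 0 i) ^+ 2))).
  apply: ler_sum => i _; move: (pos x 0 i) (pos y 0 i) (pos z 0 i) => a b c.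
  rewrite -subr_ge0 (_ : _ - _ = (v * (a - b) - u * (b - c)) ^+ 2 / (u * v)).
    by rewrite divr_ge0 ?sqr_ge0// mulr_ge0// ltW.
  by field; rewrite !gt_eqF.
rewrite big_split /= -!mulr_sumr.
apply: (@le_trans _ _ ((1 + v / u) * u ^+ 2 + (1 + u / v) * v ^+ 2)).
  by apply: lerD; apply: ler_wpM2l; rewrite ?addr_ge0 ?divr_ge0 ?(ltW u0) ?(ltW v0).
by rewrite le_eqVlt; apply/orP; left; apply/eqP; field; rewrite !gt_eqF.
Qed.

Section Separated.
Hypothesis d1 : (1 <= d)%N.
Hypothesis sep : forall x y : L, x != y -> 1 <= dist x y.

(* Sites in a common cube of side 1/d are at distance less than 1. *)
Lemma card_ball : exists2 c : R, 0 < c & forall x V (r : R), 1 <= r ->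
  (forall z, z \in V -> dist x z < r) -> (#|` V|%fset)%:R <= c * r ^+ d.
Proof.
have d0 : 0 < d%:R :> R by rewrite ltr0n.
(* Coordinates scaled by [d] and shifted by [m <= d r + 1] lie between [0] and [2 m]; the cells
   number at most [(2 m + 1) ^ d], and [2 m + 1 <= (2 d + 3) r] because [1 <= r]. *)
exists ((2 * d%:R + 3) ^+ d); first by rewrite exprn_gt0// addr_gt0// mulr_gt0.
move=> x V r r1 hV.
have r0 : 0 <= r by exact: le_trans r1.
have [m m1 m2] : exists2 m : nat, m%:R <= d%:R * r + 1 & d%:R * r < m%:R.
  have /andP[h1 h2] : (Num.truncn (d%:R * r))%:R <= d%:R * r < (Num.truncn (d%:R * r)).+1%:R.
    by apply: truncn_itv; rewrite mulr_ge0// ltW.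
  by exists (Num.truncn (d%:R * r)).+1 => //; rewrite -natr1 lerD2r.
pose u z i : R := d%:R * (pos z 0 i - pos x 0 i) + m%:R.
have u_itv z i : z \in V -> 0 <= u z i < (2 * m)%:R.
  move=> zV; have : `|pos z 0 i - pos x 0 i| < r.
    apply: le_lt_trans (hV _ zV); rewrite -sqrtr_sqr ler_wsqrtr//.
    by rewrite (bigD1 i)//= -sqrrN opprB lerDl sumr_ge0// => j _; rewrite sqr_ge0.
  rewrite ltr_norml => /andP[h1 h2]; rewrite /u.
  have : d%:R * (pos z 0 i - pos x 0 i) < m%:R.
    by apply: le_lt_trans m2; rewrite ler_pM2l// ltW.
  have : - m%:R < d%:R * (pos z 0 i - pos x 0 i).
    by rewrite ltrNl -mulrN; apply: le_lt_trans m2; rewrite ler_pM2l// lerNl ltW.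
  by rewrite natrM; lra.
pose f (z : V) : {ffun 'I_d -> 'I_(2 * m).+1} := [ffun i => inord (Num.truncn (u (val z) i))].
have finj : injective f.
  move=> z z' /ffunP fz; apply/val_inj/eqP; apply: contraT => zz'.
  have := sep zz'; rewrite leNgt => /negP[].
  have close i : `|pos (val z) 0 i - pos (val z') 0 i| < d%:R^-1.
    have := fz i; rewrite !ffunE => /(congr1 (@nat_of_ord _)).
    have /andP[a0 a1] := u_itv _ i (valP z).
    have /andP[b0 b1] := u_itv _ i (valP z').
    have ta : (Num.truncn (u (val z) i) < (2 * m).+1)%N.
      by rewrite truncn_lt_nat// (lt_trans a1)// ltr_nat.
    have tb : (Num.truncn (u (val z') i) < (2 * m).+1)%N.
      by rewrite truncn_lt_nat// (lt_trans b1)// ltr_nat.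
    rewrite !inordK// => e.
    have := truncn_itv a0; have := truncn_itv b0; rewrite e /u -natr1.
    move: (Num.truncn _)%:R => k /andP[k1 k2] /andP[k3 k4].
    rewrite -(ltr_pM2l d0) divff ?gt_eqF// -[X in X * `|_|]ger0_norm ?(ltW d0)// -normrM.
    by rewrite ltr_norml mulrBr; apply/andP; split; lra.
  rewrite -[ltRHS]sqrtr1 ltr_sqrt//.
  apply: (@lt_le_trans _ _ (\sum_(i < d) d%:R^-1)); last first.
    by rewrite sumr_const card_ord -[X in X <= _]mulr_natl divff// gt_eqF.
  have [i0 _] : exists i : 'I_d, true by exists (Ordinal d1).
  have lt1 i : (pos (val z) 0 i - pos (val z') 0 i) ^+ 2 < d%:R^-1.
    rewrite -real_normK ?num_real//.
    apply: (@le_lt_trans _ _ `|pos (val z) 0 i - pos (val z') 0 i|) => //.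
    rewrite expr2 ler_piMr// (le_trans (ltW (close i)))// invf_le1//.
    by rewrite ler1n.
  rewrite (bigD1 i0)//= [ltRHS](bigD1 i0)//= ltr_leD//.
  by apply: ler_sum => i _; exact: ltW.
have : (#|` V|%fset <= ((2 * m).+1) ^ d)%N.
  by rewrite cardfE; have := leq_card f finj; rewrite card_ffun !card_ord.
rewrite -(ler_nat R) => /le_trans; apply; rewrite natrX -exprMn.
apply: lerXn2r.
- by rewrite nnegrE ler0n.
- by rewrite nnegrE mulr_ge0// addr_ge0// mulr_ge0// ltW.
by rewrite -[X in X <= _]natr1 natrM; lra.
Qed.

(** Dyadic shells: the shell from [r] to [2 r] has at most about [r ^ d] sites, and each doubling of
    [r] gains the factor [2 ^ (d - a) < 1]. *)
Lemma shell_sum (a : R) : d%:R < a -> exists2 c : R, 0 < c &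
  forall x V (r : R), 1 <= r -> (forall z, z \in V -> r <= dist x z) ->
  \sum_(z <- V) dist x z `^ (- a) <= c * r `^ (d%:R - a).
Proof.
move=> da; have [c0 c00 hc0] := card_ball.
have q1 : 2 `^ (d%:R - a) < 1 :> R.
  rewrite -opprB powRN invf_lt1 ?powR_gt0//.
  have := @gt0_ltr_powR R (a - d%:R); rewrite subr_gt0 => /(_ da 1 2).
  by rewrite powR1 !nnegrE ler01 ler0n ltr1n => /(_ isT isT isT).
(* Fixed point of the geometric recursion: [c0 2 ^ d + A 2 ^ (d - a) = A]. *)
set A := c0 * 2 ^+ d / (1 - 2 `^ (d%:R - a)).
have A0 : 0 < A by rewrite divr_gt0 ?mulr_gt0 ?exprn_gt0// subr_gt0.
exists A => // x.
have H K : forall V (r : R), 1 <= r ->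
    (forall z, z \in V -> r <= dist x z < 2 ^+ K * r) ->
    \sum_(z <- V) dist x z `^ (- a) <= A * r `^ (d%:R - a).
  elim: K => [|K IH] V r r1 hV.
    rewrite big_seq big1 => [|z /hV]; first by apply: mulr_ge0; [exact: ltW|exact: powR_ge0].
    by rewrite expr0 mul1r => /andP[/le_lt_trans h /h]; rewrite ltxx.
  have r0 : 0 < r by exact: lt_le_trans r1.
  rewrite (bigID (fun z => dist x z < 2 * r)) /= [X in X + _]big_fset_condE.
  rewrite [X in _ + X]big_fset_condE.
  have r21 : 1 <= 2 * r by rewrite (le_trans r1)// ler_peMl ?(ltW r0)// ler1n.
  have b1 : \sum_(i <- [fset i in V | (dist x i < 2 * r)%R]%fset) dist x i `^ (- a) <=
      c0 * (2 * r) ^+ d * r `^ (- a).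
    apply: (@le_trans _ _ (\sum_(i <- [fset i in V | (dist x i < 2 * r)%R]%fset) r `^ (- a))).
      rewrite big_seq [leRHS]big_seq; apply: ler_sum => z.
      rewrite !inE /= => /andP[/hV /andP[rz _] _].
      rewrite !powRN lef_pV2 ?posrE ?powR_gt0 ?(lt_le_trans r0 rz)//.
      by rewrite ge0_ler_powR ?nnegrE ?dist_ge0 ?(ltW r0)// (le_trans _ (ltW da)).
    rewrite big_const_seq count_predT iter_addr addr0 -[leLHS]mulr_natl.
    rewrite ler_wpM2r ?powR_ge0//; apply: (hc0 x) => // z.
    by rewrite !inE /= => /andP[].
  have b2 : \sum_(i <- [fset i in V | ~~ (dist x i < 2 * r)%R]%fset) dist x i `^ (- a) <=
      A * (2 * r) `^ (d%:R - a).
    apply: IH => // z; rewrite !inE /= -leNgt => /andP[/hV /andP[_ z2] ->] /=.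
    by rewrite mulrA -exprSr.
  apply: le_trans (lerD b1 b2) _.
  rewrite powRM ?(ltW r0)// exprMn -(powR_mulrn d (ltW r0)).
  have -> : c0 * (2 ^+ d * r `^ d%:R) * r `^ (- a) = c0 * 2 ^+ d * r `^ (d%:R - a).
    by rewrite [r `^ (d%:R - a)]powRD; [ring|rewrite (gt_eqF r0) implybT].
  rewrite le_eqVlt; apply/orP; left; apply/eqP; rewrite /A; field.
  by rewrite subr_eq0 gt_eqF.
move=> V r r1 hV.
(* [V] is finite, so finitely many shells cover it; their number does not enter the bound. *)
pose B := \sum_(z <- V) dist x z.
apply: (H (Num.truncn B).+1) => // z zV; rewrite hV//=.
have zB : dist x z <= B.
  by rewrite /B (bigD1_seq z) ?fset_uniq//= lerDl sumr_ge0// => y _; exact: dist_ge0.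
apply: le_lt_trans zB _; apply: lt_le_trans (truncnS_gt B) _.
apply: (@le_trans _ _ (2 ^+ (Num.truncn B).+1)).
  by rewrite -natrX ler_nat ltnW// ltn_expl.
by rewrite ler_peMr// exprn_ge0.
Qed.

End Separated.

Lemma fset_dist_min X : X != fset0 -> exists f : L -> R, forall z,
  (exists2 x, x \in X & f z = dist x z) /\ (forall x, x \in X -> f z <= dist x z).
Proof.
move=> /fset0Pn[x0 x0X].
suff H z : exists r, (exists2 x, x \in X & r = dist x z) /\
    (forall x, x \in X -> r <= dist x z) by have [f hf] := boolp.choice H; exists f.
have [x xX xmin] := @arg_minP _ _ _ [` x0X]%fset predT (fun x : X => dist (val x) z) isT.
exists (dist (val x) z); split; first by exists (val x) => //; exact: valP.
by move=> y yX; exact: (xmin [` yX]%fset).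
Qed.

End LatticeDistance.

(** * Local observables of a finite volume *)

Section NormInstance.
Context {R : realType} {L : choiceType} {q : L -> nat}.
Local Notation C := R[i].
Local Notation mxop Z := 'M[R[i]]_#|lconf q Z|.
Implicit Types (Z W Y : {fset L}).

Definition mxnorm Z (a : mxop Z) : R := fine (opnorm (amplify a)).

Lemma sum_enum_rank (V : nmodType) Z (F : 'I_#|lconf q Z| -> V) :
  \sum_i F i = \sum_(c : lconf q Z) F (enum_rank c).
Proof. by rewrite (reindex (@enum_rank (lconf q Z)))//; apply: onW_bij; exact: enum_rank_bij. Qed.

Lemma amplify_fin Z (a : mxop Z) : opnorm (amplify a) \is a fin_num.
Proof.
(* [A c] is the [l^1] norm of a row; every entry of [v] is at most the [l^2] norm of [v]. *)
pose A (c : lconf q Z) : R := \sum_c' Normc.normc (a (enum_rank c) (enum_rank c')).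
have A0 c : 0 <= A c by apply: sumr_ge0 => c' _; exact: normc_ge0.
have S0 : 0 <= \sum_c A c ^+ 2 by apply: sumr_ge0 => c _; exact: sqr_ge0.
apply: (@opnorm_fin _ _ _ _ (Num.sqrt (\sum_c A c ^+ 2))); first exact: sqrtr_ge0.
apply: amplify_bounded; rewrite ?sqrtr_ge0// => v; rewrite sqr_sqrtr// mulr_suml.
apply: ler_sum => c _.
set s := \sum_c' Normc.normc (v c') ^+ 2.
have s0 : 0 <= s by apply: sumr_ge0 => c' _; exact: sqr_ge0.
rewrite -(sqr_sqrtr s0) -exprMn ler_pXn2r ?nnegrE ?normc_ge0 ?mulr_ge0 ?sqrtr_ge0//.
apply: le_trans (ler_normc_sum _ _ _) _; rewrite mulr_suml; apply: ler_sum => c' _.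
rewrite Normc.normcM ler_wpM2l ?normc_ge0//.
rewrite -[leLHS]ger0_norm ?normc_ge0// -sqrtr_sqr ler_wsqrtr//.
by rewrite /s (bigD1 c')//= lerDl sumr_ge0// => *; exact: sqr_ge0.
Qed.

Lemma mxnormE Z (a : mxop Z) : (mxnorm a)%:E = opnorm (amplify a).
Proof. by rewrite fineK// amplify_fin. Qed.

Lemma mxnorm_ge0 Z (a : mxop Z) : 0 <= mxnorm a.
Proof. by rewrite fine_ge0// opnorm_ge0. Qed.

Lemma mxnorm_le Z (a : mxop Z) M : 0 <= M -> mxnorm a <= M <-> bounded_by (amplify a) M.
Proof. by move=> M0; rewrite -lee_fin mxnormE; exact: opnorm_le. Qed.

Lemma mxnorm_bounded Z (a : mxop Z) : bounded_by (amplify a) (mxnorm a).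
Proof. by apply/mxnorm_le => //; exact: mxnorm_ge0. Qed.

Lemma unitary_l2 n (u : 'M[C]_n) (x : 'cV[C]_n) : u \is unitarymx ->
  \sum_i Normc.normc ((u *m x) i 0) ^+ 2 = \sum_i Normc.normc (x i 0) ^+ 2.
Proof.
move=> /unitarymxP /mulmx1C uu.
have E (y : 'cV[C]_n) : (\sum_i Normc.normc (y i 0) ^+ 2)%:C = (y ^t* *m y) 0 0.
  rewrite mxE rmorph_sum /=; apply: eq_bigr => i _; rewrite !mxE.
  by rewrite rmorphXn /= (normc_abs (y i 0)) mulrC -normCK.
apply: complexI; rewrite !E trmx_mul map_mxM -!mulmxA; congr ((_ *m _) 0 0).
by rewrite mulmxA uu mul1mx.
Qed.

Lemma mxnorm_operator_norm Z : operator_norm (@mxnorm Z).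
Proof.
have nn := @mxnorm_ge0 Z.
split => //.
- move=> a b; apply/mxnorm_le; first by rewrite addr_ge0.
  by rewrite amplifyD; apply: bounded_by_add => //; exact: mxnorm_bounded.
- move=> c a; apply/mxnorm_le; first by rewrite mulr_ge0// normc_ge0.
  by rewrite amplifyZ; apply: bounded_by_scale; exact: mxnorm_bounded.
- move=> a b; apply/mxnorm_le; first by rewrite mulr_ge0.
  by rewrite amplifyM; apply: bounded_by_comp; exact: mxnorm_bounded.
- move=> u uu; apply/mxnorm_le => //; apply: amplify_bounded => // v.
  rewrite expr1n mul1r.
  pose x : 'cV[C]_#|lconf q Z| := \col_i v (enum_val i).
  have := unitary_l2 x uu; rewrite !sum_enum_rank => e.
  rewrite le_eqVlt; apply/orP; left; apply/eqP; transitivity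
    (\sum_(c : lconf q Z) Normc.normc (x (enum_rank c) 0) ^+ 2); last first.
    by apply: eq_bigr => c _; rewrite mxE enum_rankK.
  rewrite -e; apply: eq_bigr => c _; congr (Normc.normc _ ^+ 2).
  by rewrite mxE sum_enum_rank; apply: eq_bigr => c' _; rewrite mxE enum_rankK.
Qed.

Lemma mxnorm_mx_of Z W (a : mxop Z) : (Z `<=` W)%fset ->
  mxnorm (mx_of W (amplify a)) = mxnorm a.
Proof. by move=> ZW; rewrite /mxnorm amplify_mx_of. Qed.

(** An entry of the enlarged matrix is an entry of [a] times the indicator that the two
    configurations agree outside [Z], and this indicator is symmetric. *)
Lemma mx_of_hermsymmx Z W (a : mxop Z) : (Z `<=` W)%fset ->
  a \is hermsymmx -> mx_of W (amplify a) \is hermsymmx.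
Proof.
move=> /fsubsetP ZW /hermsymmxP ha.
pose lift (c : lconf q W) := patch_conf c ground.
pose r (c : lconf q W) := restr_conf Z (lift c).
have E (c c' : lconf q W) : mx_of W (amplify a) (enum_rank c) (enum_rank c') =
    a (enum_rank (r c)) (enum_rank (r c')) *
    (restr_conf W (patch_conf (r c') (lift c)) == c')%:R.
  rewrite mx_ofE /amplify (bigD1 (r c'))//= big1 ?addr0// => c0 c0c'.
  rewrite /indicator_state; case: eqP => [e|_]; last by rewrite mulr0.
  move: c0c'; rewrite -e /r /lift => /eqP[].
  rewrite -{1}(restr_patch c0 (patch_conf c ground)); apply: eq_restr => x xZ.
  by rewrite [RHS]patch_in ?ZW// => xW; rewrite ffunE.
have sym (c c' : lconf q W) : restr_conf W (patch_conf (r c') (lift c)) = c' ->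
    restr_conf W (patch_conf (r c) (lift c')) = c.
  move=> e; rewrite -[RHS](restr_patch c ground); apply: eq_restr => x xW.
  have [xZ|xZ] := boolP (x \in Z); first by rewrite patch_in ffunE.
  rewrite patch_out// /lift -e patch_in ffunE patch_out//.
apply/hermsymmxP/matrixP => i j; rewrite -(enum_valK i) -(enum_valK j).
rewrite mxE [X in Num.conj X]mxE !E rmorphM rmorph_nat; congr (_ * _%:R).
  by move/matrixP : ha => /(_ (enum_rank (r (enum_val i))) (enum_rank (r (enum_val j)))); rewrite !mxE.
by congr nat_of_bool; apply/eqP/eqP; exact: sym.
Qed.

Definition loc W Z (a : mxop W) : Prop := local_on Z (amplify a).

Lemma loc_self W (a : mxop W) : loc W a.
Proof. by exists a. Qed.

Lemma loc_comm W Z Y (a b : mxop W) : [disjoint Z & Y]%fset ->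
  loc Z a -> loc Y b -> comm a b = 0.
Proof.
move=> ZY [a' aa'] [b' bb']; rewrite commE; apply/eqP; rewrite subr_eq0; apply/eqP.
by apply: amplify_inj; rewrite !amplifyM aa' bb'; exact: amplify_comm.
Qed.

Lemma loc_fset0_comm W (a b : mxop W) : loc fset0 a -> comm a b = 0.
Proof. by move=> a0; apply: loc_comm a0 (loc_self b); exact: fdisjoint0X. Qed.

Lemma loc_mx_of W Z (a : mxop Z) : (Z `<=` W)%fset -> loc Z (mx_of W (amplify a)).
Proof. by move=> ZW; exists a; rewrite amplify_mx_of. Qed.

Lemma local_onW Z W (T : @operator R L q) : (Z `<=` W)%fset -> local_on Z T -> local_on W T.
Proof. by move=> ZW [a ->]; exists (mx_of W (amplify a)); rewrite amplify_mx_of. Qed.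

Lemma loc0 W Z : loc Z (0 : mxop W).
Proof.
exists (0 : mxop Z); apply/funext => psi; apply/funext => s.
by rewrite /amplify !big1// => c _; rewrite mxE mul0r.
Qed.

Lemma locZ W Z (k : C) (a : mxop W) : loc Z a -> loc Z (k *: a).
Proof. by move=> [b e]; exists (k *: b); rewrite !amplifyZ e. Qed.

End NormInstance.

(** * Counting sites by their distance to a finite region *)

Section DistanceToSet.
Context {R : realType} {d : nat} {L : choiceType} (pos : L -> 'rV[R]_d).
Hypothesis d1 : (1 <= d)%N.
Hypothesis sep : forall x y : L, x != y -> 1 <= dist pos x y.
Context (X : {fset L}) (f : L -> R).
Hypothesis fP : forall z, (exists2 x, x \in X & f z = dist pos x z) /\
  (forall x, x \in X -> f z <= dist pos x z).

Lemma card_near : exists2 c : R, 0 < c & forall (V : {fset L}) (r : R), 1 <= r ->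
  (forall z, z \in V -> f z < r) -> (#|` V|%fset)%:R <= c * r ^+ d.
Proof.
have [c c0 hc] := card_ball d1 sep.
exists ((#|` X|%fset)%:R * c + 1); first by rewrite ltr_pwDr// mulr_ge0// ltW.
move=> V r r1 hV; have r0 : 0 < r by exact: lt_le_trans r1.
apply: (@le_trans _ _ (\sum_(x <- X) c * r ^+ d)); last first.
  rewrite big_const_seq count_predT iter_addr addr0 -[leLHS]mulr_natl mulrA.
  by rewrite ler_wpM2r ?exprn_ge0 ?(ltW r0)// lerDl.
have -> : (#|` V|%fset)%:R = \sum_(z <- V) (1 : R).
  by rewrite big_const_seq count_predT iter_addr addr0.
apply: (@le_trans _ _ (\sum_(x <- X) \sum_(z <- V | dist pos x z < r) (1 : R))).
  under [leRHS]eq_bigr do rewrite big_mkcond.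
  rewrite exchange_big /= big_seq [leRHS]big_seq; apply: ler_sum => z zV.
  have [[x xX fx] _] := fP z; rewrite (bigD1_seq x) ?fset_uniq//= -fx hV//.
  by rewrite lerDl sumr_ge0// => y _; case: ifP.
apply: ler_sum => x _; rewrite big_fset_condE.
rewrite big_const_seq count_predT iter_addr addr0; apply: (hc x) => // z.
by rewrite !inE => /andP[].
Qed.

Lemma shell_near (a : R) : d%:R < a -> exists2 c : R, 0 < c &
  forall (V : {fset L}) (r : R), 1 <= r -> (forall z, z \in V -> r <= f z) ->
  \sum_(z <- V) f z `^ (- a) <= c * r `^ (d%:R - a).
Proof.
move=> da; have [c c0 hc] := shell_sum d1 sep da.
exists ((#|` X|%fset)%:R * c + 1); first by rewrite ltr_pwDr// mulr_ge0// ltW.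
move=> V r r1 hV; have r0 : 0 < r by exact: lt_le_trans r1.
apply: (@le_trans _ _ (\sum_(x <- X) c * r `^ (d%:R - a))); last first.
  rewrite big_const_seq count_predT iter_addr addr0 -[leLHS]mulr_natl mulrA.
  by rewrite ler_wpM2r ?powR_ge0// lerDl.
apply: (@le_trans _ _ (\sum_(x <- X) \sum_(z <- V) dist pos x z `^ (- a))).
  rewrite exchange_big /= big_seq [leRHS]big_seq; apply: ler_sum => z zV.
  have [[x xX ->] _] := fP z; rewrite (bigD1_seq x) ?fset_uniq//=.
  by rewrite lerDl sumr_ge0// => y _; exact: powR_ge0.
rewrite big_seq [leRHS]big_seq; apply: ler_sum => x xX; apply: (hc x) => // z zV.
by apply: le_trans (hV _ zV) _; have [_] := fP z; exact.
Qed.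

End DistanceToSet.

(** [expR x >= (x / n) ^ n] with [n >= a / p] beats the power. The half in the exponent leaves the
    other half free to absorb a growth factor exponential in time. *)
Lemma expR_powR_le (R : realType) (p a : R) : 0 < p -> exists2 c : R, 0 < c &
  forall r : R, 0 < r -> 1 <= r -> expR (- (r `^ p / 2)) <= c * r `^ (- a).
Proof.
move=> p0; pose n := (Num.truncn (Num.max 0 (a / p))).+1.
have an : a <= p * n%:R.
  rewrite mulrC -ler_pdivrMr// ltW//; apply: le_lt_trans (truncnS_gt _).
  by rewrite le_max lexx orbT.
have n0 : 0 < n%:R :> R by rewrite ltr0n.
exists ((2 * n%:R) ^+ n); first by rewrite exprn_gt0// mulr_gt0.
move=> r r0 r1; set x := r `^ p / 2.
have x0 : 0 < x by rewrite divr_gt0// powR_gt0.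
have h : (x / n%:R) ^+ n <= expR x.
  have -> : expR x = expR (x / n%:R) ^+ n.
    by rewrite -expRM_natl; congr expR; field; rewrite gt_eqF.
  have xn : 0 <= x / n%:R by apply: divr_ge0; exact: ltW.
  apply: lerXn2r; rewrite ?nnegrE ?expR_ge0//.
  by apply: le_trans _ (expR_ge1Dx _); rewrite lerDr.
rewrite expRN; apply: (@le_trans _ _ ((x / n%:R) ^+ n)^-1).
  have xn : 0 < x / n%:R by apply: divr_gt0.
  by rewrite lef_pV2 ?posrE ?expR_gt0 ?exprn_gt0.
have -> : ((x / n%:R) ^+ n)^-1 = (2 * n%:R) ^+ n * r `^ (- (p * n%:R)).
  rewrite powRN powRrM powR_mulrn ?powR_ge0// -exprVn -[in RHS]exprVn -exprMn.
  congr (_ ^+ _); rewrite /x; field.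
  by rewrite !gt_eqF// powR_gt0.
rewrite ler_wpM2l ?exprn_ge0 ?mulr_ge0// ?(ltW n0)//.
by apply: ler_powR => //; rewrite lerN2.
Qed.

Section FiniteVolume.
Context {R : realType} {d : nat} {L : choiceType} (pos : L -> 'rV[R]_d).
Context {q : L -> nat} (H : interaction R q).
Local Notation C := R[i].
Local Notation mxop Z := 'M[R[i]]_#|lconf q Z|.
Implicit Types (Z W V Y : {fset L}).

Definition hnormr Z : R := mxnorm (H Z).
Definition long_range (r : R) Z : bool := (r%:E <= diam pos [set` Z])%E.
Definition hterm W Z : mxop W := mx_of W (amplify (H Z)).
(** [V] carries the dynamics; [W] only fixes the matrix algebra, so that observables outside [V] fit
    in as well. *)
Definition hvol W V : mxop W := \sum_(Z <- fpowerset V) hterm W Z.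
Definition hshort W V r : mxop W :=
  \sum_(Z <- fpowerset V | ~~ long_range r Z) hterm W Z.

Lemma hnormr_ge0 Z : 0 <= hnormr Z. Proof. exact: mxnorm_ge0. Qed.

Lemma short_range_dist r Z x z : ~~ long_range r Z -> x \in Z -> z \in Z ->
  dist pos x z < r.
Proof.
rewrite /long_range -ltNge => h xZ zZ; rewrite -lte_fin; apply: le_lt_trans h.
by apply: ereal_sup_ubound; exists x => //; exists z.
Qed.

Hypothesis H_herm : forall Z, H Z \is hermsymmx.

Lemma hterm_herm W Z : (Z `<=` W)%fset -> hterm W Z \is hermsymmx.
Proof. by move=> ZW; apply: mx_of_hermsymmx. Qed.

Lemma hterm_norm W Z : (Z `<=` W)%fset -> mxnorm (hterm W Z) = hnormr Z.
Proof. exact: mxnorm_mx_of. Qed.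

Lemma hvol_herm W V : (V `<=` W)%fset -> hvol W V \is hermsymmx.
Proof.
move=> VW; apply: hermsymmx_sum => Z; rewrite fpowersetE => ZV.
by apply: hterm_herm; exact: fsubset_trans VW.
Qed.

Lemma hshort_herm W V r : (V `<=` W)%fset -> hshort W V r \is hermsymmx.
Proof.
move=> VW; apply: hermsymmx_sum => Z; rewrite fpowersetE => ZV.
by apply: hterm_herm; exact: fsubset_trans VW.
Qed.

Context (C0 : R) (C00 : 0 <= C0).
Hypothesis HC0 : forall V x,
  \sum_(Z <- fpowerset V | x \in Z) hnormr Z * (#|` Z|%fset)%:R <= C0.

Lemma short_range_bound W V X Y r rho t (a b : mxop W) : (V `<=` W)%fset ->
  0 < r -> 0 <= t -> Y != fset0 -> loc X a -> loc Y b ->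
  (forall x y, x \in X -> y \in Y -> rho <= dist pos x y) ->
  mxnorm (comm (tau (hshort W V r) t a) b) <=
    2 * mxnorm a * mxnorm b * (#|` X|%fset)%:R *
    expR (2 * (expR 1 * C0) * t - rho / r).
Proof.
move=> VW r0 t0 Y0 Xa Yb hrho.
have [g gP] := fset_dist_min pos Y0.
(* The decay length is the range [r]: across a term of diameter less than [r] the weight varies by
   at most the factor [expR 1]. Hence [kappa = expR 1 * C0], where [C0] also counts the sites of the
   term. *)
pose S x := expR (- (g x / r)).
pose fam := [seq Z <- fpowerset V | ~~ long_range r Z].
have famP Z : Z \in fam -> ~~ long_range r Z /\ (Z `<=` W)%fset.
  rewrite mem_filter fpowersetE => /andP[-> ZV]; split=> //.
  exact: fsubset_trans VW.
have HN := @mxnorm_operator_norm R L q W.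
have := @comm_tau_weight R L _ _ HN fam (hterm W) (@loc _ _ _ W).
have -> : \sum_(Z <- fam) hterm W Z = hshort W V r by rewrite big_filter.
move=> /(_ (fun Z Zf => hterm_herm (famP Z Zf).2)).
move=> /(_ (fun Z Zf => loc_mx_of _ (famP Z Zf).2)).
move=> /(_ (fun Z Z' a b h => @loc_comm _ _ _ W Z Z' a b h)).
move=> /(_ (@loc_fset0_comm _ _ _ W)) /(_ S (expR 1 * C0) X a b t) main.
apply: le_trans (main _ _ _ _ _ _) _ => //.
- by move=> x; exact: expR_gt0.
- by rewrite mulr_ge0 ?expR_ge0.
- move=> x; apply: (@le_trans _ _ (\sum_(Z <- fam | x \in Z)
      hnormr Z * (#|` Z|%fset)%:R * (expR 1 * S x))).
    rewrite big_seq_cond [leRHS]big_seq_cond; apply: ler_sum => Z /andP[/famP[Zs ZW] xZ].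
    rewrite hterm_norm// -mulrA ler_wpM2l ?hnormr_ge0//.
    apply: (@le_trans _ _ (\sum_(z <- Z) expR 1 * S x)); last first.
      by rewrite big_const_seq count_predT iter_addr addr0 -[leLHS]mulr_natl.
    rewrite big_seq [leRHS]big_seq; apply: ler_sum => z zZ.
    rewrite -expRD ler_expR.
    have [[y yY gz] _] := gP z; have [_ /(_ y yY) gx] := gP x.
    have h1 := dist_triangle pos y z x; have h2 := short_range_dist Zs zZ xZ.
    suff : g x / r <= 1 + g z / r by lra.
    by rewrite ler_pdivrMr// mulrDl mul1r divfK ?gt_eqF// gz; lra.
  rewrite -mulr_suml [expR 1 * C0]mulrC -[leRHS]mulrA; apply: ler_wpM2r.
    by rewrite mulr_ge0 ?expR_ge0.
  apply: le_trans (HC0 V x); rewrite big_filter_cond big_mkcond [leRHS]big_mkcond.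
  apply: ler_sum => Z _; case: ifP => [/andP[_ ->]//|_].
  by case: ifP => // _; rewrite mulr_ge0 ?hnormr_ge0.
(* An observable disjoint from [Y] commutes with [b]; any other one shares with [Y] a site of weight
   [1], so the trivial bound suffices. *)
- move=> Z c _ Zc; have [ZY|] := boolP [disjoint Z & Y]%fset.
    by rewrite (loc_comm ZY Zc Yb) (opn0 HN) mulr_ge0 ?sumr_ge0 ?mulr_ge0 ?mxnorm_ge0// => x _; exact: expR_ge0.
  rewrite -fsetI_eq0 => /fset0Pn[x]; rewrite inE => /andP[xZ xY].
  rewrite (le_trans (opn_comm HN _ _))// ler_peMr ?mulr_ge0 ?mxnorm_ge0//.
  rewrite (bigD1_seq x) ?fset_uniq//= /S.
  have -> : g x = 0.
    have [[y yY gy] /(_ x xY)] := gP x; rewrite distxx gy => h.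
    by apply/eqP; rewrite eq_le h dist_ge0.
  by rewrite mul0r oppr0 expR0 lerDl sumr_ge0// => y _; exact: expR_ge0.
rewrite -mulrA -[leRHS]mulrA; apply: ler_wpM2l; first by rewrite !mulr_ge0 ?mxnorm_ge0.
rewrite expRD [leRHS]mulrCA ler_wpM2l ?expR_ge0//.
apply: (@le_trans _ _ (\sum_(x <- X) expR (- (rho / r)))); last first.
  by rewrite big_const_seq count_predT iter_addr addr0 -[leLHS]mulr_natl.
rewrite big_seq [leRHS]big_seq; apply: ler_sum => x xX.
rewrite ler_expR lerN2 ler_pM2r ?invr_gt0//.
by have [[y yY ->] _] := gP x; rewrite dist_sym; exact: hrho.
Qed.

End FiniteVolume.

Section Growth.
Context {R : realType} {d : nat} {L : choiceType} (pos : L -> 'rV[R]_d).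
Context {q : L -> nat} (H : interaction R q).
Local Notation C := R[i].
Local Notation mxop Z := 'M[R[i]]_#|lconf q Z|.
Implicit Types (Z W V Y : {fset L}).
Hypothesis H_herm : forall Z, H Z \is hermsymmx.
Context (X : {fset L}) (f : L -> R).
Hypothesis fP : forall z, (exists2 x, x \in X & f z = dist pos x z) /\
  (forall x, x \in X -> f z <= dist pos x z).

(** The support need not contain [z], only lie no closer to [X]: a term of the Hamiltonian can then
    be tested, whole, at its site closest to [X]. *)
Definition test_observable W z (b : mxop W) : Prop :=
  mxnorm b <= 1 /\ exists Y, [/\ Y != fset0, loc Y b & forall y, y \in Y -> f z <= f y].

(* How much [a], evolved for the time [s], is felt at the distance of the site
   [z] from [X]. *)
Definition growth W V (a : mxop W) (z : L) (s : R) : R :=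
  sup [set mxnorm (comm b (tau (hvol H W V) s a)) | b in test_observable z].

Lemma test_observable0 W z : test_observable z (0 : mxop W).
Proof.
split; first by rewrite (opn0 (mxnorm_operator_norm _)).
exists [fset z]%fset; split=> [||y].
- by apply/fset0Pn; exists z; rewrite inE.
- exact: loc0.
- by rewrite inE => /eqP ->.
Qed.

Lemma mxnorm_comm_le W V (a b : mxop W) s :
  mxnorm b <= 1 -> mxnorm (comm b (tau (hvol H W V) s a)) <= 2 * mxnorm a.
Proof.
move=> b1; rewrite (le_trans (opn_comm (mxnorm_operator_norm _) _ _))//.
rewrite (opn_tau (mxnorm_operator_norm _)) mulrAC ler_piMr// mulr_ge0//.
exact: mxnorm_ge0.
Qed.

Lemma growth_ubound W V (a b : mxop W) z s : test_observable z b ->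
  mxnorm (comm b (tau (hvol H W V) s a)) <= growth V a z s.
Proof.
move=> zb; apply: ub_le_sup; last by exists b.
by exists (2 * mxnorm a) => _ [b' [b'1 _] <-]; exact: mxnorm_comm_le.
Qed.

Lemma growth_le W V (a : mxop W) z s M :
  (forall b, test_observable z b -> mxnorm (comm b (tau (hvol H W V) s a)) <= M) ->
  growth V a z s <= M.
Proof.
move=> hM; apply: ge_sup; last by move=> _ [b zb <-]; exact: hM.
by exists (mxnorm (comm (0 : mxop W) (tau (hvol H W V) s a))), 0 => //; exact: test_observable0.
Qed.

Lemma growth_ge0 W V (a : mxop W) z s : 0 <= growth V a z s.
Proof. by apply: le_trans (growth_ubound _ _ _ (test_observable0 W z)); exact: mxnorm_ge0. Qed.

Lemma growth_le2 W V (a : mxop W) z s : growth V a z s <= 2 * mxnorm a.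
Proof. by apply: growth_le => b [b1 _]; exact: mxnorm_comm_le. Qed.

(** Each nonzero term, normalised, is a test observable at its site closest to [X]; its other sites
    only add nonnegative amounts to the right-hand side. *)
Lemma comm_hterm_growth W V (a : mxop W) s (P : pred {fset L}) : (V `<=` W)%fset ->
  \sum_(Z <- fpowerset V | P Z) mxnorm (comm (hterm H W Z) (tau (hvol H W V) s a)) <=
  \sum_(z <- V) growth V a z s * \sum_(Z <- fpowerset V | P Z && (z \in Z)) hnormr H Z.
Proof.
move=> VW; have HN := @mxnorm_operator_norm R L q W.
under [leRHS]eq_bigr => z _ do rewrite mulr_sumr big_mkcond.
rewrite exchange_big /= big_mkcond big_seq [leRHS]big_seq; apply: ler_sum => Z.
rewrite fpowersetE => ZV.
have ZW : (Z `<=` W)%fset by exact: fsubset_trans VW.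
have nn z : 0 <= (if P Z && (z \in Z) then growth V a z s * hnormr H Z else 0).
  by case: ifP => // _; rewrite mulr_ge0 ?growth_ge0 ?hnormr_ge0.
case: ifP => PZ; last by apply: sumr_ge0 => z _; have := nn z; rewrite PZ.
have hl := loc_mx_of (H Z) ZW.
have [Z0|/fset0Pn[z1 z1Z]] := eqVneq Z fset0.
  rewrite loc_fset0_comm ?(opn0 HN); last by rewrite -Z0.
  by apply: sumr_ge0 => z _; have := nn z; rewrite PZ.
have [z zZ zmin] : exists2 z, z \in Z & forall y, y \in Z -> f z <= f y.
  have [x _ xmin] := @arg_minP _ _ _ [` z1Z]%fset predT (fun x : Z => f (val x)) isT.
  by exists (val x) => [|y yZ]; [exact: valP|exact: (xmin [` yZ]%fset)].
rewrite (bigD1_seq z) ?fset_uniq//=; last exact: (fsubsetP ZV).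
rewrite zZ /= ler_wpDr//.
  by apply: sumr_ge0 => y _; have := nn y; rewrite PZ.
have [h0|h0] := eqVneq (hnormr H Z) 0.
  rewrite h0 mulr0 (le_trans (opn_comm HN _ _))// hterm_norm// h0.
  by rewrite mulr0 mul0r.
have hpos : 0 < hnormr H Z by rewrite lt_def h0 hnormr_ge0.
set k := ((hnormr H Z)^-1)%:C.
have kn : Normc.normc k = (hnormr H Z)^-1 by rewrite normc_real ger0_norm ?invr_ge0 ?ltW.
have := @growth_ubound W V a (k *: hterm H W Z) z s; rewrite commZl => h.
rewrite mulrC -ler_pdivrMl//; apply: le_trans (h _).
  have e : comm (hterm H W Z) (tau (hvol H W V) s a) = (hnormr H Z)%:C *: (k *: comm (hterm H W Z) (tau (hvol H W V) s a)).
    by rewrite scalerA -rmorphM divff// scale1r.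
  rewrite {1}e ler_pdivrMl//; apply: le_trans (opnZ HN _ _) _.
  by rewrite normc_real ger0_norm ?hnormr_ge0.
split; last first.
  by exists Z; split => //; [apply/fset0Pn; exists z | exact: locZ].
by rewrite (le_trans (opnZ HN _ _))// kn hterm_norm// mulVf.
Qed.

Context (J alpha C0 : R) (J0 : 0 < J) (C00 : 0 <= C0).
Hypothesis HC0 : forall V x,
  \sum_(Z <- fpowerset V | x \in Z) hnormr H Z * (#|` Z|%fset)%:R <= C0.
Hypothesis HJ : forall V z r, 0 < r ->
  \sum_(Z <- fpowerset V | long_range pos r Z && (z \in Z)) hnormr H Z <= J * r `^ (- alpha).

(* Truncating the Hamiltonian at the range [r] costs, by Duhamel's formula, the
   commutators of the evolved observable with the long-range terms. *)
Lemma comm_tau_truncation W V (a b : mxop W) Y r rho t B : (V `<=` W)%fset ->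
  0 < r -> 0 <= t -> Y != fset0 -> loc X a -> loc Y b ->
  (forall y, y \in Y -> rho <= f y) ->
  (forall s, 0 <= s <= t -> \sum_(z <- V) growth V a z s <= B) ->
  mxnorm (comm b (tau (hvol H W V) t a)) <=
    mxnorm b * (2 * mxnorm a * (#|` X|%fset)%:R * expR (2 * (expR 1 * C0) * t - rho / r) +
                2 * (t * (J * r `^ (- alpha) * B))).
Proof.
move=> VW r0 t0 Y0 Xa Yb hrho hB; have HN := @mxnorm_operator_norm R L q W.
set T := tau _ t a; set T' := tau (hshort pos H W V r) t a.
have -> : comm b T = comm b T' - comm (T - T') b.
  by move: T T' => T T'; rewrite !commE; nc_ring.
apply: le_trans (opnB HN _ _) _; rewrite mulrDr; apply: lerD.
  rewrite commC (opnN HN) /T' mulrC.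
  apply: le_trans (short_range_bound H_herm C00 HC0 VW r0 t0 Y0 Xa Yb (rho := rho) _) _.
    by move=> x y xX yY; apply: le_trans (hrho _ yY) _; have [_] := fP y; exact.
  by rewrite le_eqVlt; apply/orP; left; apply/eqP; ring.
apply: le_trans (opn_comm HN _ _) _; rewrite [leRHS]mulrC ler_wpM2r ?mxnorm_ge0//.
rewrite ler_wpM2l//.
apply: (tau_duhamel HN) => //; [exact: hvol_herm|exact: hshort_herm|].
move=> s st; have -> : hvol H W V - hshort pos H W V r =
    \sum_(Z <- fpowerset V | long_range pos r Z) hterm H W Z.
  by rewrite /hvol (bigID (long_range pos r)) /= addrK.
rewrite comm_suml; apply: le_trans (opn_sum HN _ _ _) _.
apply: le_trans (comm_hterm_growth _ _ _ VW) _.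
apply: (@le_trans _ _ (\sum_(z <- V) growth V a z s * (J * r `^ (- alpha)))).
  by apply: ler_sum => z _; rewrite ler_wpM2l ?growth_ge0// HJ.
rewrite -mulr_suml mulrC ler_wpM2l ?hB// mulr_ge0 ?powR_ge0// ltW//.
Qed.
End Growth.

(** * Power-law interactions *)

Section Bootstrap.
Context {R : realType} {d : nat} {L : choiceType} (pos : L -> 'rV[R]_d).
Hypothesis d1 : (1 <= d)%N.
Hypothesis sep : forall x y : L, x != y -> 1 <= dist pos x y.
Context {q : L -> nat} (H : interaction R q).
Local Notation mxop Z := 'M[R[i]]_#|lconf q Z|.
Implicit Types (Z W V Y : {fset L}).
Hypothesis H_herm : forall Z, H Z \is hermsymmx.
Context (X : {fset L}) (f : L -> R).
Hypothesis fP : forall z, (exists2 x, x \in X & f z = dist pos x z) /\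
  (forall x, x \in X -> f z <= dist pos x z).
Context (J alpha C0 : R) (J0 : 0 < J) (C00 : 0 <= C0).
Hypothesis HC0 : forall V x,
  \sum_(Z <- fpowerset V | x \in Z) hnormr H Z * (#|` Z|%fset)%:R <= C0.
Hypothesis HJ : forall V z r, 0 < r ->
  \sum_(Z <- fpowerset V | long_range pos r Z && (z \in Z)) hnormr H Z <= J * r `^ (- alpha).
Context (sigma : R).
Hypothesis alphad : d%:R < alpha.
Hypothesis sigma_itv : sigma_range d alpha sigma.

Local Notation nX := ((#|` X|%fset)%:R : R).
Local Notation growth := (growth H f).
Let p := 1 - sigma.
Let A := sigma * alpha.

Lemma subr_sigma_gt0 : 0 < p.
Proof. by have /andP[_ h] := sigma_itv; rewrite subr_gt0. Qed.

(** Clearing the denominator in [sigma_range]. The margin [p] is what the bootstrap spends on the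
    factor [t] of Duhamel's formula. *)
Lemma sigma_alpha_gt : d%:R + p < A.
Proof.
have /andP[h _] := sigma_itv; rewrite /A /p; move: h.
rewrite ltr_pdivrMr; last by rewrite ltr_pwDr// (le_trans _ (ltW alphad)).
by rewrite mulrDr mulr1; lra.
Qed.

Lemma sigma_alpha_gt_dim : d%:R < A.
Proof. by apply: lt_trans sigma_alpha_gt; rewrite ltrDl subr_sigma_gt0. Qed.

Lemma powR_scale rho : 0 < rho ->
  rho / rho `^ sigma = rho `^ p /\ (rho `^ sigma) `^ (- alpha) = rho `^ (- A).
Proof.
move=> rho0; split; last by rewrite -powRrM mulrN.
rewrite /p [in RHS]powRB; last by rewrite (gt_eqF rho0) implybT.
by rewrite powRr1// ltW.
Qed.

Lemma pointwise_growth V W (a b : mxop W) Y t rho B : (V `<=` W)%fset ->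
  0 <= t -> 0 < rho -> Y != fset0 -> loc X a -> loc Y b ->
  (forall y, y \in Y -> rho <= f y) ->
  (forall s, 0 <= s <= t -> \sum_(z <- V) growth V a z s <= B) ->
  mxnorm (comm b (tau (hvol H W V) t a)) <=
    mxnorm b * (2 * mxnorm a * nX * expR (2 * (expR 1 * C0) * t - rho `^ p) +
                2 * (t * (J * rho `^ (- A) * B))).
Proof.
move=> VW t0 rho0 Y0 Xa Yb hrho hB.
have [<- <-] := powR_scale rho0.
by apply: (comm_tau_truncation H_herm fP J0 C00 HC0 HJ) Y0 Xa Yb hrho hB => //; exact: powR_gt0.
Qed.

(** Sites are split at a radius [r0]: inside, the trivial bound is multiplied by the number of
    sites; outside, [pointwise_growth] is fed with the bound [M] to be improved, which comes back
    with coefficient at most [1/2]. *)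
Lemma growth_bootstrap : exists w D, [/\ 0 < w, 4 * (expR 1 * C0) <= w, 0 < D &
  forall V W (a : mxop W) t, (V `<=` W)%fset -> loc X a -> 0 <= t ->
    \sum_(z <- V) growth V a z t <= D * mxnorm a * Num.max 1 (w * t) `^ (d%:R / p)].
Proof.
have p0 := subr_sigma_gt0.
have [c1 c10 hc1] := card_near d1 sep fP.
have [c2 c20 hc2] := shell_near d1 sep fP sigma_alpha_gt_dim.
have [E E0 hE] := expR_powR_le A p0.
set v := expR 1 * C0; have v0 : 0 <= v by rewrite mulr_ge0 ?expR_ge0.
(* [4 * v] leaves half of the exponent [f z ^ p] outside the cone, and [4 * J * c2] brings the
   coefficient of [M] down to [1/2]. *)
pose w := 4 * v + 4 * J * c2 + 1.
have Jc2 : 0 < 4 * J * c2 by rewrite !mulr_gt0.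
have w0 : 0 < w by rewrite /w; lra.
have wJ : 4 * J * c2 <= w by rewrite /w; lra.
have wv : 4 * v <= w by rewrite /w; lra.
pose C1 := 2 * c1 + 2 * nX * E * c2.
have C1_gt0 : 0 < C1 by rewrite /C1 ltr_pwDl// ?mulr_gt0// !mulr_ge0// ltW.
exists w, (2 * C1); split => //; first by rewrite mulr_gt0.
move=> V W a + VW Xa.
pose x t := Num.max 1 (w * t).
pose m t := x t `^ (d%:R / p).
have x1 t : 1 <= x t by rewrite le_max lexx.
have x0 t : 0 < x t by exact: lt_le_trans ltr01 (x1 t).
have m1 t : 1 <= m t.
  by rewrite -(powRr0 (x t)); apply: ler_powR => //; rewrite divr_ge0// ltW.
have m_mono s t : s <= t -> m s <= m t.
  move=> st; apply: ge0_ler_powR; rewrite ?nnegrE ?(ltW (x0 _)) ?divr_ge0 ?(ltW p0)//.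
  by rewrite ge_max !le_max lexx /= ler_pM2l// st orbT.
have Na0 := mxnorm_ge0 a.
pose P M := forall t, 0 <= t -> \sum_(z <- V) growth V a z t <= M * m t.
have step M : 0 <= M -> P M -> P (C1 * mxnorm a + M / 2).
  move=> M0 PM t t0.
  (* Radius of the short-range cone: [r0 ^ d] is [m t], and [r0 <= f z] forces
     [w * t <= f z ^ p]. *)
  pose r0 := x t `^ p^-1.
  have r01 : 1 <= r0.
    by rewrite -(powRr0 (x t)); apply: ler_powR => //; rewrite invr_ge0 ltW.
  have r0d : r0 ^+ d = m t.
    by rewrite -powR_mulrn ?powR_ge0// -powRrM mulrC.
  pose D := 2 * mxnorm a * nX * E + 2 * (t * (J * (M * m t))).
  have D0 : 0 <= D.
    by rewrite addr_ge0 ?mulr_ge0 ?(ltW E0) ?(ltW J0) ?(le_trans ler01 (m1 t)).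
  have far z : r0 <= f z -> growth V a z t <= D * f z `^ (- A).
    move=> rz; have z1 : 1 <= f z by exact: le_trans rz.
    have z0 : 0 < f z by exact: lt_le_trans z1.
    apply: growth_le => b [b1 [Y [Y0 Yb hY]]].
    have hB s : 0 <= s <= t -> \sum_(z <- V) growth V a z s <= M * m t.
      by move=> /andP[s0 st]; rewrite (le_trans (PM s s0))// ler_wpM2l// m_mono.
    apply: le_trans (pointwise_growth VW t0 z0 Y0 Xa Yb hY hB) _.
    set S := _ + _; have S0 : 0 <= S.
      by rewrite addr_ge0 ?mulr_ge0 ?expR_ge0 ?powR_ge0 ?(ltW J0) ?(le_trans ler01 (m1 t)).
    apply: (@le_trans _ _ S); first by rewrite ler_piMl.
    have -> : D * f z `^ (- A) = 2 * mxnorm a * nX * (E * f z `^ (- A)) +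
        2 * (t * (J * f z `^ (- A) * (M * m t))) by rewrite /D; ring.
    rewrite /S lerD2r ler_wpM2l ?mulr_ge0//.
    apply: le_trans (hE _ z0 z1); rewrite ler_expR -/v.
    have : w * t <= f z `^ p.
      apply: (@le_trans _ _ (x t)); first by rewrite le_max lexx orbT.
      have -> : x t = r0 `^ p by rewrite /r0 -powRrM mulVf ?gt_eqF// powRr1// ltW.
      by apply: ge0_ler_powR; rewrite ?nnegrE ?(ltW p0) ?(ltW z0) ?powR_ge0.
    have : 4 * v * t <= w * t by rewrite ler_wpM2r.
    by lra.
  rewrite (bigID (fun z => f z < r0)) /= [X in X + _]big_fset_condE.
  rewrite [X in _ + X]big_fset_condE.
  have near_sum : \sum_(z <- [fset z in V | (f z < r0)%R]%fset) growth V a z t <=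
      2 * mxnorm a * (c1 * m t).
    apply: (@le_trans _ _ (\sum_(z <- [fset z in V | (f z < r0)%R]%fset) 2 * mxnorm a)).
      by apply: ler_sum => z _; exact: growth_le2.
    rewrite big_const_seq count_predT iter_addr addr0 -[leLHS]mulr_natr.
    rewrite ler_wpM2l ?mulr_ge0// -r0d; apply: hc1 => // z.
    by rewrite !inE => /andP[].
  have far_sum : \sum_(z <- [fset z in V | ~~ (f z < r0)%R]%fset) growth V a z t <=
      D * (c2 * r0 `^ (d%:R - A)).
    apply: (@le_trans _ _ (\sum_(z <- [fset z in V | ~~ (f z < r0)%R]%fset)
        D * f z `^ (- A))).
      rewrite big_seq [leRHS]big_seq; apply: ler_sum => z.
      by rewrite !inE /= -leNgt => /andP[_]; exact: far.
    rewrite -mulr_sumr ler_wpM2l//; apply: hc2 => // z.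
    by rewrite !inE /= -leNgt => /andP[].
  apply: le_trans (lerD near_sum far_sum) _.
  set u := r0 `^ (d%:R - A).
  (* As [(d - A) / p < -1], the far sum gains a full factor [1 / x t], which pays for [t]. *)
  have ux : u <= (x t)^-1.
    rewrite /u /r0 -powRrM -[(x t)^-1]powR_inv1 ?(ltW (x0 t))//; apply: ler_powR => //.
    by rewrite mulrC ler_pdivrMr// mulN1r; have := sigma_alpha_gt; lra.
  have u0 : 0 <= u by exact: powR_ge0.
  have u1 : u <= 1 by rewrite (le_trans ux)// invf_le1.
  have tu : t * u * w <= 1.
    apply: (@le_trans _ _ (w * t * (x t)^-1)).
      by rewrite mulrC mulrA ler_wpM2l// mulr_ge0// ltW.
    by rewrite ler_pdivrMr// mul1r le_max lexx orbT.
  have -> : D * (c2 * u) = 2 * nX * E * c2 * mxnorm a * u +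
      (2 * J * c2 * t * u) * (M * m t) by rewrite /D; ring.
  have b1 : 2 * nX * E * c2 * mxnorm a * u <= 2 * nX * E * c2 * mxnorm a * m t.
    by rewrite ler_wpM2l ?mulr_ge0 ?(ltW E0) ?(ltW c20)// (le_trans u1).
  have b2 : 2 * J * c2 * t * u <= 2^-1.
    have : 4 * J * c2 * (t * u) <= w * (t * u) by rewrite ler_wpM2r// mulr_ge0.
    by lra.
  have b3 : 2 * J * c2 * t * u * (M * m t) <= 2^-1 * (M * m t).
    by rewrite ler_wpM2r// mulr_ge0// (le_trans ler01).
  apply: le_trans (lerD (lexx _) (lerD b1 b3)) _.
  by rewrite le_eqVlt; apply/orP; left; apply/eqP; rewrite /C1; field.
(* A start that depends on [V]; iterating [step] divides its contribution by [2 ^ k], and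
   [2 * C1 * mxnorm a] is the fixed point that remains. *)
have P0 : P (2 * mxnorm a * (#|` V|%fset)%:R).
  move=> t t0; apply: (@le_trans _ _ (2 * mxnorm a * (#|` V|%fset)%:R)); last first.
    by rewrite ler_peMr// !mulr_ge0.
  apply: (@le_trans _ _ (\sum_(z <- V) 2 * mxnorm a)).
    by apply: ler_sum => z _; exact: growth_le2.
  by rewrite big_const_seq count_predT iter_addr addr0 [leRHS]mulr_natr.
set M0 := 2 * mxnorm a * _ in P0.
have M00 : 0 <= M0 by rewrite !mulr_ge0.
have Pk k : P (2 * C1 * mxnorm a + M0 / 2 ^+ k).
  elim: k => [|k IH] t t0.
    rewrite expr0 divr1; apply: le_trans (P0 t t0) _.
    by rewrite ler_wpM2r ?(le_trans ler01)// lerDr !mulr_ge0// ltW.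
  have := step _ _ IH t t0; rewrite addr_ge0 ?mulr_ge0 ?invr_ge0 ?exprn_ge0 ?(ltW C1_gt0)//.
  move=> /(_ isT); congr (_ <= _ * _); rewrite exprS; field.
  by rewrite expf_neq0.
move=> t t0; apply: (@ler_add_inv_nat _ _ _ 0 (M0 * m t)) => k k0 _.
apply: le_trans (Pk k t t0) _; rewrite mulrDl -/(x t) -/(m t) lerD2l.
rewrite mulrAC ler_wpM2l ?mulr_ge0 ?(le_trans ler01 (m1 t))//.
rewrite lef_pV2 ?posrE ?exprn_gt0 ?ltr0n// -natrX ler_nat ltnW//.
exact: ltn_expl.
Qed.

Lemma finite_volume_lieb_robinson : exists w K, [/\ 0 < w, 0 < K &
  forall V W (a b : mxop W) Y t rho, (V `<=` W)%fset -> 0 <= t -> 0 < rho ->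
    Y != fset0 -> loc X a -> loc Y b -> (forall y, y \in Y -> rho <= f y) ->
    mxnorm (comm b (tau (hvol H W V) t a)) <=
      mxnorm a * mxnorm b * lr_function d #|` X|%fset alpha sigma w K rho t].
Proof.
have [w [D [w0 wC D0 hD]]] := growth_bootstrap.
have p0 := subr_sigma_gt0.
(* Dividing by [w] turns the factor [t] of [pointwise_growth] into [w * t], the variable of
   [lr_function]. *)
exists w, (2 * J * D / w); split => //; first by rewrite divr_gt0 ?mulr_gt0.
move=> V W a b Y t rho VW t0 rho0 Y0 Xa Yb hrho.
have [Na0 Nb0] := (mxnorm_ge0 a, mxnorm_ge0 b).
set x := w * t; have x0 : 0 <= x by rewrite mulr_ge0// ltW.
have e0 : 0 <= d%:R / p by rewrite divr_ge0// ltW.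
set m := Num.max 1 x `^ (d%:R / p).
have hB s : 0 <= s <= t -> \sum_(z <- V) growth V a z s <= D * mxnorm a * m.
  move=> /andP[s0 st]; apply: le_trans (hD V W a s VW Xa s0) _.
  rewrite ler_wpM2l ?mulr_ge0 ?(ltW D0)//; apply: ge0_ler_powR => //.
  - by rewrite nnegrE le_max ler01.
  - by rewrite nnegrE le_max ler01.
  - by rewrite ge_max !le_max lexx /= ler_pM2l// st orbT.
apply: le_trans (pointwise_growth VW t0 rho0 Y0 Xa Yb hrho hB) _.
(* The two summands, multiplied by [x], become the linear and the higher power of [v t] in
   [lr_function]. *)
have m_le : m <= 1 + x `^ (d%:R / p).
  rewrite /m; have [_|_] := leP 1 x; first by rewrite lerDr.
  by rewrite powR1 lerDl powR_ge0.
have xm : x * m <= x + x `^ (1 + d%:R / p).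
  have -> : x `^ (1 + d%:R / p) = x * x `^ (d%:R / p).
    by rewrite -(@mulr_powRB1 _ x (1 + d%:R / p)) ?ltr_pwDl// [1 + _]addrC addrK.
  by rewrite -{2}(mulr1 x) -mulrDr ler_wpM2l.
have ev : 2 * (expR 1 * C0) * t <= x.
  rewrite /x ler_wpM2r// (le_trans _ wC)// ler_wpM2r ?mulr_ge0 ?expR_ge0//.
  by rewrite ler_nat.
rewrite [mxnorm a * mxnorm b]mulrC -[leRHS]mulrA ler_wpM2l//.
rewrite /lr_function -/p -/A mulrDr; apply: lerD.
  rewrite [leRHS]mulrA [mxnorm a * (2 * _)]mulrCA [2 * (mxnorm a * _)]mulrA.
  by rewrite ler_wpM2l ?mulr_ge0// ler_expR lerD2r.
rewrite -/x powRN.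
have -> : mxnorm a * (2 * J * D / w * ((x + x `^ (1 + d%:R / p)) / rho `^ A)) =
    2 * J * D * mxnorm a / w / rho `^ A * (x + x `^ (1 + d%:R / p)).
  by field; rewrite gt_eqF ?powR_gt0 ?gt_eqF.
have -> : 2 * (t * (J / rho `^ A * (D * mxnorm a * m))) =
    2 * J * D * mxnorm a / w / rho `^ A * (x * m).
  by rewrite /x; field; rewrite gt_eqF ?powR_gt0 ?gt_eqF.
rewrite ler_wpM2l// !mulr_ge0 ?invr_ge0 ?powR_ge0 ?(ltW w0) ?(ltW J0) ?(ltW D0)//.
Qed.

(** The Lieb-Robinson bound is summable at large distance because [d < A]. The uniformity in [V] and
    [W] is what the comparison of different volumes requires. *)
Lemma finite_volume_tail t e : 0 <= t -> 0 < e -> exists2 r, 1 <= r &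
  forall V W (a : mxop W) s, (V `<=` W)%fset -> loc X a -> 0 <= s <= t ->
    \sum_(z <- V | r <= f z) growth V a z s <= e * mxnorm a.
Proof.
move=> t0 e0; have [w [K [w0 K0 hlr]]] := finite_volume_lieb_robinson.
have p0 := subr_sigma_gt0.
have [c c0 hc] := shell_near d1 sep fP sigma_alpha_gt_dim.
have [E E0 hE] := expR_powR_le A p0.
set x := w * t; have x0 : 0 <= x by rewrite mulr_ge0// ltW.
pose D := 2 * nX * E + K * (x + x `^ (1 + d%:R / p)) + 1.
have D0 : 0 < D.
  by rewrite ltr_pwDr// addr_ge0 ?mulr_ge0 ?addr_ge0 ?powR_ge0 ?(ltW E0) ?(ltW K0).
have dA : 0 < A - d%:R by rewrite subr_gt0 sigma_alpha_gt_dim.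
(* Beyond [r1] the exponential is dominated by a multiple of [f z ^ (- A)]; beyond [r2] the shell
   sum is at most [e]. *)
pose r1 := Num.max 1 (2 * x) `^ p^-1.
pose r2 := (D * c / e) `^ (A - d%:R)^-1.
have r11 : 1 <= r1.
  rewrite -(powRr0 (Num.max 1 (2 * x))); apply: ler_powR; first by rewrite le_max lexx.
  by rewrite invr_ge0 ltW.
pose r := Num.max r1 r2.
have r1r : 1 <= r by rewrite le_max r11.
have r0 : 0 < r by exact: lt_le_trans r1r.
exists r => // V W a s VW Xa /andP[s0 st].
have ws : w * s <= x by rewrite ler_pM2l.
have Na0 := mxnorm_ge0 a.
have far z : r <= f z -> growth V a z s <= D * mxnorm a * f z `^ (- A).
  move=> rz; have z1 : 1 <= f z by exact: le_trans rz.
  have z0 : 0 < f z by exact: lt_le_trans z1.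
  apply: growth_le => b [b1 [Y [Y0 Yb hY]]].
  apply: le_trans (hlr V W a b Y s (f z) VW s0 z0 Y0 Xa Yb hY) _.
  have ex : expR (w * s - f z `^ p) <= E * f z `^ (- A).
    apply: le_trans (hE _ z0 z1); rewrite ler_expR.
    have : 2 * x <= f z `^ p.
      apply: (@le_trans _ _ (r1 `^ p)).
        rewrite /r1 -powRrM mulVf ?gt_eqF// powRr1; last by rewrite le_max ler01.
        by rewrite le_max lexx orbT.
      apply: ge0_ler_powR; rewrite ?nnegrE ?(ltW p0) ?(ltW z0) ?powR_ge0//.
      by apply: le_trans rz; rewrite le_max lexx.
    by lra.
  have ws0 : 0 <= w * s by rewrite mulr_ge0// ltW.
  have e1 : 0 <= 1 + d%:R / p by rewrite addr_ge0// divr_ge0// ltW.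
  have pw : (w * s) `^ (1 + d%:R / p) <= x `^ (1 + d%:R / p).
    by apply: ge0_ler_powR; rewrite ?nnegrE.
  have l1 : lr_function d #|` X|%fset alpha sigma w K (f z) s <= D * f z `^ (- A).
    rewrite /lr_function -/p -/A -powRN.
    apply: (@le_trans _ _ (2 * nX * (E * f z `^ (- A)) +
        K * ((x + x `^ (1 + d%:R / p)) * f z `^ (- A)))).
      apply: lerD; first by rewrite ler_wpM2l ?mulr_ge0.
      rewrite ler_wpM2l ?(ltW K0)// ler_wpM2r ?powR_ge0//.
      exact: lerD.
    rewrite /D -subr_ge0.
    have -> : (2 * nX * E + K * (x + x `^ (1 + d%:R / p)) + 1) * f z `^ (- A) -
      (2 * nX * (E * f z `^ (- A)) + K * ((x + x `^ (1 + d%:R / p)) * f z `^ (- A))) =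
      f z `^ (- A) by ring.
    exact: powR_ge0.
  rewrite -mulrA [leLHS]mulrA; apply: (@le_trans _ _ (mxnorm a * (D * f z `^ (- A)))).
    rewrite -mulrA ler_wpM2l//; apply: le_trans (ler_wpM2l (mxnorm_ge0 b) l1) _.
    by rewrite ler_piMl// mulr_ge0 ?powR_ge0// ltW.
  by rewrite mulrA [_ * D]mulrC.
rewrite big_fset_condE.
apply: (@le_trans _ _ (D * mxnorm a * (c * r `^ (d%:R - A)))).
  apply: (@le_trans _ _ (\sum_(z <- [fset z in V | (r <= f z)%R]%fset)
      D * mxnorm a * f z `^ (- A))).
    rewrite big_seq [leRHS]big_seq; apply: ler_sum => z.
    by rewrite !inE /= => /andP[_]; exact: far.
  rewrite -mulr_sumr ler_wpM2l ?mulr_ge0 ?(ltW D0)//; apply: hc => // z.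
  by rewrite !inE /= => /andP[].
have rr : D * c / e <= r `^ (A - d%:R).
  apply: (@le_trans _ _ (r2 `^ (A - d%:R))).
    by rewrite /r2 -powRrM mulVf ?gt_eqF// powRr1// divr_ge0 ?mulr_ge0// ltW.
  apply: ge0_ler_powR; rewrite ?nnegrE ?powR_ge0 ?(ltW dA) ?(ltW r0)//.
  by rewrite le_max lexx orbT.
rewrite -opprB powRN; have rA0 : 0 < r `^ (A - d%:R) by exact: powR_gt0.
have -> : D * mxnorm a * (c / r `^ (A - d%:R)) = D * c / r `^ (A - d%:R) * mxnorm a.
  by ring.
by rewrite ler_wpM2r// ler_pdivrMr// [e * _]mulrC -ler_pdivrMr.
Qed.

End Bootstrap.

(** The limit is the supremum of the lower ends [u k - c / k.+1]: each lies below every upper end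
    [u l + c / l.+1]. *)
Lemma real_cauchy (R : realType) (u : nat -> R) (c : R) :
  (forall k l, `|u k - u l| <= c * (k.+1%:R^-1 + l.+1%:R^-1)) ->
  exists z, forall k, `|u k - z| <= c * k.+1%:R^-1.
Proof.
move=> h; pose S := [set u k - c * k.+1%:R^-1 | k in [set: nat]].
have ub l : ubound S (u l + c * l.+1%:R^-1).
  move=> _ [k _ <-]; have := h k l; rewrite ler_norml mulrDr => /andP[_].
  by move: (c * k.+1%:R^-1) (c * l.+1%:R^-1) (u k) (u l) => a b x y; lra.
have S0 : S !=set0 by exists (u 0%N - c * 1%:R^-1); exists 0%N.
exists (sup S) => l; rewrite ler_norml; apply/andP; split.
  have : sup S <= u l + c * l.+1%:R^-1 by apply: ge_sup => //; exact: ub.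
  by move: (c * l.+1%:R^-1) (u l) (sup S) => b y z; lra.
have : u l - c * l.+1%:R^-1 <= sup S.
  by apply: ub_le_sup; [exists (u 0%N + c * 1%:R^-1); exact: ub | exists l].
by move: (c * l.+1%:R^-1) (u l) (sup S) => b y z; lra.
Qed.

(** * The infinite-volume limit *)

Section Completeness.
Context {R : realType} {L : choiceType} {q : L -> nat}.
Local Notation C := R[i].
Local Notation operator := (@operator R L q).

Lemma normc_ge_Re_Im (z : C) :
  `|complex.Re z| <= Normc.normc z /\ `|complex.Im z| <= Normc.normc z.
Proof.
case: z => a b; rewrite /Normc.normc /= -!sqrtr_sqr; split; apply: ler_wsqrtr.
  by rewrite lerDl sqr_ge0.
by rewrite lerDr sqr_ge0.
Qed.

Lemma complex_cauchy (u : nat -> C) (c : R) :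
  (forall k l, Normc.normc (u k - u l) <= c * (k.+1%:R^-1 + l.+1%:R^-1)) ->
  exists z, forall k, Normc.normc (u k - z) <= 2 * c * k.+1%:R^-1.
Proof.
move=> h.
have [k l|x hx] := @real_cauchy R (fun k => complex.Re (u k)) c.
  have := (normc_ge_Re_Im (u k - u l)).1; case: (u k) (u l) (h k l) => a b [a' b'] /=.
  by move=> h1 h2; exact: le_trans h2 h1.
have [k l|y hy] := @real_cauchy R (fun k => complex.Im (u k)) c.
  have := (normc_ge_Re_Im (u k - u l)).2; case: (u k) (u l) (h k l) => a b [a' b'] /=.
  by move=> h1 h2; exact: le_trans h2 h1.
exists (x +i* y) => k; move: (hx k) (hy k); case: (u k) => a b ha hb.
have -> : Complex a b - Complex x y = (a - x)%:C + (0 +i* (b - y)).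
  by apply/eqP; rewrite eq_complex /= addr0 add0r !eqxx.
rewrite (le_trans (le_normcD _ _))// normc_real normc_imag.
by rewrite mulr2n 2!mulrDl mul1r; apply: lerD.
Qed.

Lemma l2sq_pointwise (psi : @state R L q) s :
  ((Normc.normc (psi s) ^+ 2)%:E <= l2sq psi)%E.
Proof.
have h : (0 <= (Normc.normc (psi s) ^+ 2)%:E)%E by rewrite lee_fin sqr_ge0.
rewrite -(@esum_set1 R _ s (fun s => (Normc.normc (psi s) ^+ 2)%:E))//.
by apply: esum_ge; exists [set s]; [split|rewrite esum_set1 ?fsbig_set1].
Qed.

(** The limit is taken coordinate by coordinate. The coordinate errors are uniform in [s] but not
    summable over [s], so each finite partial sum of the norm uses an index [l] adapted to its
    number of terms. *)
Lemma opnorm_complete (T : nat -> operator) :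
  (forall k l, bounded_by (opsub (T k) (T l)) (k.+1%:R^-1 + l.+1%:R^-1)) ->
  exists U : operator, forall k, bounded_by (opsub (T k) U) (4 * k.+1%:R^-1).
Proof.
move=> hT.
have ival k : 0 <= k.+1%:R^-1 :> R by rewrite invr_ge0.
have H (x : @state R L q * conf q) : exists z : C, (l2sq x.1 < +oo)%E -> forall k,
    Normc.normc (T k x.1 x.2 - z) <= 2 * Num.sqrt (fine (l2sq x.1)) * k.+1%:R^-1.
  (* Outside [l^2(conf)] the limit is unconstrained and any value serves. *)
  case: x => psi s /=; have [psioo|] := pselect (l2sq psi < +oo)%E; last by exists 0.
  have psif : l2sq psi \is a fin_num by rewrite ge0_fin_numE ?l2sq_ge0.
  have m0 : 0 <= fine (l2sq psi) by rewrite fine_ge0 ?l2sq_ge0.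
  have [k l|z hz] := @complex_cauchy (fun k => T k psi s) (Num.sqrt (fine (l2sq psi))).
    have := le_trans (l2sq_pointwise (opsub (T k) (T l) psi) s) (hT k l psi psioo).
    rewrite -(fineK psif) -EFinM lee_fin /= => h.
    rewrite -ler_sqr ?nnegrE ?normc_ge0 ?mulr_ge0 ?sqrtr_ge0 ?addr_ge0//.
    by rewrite exprMn sqr_sqrtr// mulrC.
  by exists z.
have [U hU] := boolp.choice H.
exists (fun psi s => U (psi, s)) => k psi psioo.
have psif : l2sq psi \is a fin_num by rewrite ge0_fin_numE ?l2sq_ge0.
set m := fine (l2sq psi).
have mE : l2sq psi = m%:E by rewrite fineK.
have m0 : 0 <= m by rewrite fine_ge0 ?l2sq_ge0.
apply: ge_ereal_sup => _ [F [finF _] <-].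
rewrite fsbig_finite//= sumEFin mE -EFinM lee_fin.
set n := size (fset_set F).
(* With [l.+1 = n.+1 * k.+1], the squares of [n] coordinate errors of order [1 / l.+1] add up to
   order [1 / k.+1 ^ 2] at most. *)
pose l := (n.+1 * k.+1).-1.
set ik := k.+1%:R^-1 : R.
have lE : l.+1%:R^-1 = n.+1%:R^-1 * ik :> R by rewrite prednK// natrM invfM.
have ik0 : 0 <= ik by exact: ival.
have n1 : n.+1%:R^-1 <= 1 :> R by rewrite invf_le1 ?ltr0n// ler1n.
have kl : l.+1%:R^-1 <= ik by rewrite lE ler_piMl.
have nl : n%:R * l.+1%:R^-1 ^+ 2 <= ik ^+ 2.
  rewrite lE exprMn mulrA ler_piMl ?sqr_ge0// expr2 mulrA.
  rewrite mulr_ile1 ?mulr_ge0 ?invr_ge0//.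
  by rewrite ler_pdivrMr ?ltr0n// mul1r ler_nat.
have b1 : \sum_(s <- fset_set F) Normc.normc (opsub (T k) (T l) psi s) ^+ 2 <=
    (ik + ik) ^+ 2 * m.
  apply: (@le_trans _ _ ((ik + l.+1%:R^-1) ^+ 2 * m)); last first.
    by rewrite ler_wpM2r// ler_pXn2r ?nnegrE ?addr_ge0 ?ival// lerD2l.
  have h := hT k l psi psioo; rewrite mE -EFinM in h.
  rewrite -lee_fin; apply: le_trans _ h; rewrite -sumEFin; apply: esum_ge; exists F; first by split.
  by rewrite fsbig_finite.
have b2 : \sum_(s <- fset_set F) Normc.normc (T l psi s - U (psi, s)) ^+ 2 <=
    n%:R * (2 * Num.sqrt m * l.+1%:R^-1) ^+ 2.
  have -> : n%:R * (2 * Num.sqrt m * l.+1%:R^-1) ^+ 2 =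
      \sum_(s <- fset_set F) (2 * Num.sqrt m * l.+1%:R^-1) ^+ 2.
    by rewrite big_const_seq count_predT iter_addr addr0 mulr_natl.
  apply: ler_sum => s _; rewrite ler_pXn2r ?nnegrE ?normc_ge0 ?mulr_ge0 ?sqrtr_ge0 ?ival//.
  exact: (hU (psi, s)).
apply: (@le_trans _ _ (\sum_(s <- fset_set F)
    ((1 + 1) * Normc.normc (opsub (T k) (T l) psi s) ^+ 2 +
     (1 + 1^-1) * Normc.normc (T l psi s - U (psi, s)) ^+ 2))).
  apply: ler_sum => s _; rewrite /opsub.
  have -> : T k psi s - U (psi, s) = (T k psi s - T l psi s) + (T l psi s - U (psi, s)).
    by rewrite addrA subrK.
  exact: normcD_young.
rewrite big_split /= -!mulr_sumr invr1.
apply: (@le_trans _ _ ((1 + 1) * ((ik + ik) ^+ 2 * m) +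
    (1 + 1) * (n%:R * (2 * Num.sqrt m * l.+1%:R^-1) ^+ 2))).
  by apply: lerD; apply: ler_wpM2l.
have -> : n%:R * (2 * Num.sqrt m * l.+1%:R^-1) ^+ 2 =
    4 * m * (n%:R * l.+1%:R^-1 ^+ 2).
  by rewrite !exprMn sqr_sqrtr//; ring.
apply: (@le_trans _ _ ((1 + 1) * ((ik + ik) ^+ 2 * m) + (1 + 1) * (4 * m * ik ^+ 2))).
  by rewrite lerD2l !ler_wpM2l ?mulr_ge0.
by rewrite le_eqVlt; apply/orP; left; apply/eqP; ring.
Qed.

End Completeness.

Section FiniteVolumeOperators.
Context {R : realType} {L : choiceType} {q : L -> nat} (H : interaction R q).
Local Notation mxop Z := 'M[R[i]]_#|lconf q Z|.
Hypothesis H_herm : forall Z, H Z \is hermsymmx.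
Implicit Types (V W X : {fset L}).

Lemma hamiltonian_amplify V W : (V `<=` W)%fset ->
  hamiltonian H V = amplify (hvol H W V).
Proof.
move=> VW; apply/funext => psi; apply/funext => s.
rewrite /hvol amplify_sum /hamiltonian big_seq [RHS]big_seq.
apply: eq_bigr => Z; rewrite fpowersetE => ZV.
by rewrite amplify_mx_of//; exact: fsubset_trans VW.
Qed.

Lemma heisenberg_fin_amplify V W t (a : mxop W) : (V `<=` W)%fset ->
  heisenberg_fin H V t (amplify a) = amplify (tau (hvol H W V) t a).
Proof.
move=> VW; have P s : propagator H V s = amplify (expmx (hvol H W V) s).
  rewrite /propagator (hamiltonian_amplify VW); apply: opexp_amplify.
  exact: hvol_herm.
by rewrite /heisenberg_fin !P tauE !amplifyM.
Qed.

(** Holds because [amplify a] is linear; a map of type [operator] need not be. *)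
Lemma amplify_opsub W (a : mxop W) (S T : @operator R L q) :
  amplify a \o opsub S T = opsub (amplify a \o S) (amplify a \o T).
Proof.
apply/funext => psi; apply/funext => s; rewrite /opsub /amplify /= -sumrB.
by apply: eq_bigr => c _; rewrite mulrBr.
Qed.

End FiniteVolumeOperators.

(** * Finite-volume consequences of the assumptions on the couplings *)

Section Couplings.
Context {R : realType} {d : nat} {L : choiceType} (pos : L -> 'rV[R]_d).
Context {q : L -> nat} (H : interaction R q).
Implicit Types (V W X Z : {fset L}).

Lemma fset_sum_le_esum (T : choiceType) (F : {fset T}) (S : set T) (a : T -> \bar R) :
  (forall i, i \in F -> S i) -> (\sum_(i <- F) a i <= \esum_(i in S) a i)%E.
Proof.
move=> FS; apply: esum_ge; exists [set` F]; first by split => // i /FS.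
by rewrite fsbig_finite//= set_fsetK.
Qed.

Lemma hnormE Z : hnorm H Z = (hnormr H Z)%:E.
Proof. by rewrite /hnormr mxnormE. Qed.

(** Exchanging the sums over [y] and [Z] counts each term once per site, hence its number of sites.
    The site given as argument excludes an empty supremum, which would be [-oo]. *)
Lemma total_coupling_bound : L -> (total_coupling H < +oo)%E ->
  exists2 C0 : R, 0 <= C0 & (forall V x,
  \sum_(Z <- fpowerset V | x \in Z) hnormr H Z * (#|` Z|%fset)%:R <= C0) /\
  (forall x, \esum_(Z in [set Z : {fset L} | x \in Z]) hnorm H Z \is a fin_num).
Proof.
move=> x0 toto.
have ge x : (\esum_(y in [set: L])
    \esum_(Z in [set Z : {fset L} | x \in Z /\ y \in Z]) hnorm H Z <= total_coupling H)%E.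
  by apply: ereal_sup_ubound; exists x.
have in0 x y : (0 <= \esum_(Z in [set Z : {fset L} | x \in Z /\ y \in Z]) hnorm H Z)%E.
  by apply: esum_ge0 => Z _; exact: opnorm_ge0.
have tot0 : (0 <= total_coupling H)%E.
  by apply: le_trans (ge x0); apply: esum_ge0.
have totf : total_coupling H \is a fin_num by rewrite ge0_fin_numE.
exists (fine (total_coupling H)); first exact: fine_ge0.
split=> [V x|x]; last first.
  rewrite ge0_fin_numE; last by apply: esum_ge0 => Z _; exact: opnorm_ge0.
  apply: le_lt_trans toto; apply: le_trans (ge x).
  (* Only the summand [y = x] is kept. *)
  apply: le_trans (fset_sum_le_esum (F := [fset x]%fset) _ _) => //.
  rewrite big_seq_fset1 (_ : [set Z | _] = [set Z : {fset L} | x \in Z /\ x \in Z])//.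
  by apply/seteqP; split => Z //= [].
rewrite -lee_fin fineK//; apply: le_trans (ge x).
apply: le_trans (fset_sum_le_esum (F := V) _ _) => //.
apply: (@le_trans _ _ (\sum_(y <- V) \sum_(Z <- fpowerset V | (x \in Z) && (y \in Z)) (hnormr H Z)%:E)%E).
  under [leRHS]eq_bigr do rewrite big_mkcond.
  rewrite exchange_big /= -sumEFin.
  rewrite big_mkcond big_seq [leRHS]big_seq.
  apply: lee_sum => Z; rewrite fpowersetE => ZV.
  have [xZ|xZ] := boolP (x \in Z); last by rewrite big1.
  rewrite -big_mkcond /= big_fset_condE.
  have -> : [fset y in V | y \in Z]%fset = Z.
    apply/fsetP => y; rewrite !inE andbC; case: (boolP (y \in Z)) => // yZ.
    exact: (fsubsetP ZV).
  by rewrite sumEFin big_const_seq count_predT iter_addr addr0 mulr_natr.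
apply: lee_sum => y _; rewrite big_fset_condE.
under eq_bigr do rewrite -hnormE.
by apply: fset_sum_le_esum => Z; rewrite !inE /= => /andP[_ /andP[]].
Qed.

Lemma tail_coupling_bound J alpha :
  (forall r : R, 0 < r -> (tail_coupling H pos r <= (J * r `^ (- alpha))%:E)%E) ->
  forall V z r, 0 < r ->
  \sum_(Z <- fpowerset V | long_range pos r Z && (z \in Z)) hnormr H Z <= J * r `^ (- alpha).
Proof.
move=> h V z r r0; rewrite -lee_fin; apply: le_trans (h r r0).
rewrite -sumEFin big_fset_condE; under eq_bigr do rewrite -hnormE.
apply: (@le_trans _ _ (\esum_(Z in [set Z : {fset L} |
    z \in Z /\ (r%:E <= diam pos [set` Z])%E]) hnorm H Z)%E).
  by apply: fset_sum_le_esum => Z; rewrite !inE /= => /andP[_ /andP[]].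
by apply: ereal_sup_ubound; exists z.
Qed.

(** A finite family of terms nearly exhausts the sum; [V0] is its union, so a term not contained in
    [V] is outside the family and belongs to the remainder. *)
Lemma coupling_exhaustion z (e : R) : 0 < e ->
  \esum_(Z in [set Z : {fset L} | z \in Z]) hnorm H Z \is a fin_num ->
  exists V0 : {fset L}, forall V W, (V0 `<=` V)%fset ->
    \sum_(Z <- fpowerset W | ~~ (Z `<=` V)%fset && (z \in Z)) hnormr H Z <= e.
Proof.
move=> e0 fin.
have [_ [F [finF FS] <-] hF] := ub_ereal_sup_adherent e0 fin.
exists (\bigcup_(Z <- fset_set F) Z)%fset => V W /fsubsetP V0V.
rewrite big_fset_condE.
set G := [fset Z in fpowerset W | _]%fset.
have FG : [disjoint fset_set F & G]%fset.
  apply/fdisjointP => Z ZF; rewrite !inE /= !negb_and negbK.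
  have -> : (Z `<=` V)%fset; last by rewrite orbT.
  apply/fsubsetP => x xZ; apply: V0V; apply/bigfcupP; exists Z => //.
  by rewrite ZF.
set S := (\esum_(Z in _) hnorm H Z)%E in fin hF.
have SE : S = (fine S)%:E by rewrite fineK.
have FGS : (\sum_(Z <- fset_set F ++ G) hnorm H Z <= S)%E.
  rewrite (@perm_big _ _ _ _ _ (fset_set F `|` G)%fset); last first.
    apply: uniq_perm; [|exact: fset_uniq|by move=> Z; rewrite mem_cat in_fsetU].
    rewrite cat_uniq !fset_uniq andbT /=; apply/hasPn => Z ZG.
    by apply: contraL ZG => ZF; move/fdisjointP : FG => ->.
  apply: fset_sum_le_esum => Z; rewrite in_fsetU => /orP[|].
    by rewrite in_fset_set// inE => /FS.
  by rewrite !inE => /andP[_ /andP[]].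
have sumE (r : seq {fset L}) :
    (\sum_(Z <- r) hnorm H Z)%E = (\sum_(Z <- r) hnormr H Z)%:E.
  by rewrite -sumEFin; apply: eq_bigr => Z _; exact: hnormE.
have {}hF : (S - e%:E < \sum_(Z \in F) hnorm H Z)%E by exact: hF.
move: hF FGS; rewrite fsbig_finite//= !sumE big_cat /= SE.
by rewrite -EFinB lte_fin lee_fin; lra.
Qed.

End Couplings.

Section BoundedOperators.
Context {R : realType} {L : choiceType} {q : L -> nat}.
Implicit Types T U S : @operator R L q.

Lemma bounded_by_opsubC T U M : 0 <= M ->
  bounded_by (opsub T U) M -> bounded_by (opsub U T) M.
Proof.
move=> M0 h; have := bounded_by_scale (-1) h; rewrite normcN Normc.normc1 mul1r.
by congr bounded_by; apply/funext => psi; apply/funext => s; rewrite /opsub mulN1r opprB.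
Qed.

Lemma bounded_by_opsub_trans T U S M K : 0 <= M -> 0 <= K ->
  bounded_by (opsub T U) M -> bounded_by (opsub U S) K -> bounded_by (opsub T S) (M + K).
Proof.
move=> M0 K0 h1 h2; have := bounded_by_add M0 K0 h1 h2.
by congr bounded_by; apply/funext => psi; apply/funext => s; rewrite /opsub addrA subrK.
Qed.

Lemma bounded_by_close T U M K : 0 <= M -> 0 <= K ->
  bounded_by (opsub T U) M -> bounded_by U K -> bounded_by T (M + K).
Proof.
move=> M0 K0 h1 h2; have := bounded_by_add M0 K0 h1 h2.
by congr bounded_by; apply/funext => psi; apply/funext => s; rewrite /opsub subrK.
Qed.

End BoundedOperators.

(** * Existence of the dynamics and transfer of the bound to infinite volume *)

Section InfiniteVolume.
Context {R : realType} {d : nat} {L : choiceType} (pos : L -> 'rV[R]_d).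
Hypothesis d1 : (1 <= d)%N.
Hypothesis sep : forall x y : L, x != y -> 1 <= dist pos x y.
Context {q : L -> nat} (H : interaction R q).
Local Notation mxop Z := 'M[R[i]]_#|lconf q Z|.
Hypothesis H_herm : forall Z, H Z \is hermsymmx.
Context (J alpha : R) (J0 : 0 < J) (alphad : d%:R < alpha).
Hypothesis Htail : forall r : R, 0 < r ->
  (tail_coupling H pos r <= (J * r `^ (- alpha))%:E)%E.
Hypothesis Htot : (total_coupling H < +oo)%E.
Context (X : {fset L}) (X0 : X != fset0).

Lemma sigma_range_nonempty : exists sigma, sigma_range d alpha sigma.
Proof.
have a0 : 0 < alpha + 1 by rewrite ltr_pwDr// (le_trans _ (ltW alphad)).
have : (d%:R + 1) / (alpha + 1) < 1 by rewrite ltr_pdivrMr// mul1r ltrD2r.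
set b := _ / _ => b1; exists ((b + 1) / 2).
by rewrite /sigma_range /= -/b; apply/andP; split; lra.
Qed.

Lemma hvol_diff (V W : {fset L}) : (V `<=` W)%fset ->
  hvol H W W - hvol H W V = \sum_(Z <- fpowerset W | ~~ (Z `<=` V)%fset) hterm H W Z.
Proof.
move=> VW; rewrite {1}/hvol (bigID (fun Z => Z `<=` V)%fset) /= big_fset_condE.
have -> : [fset Z in fpowerset W | (Z `<=` V)%fset]%fset = fpowerset V.
  apply/fsetP => Z; rewrite !inE /= !fpowersetE andbC.
  by case: (boolP (Z `<=` V)%fset) => // ZV; rewrite (fsubset_trans ZV VW).
by rewrite addrC addrK.
Qed.

(** By [tau_duhamel], only the terms inside [W] but not inside [V] matter. At sites far from [X] the
    growth is small ([finite_volume_tail]); the other sites are finitely many, and at each of them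
    these terms are small ([coupling_exhaustion]). *)
Lemma heisenberg_cauchy (a0 : mxop X) t e : 0 <= t -> 0 < e ->
  exists V0 : {fset L}, (X `<=` V0)%fset /\ forall V W : {fset L},
    (V0 `<=` V)%fset -> (V `<=` W)%fset ->
    mxnorm (tau (hvol H W W) t (mx_of W (amplify a0)) -
            tau (hvol H W V) t (mx_of W (amplify a0))) <= e.
Proof.
move=> t0 e0; have [x0 _] := fset0Pn _ X0.
have [f fP] := fset_dist_min pos X0.
have [C0 C00 [HC0 Hfin]] := total_coupling_bound x0 Htot.
have HJ := tail_coupling_bound Htail.
have [sigma sP] := sigma_range_nonempty.
set Na := mxnorm a0; have Na0 : 0 <= Na by exact: mxnorm_ge0.
(* [e1] for the far sites and [e2] for the near ones each account for half of [e]. *)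
pose e1 := e / (2 * (t * Na * C0 + 1)).
have k1 : 0 < t * Na * C0 + 1 by rewrite ltr_pwDr// !mulr_ge0.
have e10 : 0 < e1 by rewrite divr_gt0// mulr_gt0.
have [r r1 hr] := finite_volume_tail d1 sep H_herm fP J0 C00 HC0 HJ alphad sP t0 e10.
have [c c0 hc] := card_near d1 sep fP.
set n := c * r ^+ d.
have n0 : 0 <= n by rewrite mulr_ge0 ?exprn_ge0 ?(ltW c0)// (le_trans ler01).
pose e2 := e / (2 * (t * (2 * Na) * n + 1)).
have k2 : 0 < t * (2 * Na) * n + 1 by rewrite ltr_pwDr// mulr_ge0// !mulr_ge0.
have e20 : 0 < e2 by rewrite divr_gt0// mulr_gt0.
(* An infinite set of near sites would contain a finite one violating the count [n]. *)
have finB : finite_set [set z | f z < r].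
  apply: contrapT => infB.
  have [B BS Bn] := infinite_set_fset (Num.truncn n).+1 infB.
  have : (#|` B|%fset)%:R <= n by apply: hc => // z zB; exact: BS.
  apply/negP; rewrite -ltNge; apply: lt_le_trans (truncnS_gt n) _.
  by rewrite ler_nat.
have [v hv] := boolp.choice (fun z => coupling_exhaustion e20 (Hfin z)).
pose V0 := (X `|` \bigcup_(z <- fset_set [set z | f z < r]) v z)%fset.
have XV0 : (X `<=` V0)%fset by exact: fsubsetUl.
exists V0; split => // V W V0V VW.
have XW : (X `<=` W)%fset by exact: fsubset_trans XV0 (fsubset_trans V0V VW).
set a := mx_of W (amplify a0).
have aN : mxnorm a = Na by exact: mxnorm_mx_of.
have HN := @mxnorm_operator_norm R L q W.
have tM : t * (C0 * (e1 * Na) + n * (2 * Na * e2)) <= e.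
  have h1 : t * (C0 * (e1 * Na)) <= e / 2.
    have -> : t * (C0 * (e1 * Na)) = t * Na * C0 * e1 by ring.
    have -> : e / 2 = (t * Na * C0 + 1) * e1 by rewrite /e1; field; rewrite gt_eqF.
    by rewrite ler_wpM2r ?(ltW e10)// lerDl.
  have h2 : t * (n * (2 * Na * e2)) <= e / 2.
    have -> : t * (n * (2 * Na * e2)) = t * (2 * Na) * n * e2 by ring.
    have -> : e / 2 = (t * (2 * Na) * n + 1) * e2 by rewrite /e2; field; rewrite gt_eqF.
    by rewrite ler_wpM2r ?(ltW e20)// lerDl.
  by rewrite mulrDr; lra.
apply: le_trans tM; apply: (tau_duhamel HN) => //; [exact: hvol_herm|exact: hvol_herm|].
move=> s st; rewrite hvol_diff// comm_suml.
apply: le_trans (opn_sum HN _ _ _) _.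
apply: le_trans (comm_hterm_growth H f a s _ (fsubset_refl W)) _.
set g := fun z => growth H f W a z s.
set h := fun z => \sum_(Z <- fpowerset W | ~~ (Z `<=` V)%fset && (z \in Z)) hnormr H Z.
have g0 z : 0 <= g z by exact: growth_ge0.
rewrite (bigID (fun z => r <= f z)) /=; apply: lerD.
  apply: (@le_trans _ _ (\sum_(z <- W | r <= f z) g z * C0)).
    apply: ler_sum => z _; apply: ler_wpM2l; first exact: g0.
    apply: le_trans (HC0 W z); rewrite big_mkcond [leRHS]big_mkcond.
    apply: ler_sum => Z _.
    have [zZ|zZ] := boolP (z \in Z); last by rewrite andbF.
    rewrite andbT; have Z1 : (1 <= #|` Z|)%N.
      by rewrite cardfs_gt0; apply/fset0Pn; exists z.
    apply: (@le_trans _ _ (hnormr H Z)); first by case: ifP => // _; exact: hnormr_ge0.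
    by rewrite ler_peMr ?hnormr_ge0// ler1n.
  rewrite -mulr_suml mulrC ler_wpM2l// -aN.
  by apply: hr => //; exact: loc_mx_of.
apply: (@le_trans _ _ (\sum_(z <- W | ~~ (r <= f z)) 2 * Na * e2)).
  apply: ler_sum => z; rewrite -ltNge => zr; apply: ler_pM; rewrite ?g0//.
  - by apply: sumr_ge0 => Z _; exact: hnormr_ge0.
  - by rewrite -aN; exact: growth_le2.
  - apply: hv; apply: fsubset_trans V0V; apply: fsubset_trans (fsubsetUr _ _).
    by apply: bigfcup_sup => //; rewrite in_fset_set// inE.
rewrite big_fset_condE big_const_seq count_predT iter_addr addr0 -[leLHS]mulr_natl.
apply: ler_wpM2r; first by apply: mulr_ge0; [rewrite mulr_ge0|exact: ltW].
apply: hc => // z.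
by rewrite !inE /= -ltNge => /andP[].
Qed.

Lemma heisenberg_exists t A : 0 <= t -> local_on X A ->
  exists T : @operator R L q, is_heisenberg H t A T.
Proof.
move=> t0 [a0 ->]; set A' := amplify a0.
have ival k : 0 <= k.+1%:R^-1 :> R by rewrite invr_ge0.
have cauchy k : exists V0 : {fset L}, forall V V', (V0 `<=` V)%fset -> (V0 `<=` V')%fset ->
    bounded_by (opsub (heisenberg_fin H V t A') (heisenberg_fin H V' t A')) k.+1%:R^-1.
  have e0 : 0 < k.+1%:R^-1 / 2 :> R by rewrite divr_gt0// invr_gt0.
  have [V0 [XV0 hV0]] := heisenberg_cauchy a0 t0 e0; exists V0.
  have key V W : (V0 `<=` V)%fset -> (V `<=` W)%fset ->
      bounded_by (opsub (heisenberg_fin H W t A') (heisenberg_fin H V t A')) (k.+1%:R^-1 / 2).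
    move=> V0V VW; have XW : (X `<=` W)%fset by exact: fsubset_trans XV0 (fsubset_trans V0V VW).
    rewrite /A' -(amplify_mx_of _ XW) !heisenberg_fin_amplify// -amplifyB.
    by apply/mxnorm_le; [exact: ltW|exact: hV0].
  move=> V V' V0V V0V'; rewrite [k.+1%:R^-1]splitr.
  apply: (@bounded_by_opsub_trans _ _ _ _ (heisenberg_fin H (V `|` V')%fset t A'));
    rewrite ?(ltW e0)//.
    by apply: bounded_by_opsubC; [exact: ltW|apply: key => //; exact: fsubsetUl].
  by apply: key => //; exact: fsubsetUr.
have [V hV] := boolp.choice cauchy.
have [k l|T hT] := @opnorm_complete R L q (fun k => heisenberg_fin H (V k) t A').
  apply: (@bounded_by_opsub_trans _ _ _ _ (heisenberg_fin H (V k `|` V l)%fset t A')) => //.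
    by apply: hV => //; exact: fsubsetUl.
  by apply: hV => //; exact: fsubsetUr.
(* [5 = 1 + 4]: one unit from the Cauchy estimate, four from [opnorm_complete]. *)
exists T => e e0; pose k := Num.truncn (5 / e); exists (V k) => W VW.
have ke : k.+1%:R^-1 + 4 * k.+1%:R^-1 <= e.
  have -> : k.+1%:R^-1 + 4 * k.+1%:R^-1 = 5 / k.+1%:R :> R by ring.
  rewrite ler_pdivrMr ?ltr0n// mulrC -ler_pdivrMr//.
  by apply: ltW; exact: truncnS_gt.
apply/opnorm_le; first exact: ltW.
apply: (bounded_byW (M := k.+1%:R^-1 + 4 * k.+1%:R^-1)).
  by rewrite ke andbT addr_ge0// mulr_ge0.
by apply: bounded_by_opsub_trans (hT k); rewrite ?mulr_ge0//; exact: hV.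
Qed.

Lemma lr_function_ge0 n sigma v K r t : 0 < v -> 0 < K -> 0 <= t -> sigma < 1 ->
  0 <= lr_function d n alpha sigma v K r t.
Proof.
move=> v0 K0 t0 s1; apply: addr_ge0; first by rewrite !mulr_ge0 ?expR_ge0.
apply: mulr_ge0; first exact: ltW.
by rewrite divr_ge0 ?powR_ge0// addr_ge0 ?powR_ge0// mulr_ge0// ltW.
Qed.

Lemma setdist_le (Y : set L) x y : x \in X -> Y y -> setdist pos [set` X] Y <= dist pos x y.
Proof.
move=> xX Yy; apply: ge_inf; last by exists x => //; exists y.
by exists 0 => _ [? _ [? _ <-]]; exact: dist_ge0.
Qed.

(** [T] is approximated by a finite-volume evolution [TV] and [B] by a local [U]; the bound on their
    commutator is uniform in the volume, so [e] can tend to [0]. *)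
Lemma infinite_volume_lieb_robinson sigma : sigma_range d alpha sigma ->
  exists v K : R, [/\ 0 < v, 0 < K &
    lieb_robinson H pos X (lr_function d #|` X|%fset alpha sigma v K)].
Proof.
move=> sP; have [x0 _] := fset0Pn _ X0.
have [f fP] := fset_dist_min pos X0.
have [C0 C00 [HC0 _]] := total_coupling_bound x0 Htot.
have HJ := tail_coupling_bound Htail.
have [w [K [w0 K0 hlr]]] :=
  finite_volume_lieb_robinson d1 sep H_herm fP J0 C00 HC0 HJ alphad sP.
exists w, K; split => // t Y A B T t0 [y0 Yy0] dXY [a0 ->] HB HT.
set r := setdist pos [set` X] Y in dXY *.
set c := lr_function _ _ _ _ _ _ r t.
have c0 : 0 <= c by case/andP: sP => _ s1; exact: lr_function_ge0.
set A' := amplify a0; set na := mxnorm a0.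
have na0 : 0 <= na by exact: mxnorm_ge0.
have HA : bounded_by A' na by exact: mxnorm_bounded.
have Bfin : opnorm B \is a fin_num.
  have [Z [U [_ [u ->] hU]]] := HB 1 ltr01.
  apply: (@opnorm_fin _ _ _ _ (1 + mxnorm u)); first by rewrite addr_ge0 ?mxnorm_ge0.
  have hBu : bounded_by (opsub B (amplify u)) 1 by apply/opnorm_le.
  exact: (bounded_by_close ler01 (mxnorm_ge0 u) hBu (mxnorm_bounded u)).
set nb := fine (opnorm B).
have nb0 : 0 <= nb by rewrite fine_ge0 ?opnorm_ge0.
have Bb : bounded_by B nb by exact: bounded_by_opnorm.
rewrite -(mxnormE a0) -/na -(fineK Bfin) -/nb -!EFinM.
(* Sum of all error terms below per unit of [e], with [e * e] replaced by [e]. *)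
pose k := na * c + nb + na + na + 1 + nb + 1.
have k0 : 0 < k by rewrite ltr_wpDl// !addr_ge0// mulr_ge0.
apply/lee_addgt0Pr => e' e'0.
pose e := Num.min 1 (e' / k).
have e0 : 0 < e by rewrite lt_min ltr01 divr_gt0.
have e1 : e <= 1 by rewrite ge_min lexx.
have ek : e * k <= e' by rewrite -ler_pdivlMr// ge_min lexx orbT.
have [Z [U [ZY [u0 Uu] hU]]] := HB e e0.
have [V0 hV0] := HT e e0.
(* [Z] may be empty; adding [y0] keeps the support nonempty and inside [Y]. *)
pose Y' := (y0 |` Z)%fset.
pose V := (V0 `|` X)%fset; pose W := (V `|` Y')%fset.
have VW : (V `<=` W)%fset by exact: fsubsetUl.
have XW : (X `<=` W)%fset by apply: fsubset_trans VW; exact: fsubsetUr.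
have Y'W : (Y' `<=` W)%fset by exact: fsubsetUr.
have ZY' : (Z `<=` Y')%fset by exact: fsubsetUr.
have ZW : (Z `<=` W)%fset by exact: fsubset_trans Y'W.
pose a := mx_of W A'; pose u := mx_of W U.
have aE : amplify a = A' by exact: amplify_mx_of.
have uE : amplify u = U by rewrite /u Uu amplify_mx_of.
have Xa : loc X a by exact: loc_mx_of.
have Yu : loc Y' u by rewrite /loc uE; apply: local_onW ZY' _; exists u0.
have HN := @mxnorm_operator_norm R L q W.
set tv := tau (hvol H W V) t a.
pose TV := heisenberg_fin H V t A'.
have TVE : TV = amplify tv by rewrite /TV -aE heisenberg_fin_amplify.
have dT : bounded_by (opsub TV T) e.
  by apply/opnorm_le; [exact: ltW|apply: hV0; exact: fsubsetUl].
have dT' : bounded_by (opsub T TV) e by apply: bounded_by_opsubC => //; exact: ltW.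
have dB : bounded_by (opsub B U) e by apply/opnorm_le => //; exact: ltW.
have dB' : bounded_by (opsub U B) e by apply: bounded_by_opsubC => //; exact: ltW.
have nTV : bounded_by TV na.
  rewrite TVE; apply/mxnorm_le => //; rewrite /tv (opn_tau HN).
  by rewrite /a mxnorm_mx_of.
have e00 : 0 <= e by exact: ltW.
have nT : bounded_by T (e + na) by exact: (bounded_by_close e00 na0 dT' nTV).
have nU : bounded_by U (e + nb) by exact: (bounded_by_close e00 nb0 dB' Bb).
have nu : mxnorm u <= e + nb by apply/mxnorm_le; [exact: addr_ge0|rewrite uE].
have Y'0 : Y' != fset0 by apply/fset0Pn; exists y0; rewrite !inE eqxx.
have rY' y : y \in Y' -> r <= f y.
  move=> yY'; have [[x xX ->] _] := fP y; apply: setdist_le => //.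
  by move: yY'; rewrite !inE => /predU1P[->//|yZ]; exact: ZY.
have main : bounded_by (opsub (TV \o U) (U \o TV)) (na * (e + nb) * c).
  rewrite TVE -uE -!amplifyM -amplifyB -commE.
  apply/mxnorm_le; first by rewrite !mulr_ge0// addr_ge0.
  rewrite commC (opnN HN); apply: le_trans (hlr V W a u Y' t r VW t0 dXY Y'0 Xa Yu rY') _.
  by rewrite ler_wpM2r// /a mxnorm_mx_of// ler_wpM2l.
(* [[T, B] = [TV, U] + (T - TV) B + TV (B - U) - (B - U) T - U (T - TV)], arranged so that only [TV]
   and [U], which are linear, stand to the left of a difference. *)
have p1 := bounded_by_comp dT' Bb.
have p2 := bounded_by_comp nTV dB.
have p3 := bounded_by_comp dB nT.
have p4 := bounded_by_comp nU dT'.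
have n1 : 0 <= na * (e + nb) * c by rewrite !mulr_ge0// addr_ge0.
have n2 : 0 <= e * nb by rewrite mulr_ge0.
have n3 : 0 <= na * e by rewrite mulr_ge0.
have n4 : 0 <= e * (e + na) by rewrite mulr_ge0// addr_ge0.
have n5 : 0 <= (e + nb) * e by rewrite mulr_ge0// addr_ge0.
have P := bounded_by_add (addr_ge0 n1 n2) n3 (bounded_by_add n1 n2 main p1) p2.
have Q := bounded_by_add n4 n5 p3 p4.
have := bounded_by_opsub (addr_ge0 (addr_ge0 n1 n2) n3) (addr_ge0 n4 n5) P Q.
set big := opsub _ _; have -> : big = commutator T B.
  have l1 : TV \o opsub B U = opsub (TV \o B) (TV \o U) by rewrite TVE amplify_opsub.
  have l2 : U \o opsub T TV = opsub (U \o T) (U \o TV) by rewrite -uE amplify_opsub.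
  apply/funext => psi; apply/funext => s; rewrite /big l1 l2 /commutator /opsub /=.
  move: (T (B psi) s) (B (T psi) s) (TV (U psi) s) (U (TV psi) s) (TV (B psi) s) (U (T psi) s).
  by move=> *; ring.
move=> /(bounded_byW (M' := na * nb * c + e')) h; apply/opnorm_le.
  by rewrite addr_ge0 ?mulr_ge0// ltW.
apply: h; rewrite !addr_ge0//=.
have ee : e * e <= e by rewrite ler_piMr.
apply: (@le_trans _ _ (na * nb * c + e * k)); last by rewrite lerD2l.
rewrite -subr_ge0; have -> : na * nb * c + e * k -
    (na * (e + nb) * c + e * nb + na * e + (e * (e + na) + (e + nb) * e)) =
    2 * (e - e * e) by rewrite /k; ring.
by rewrite mulr_ge0// subr_ge0.
Qed.

End InfiniteVolume.

(** * The light cone LC2 *)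

Section PowerIntegrals.
Context {R : realType}.
Local Notation mu := (@lebesgue_measure R).

Lemma powRN_le (s e t : R) : 0 < s -> 0 < e -> e^-1 `^ s^-1 <= t -> t `^ (- s) <= e.
Proof.
move=> s0 e0 h; rewrite powRN -[leRHS]invrK lef_pV2 ?posrE ?invr_gt0//; last first.
  by rewrite powR_gt0//; apply: lt_le_trans h; rewrite powR_gt0// invr_gt0.
have -> : e^-1 = (e^-1 `^ s^-1) `^ s.
  by rewrite -powRrM mulVf ?gt_eqF// powRr1// invr_ge0 ltW.
apply: ge0_ler_powR => //; rewrite ?nnegrE ?powR_ge0 ?(ltW s0)//.
by apply: le_trans h; exact: powR_ge0.
Qed.

Lemma cvg_powRN (s : R) : 0 < s -> t `^ (- s) @[t --> +oo] --> (0 : R).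
Proof.
move=> s0; apply/cvgr0Pnorm_le => e e0; near=> t.
rewrite ger0_norm ?powR_ge0//; apply: powRN_le => //.
Unshelve. all: by end_near. Qed.

Lemma cvg_powRN_at (s b : R) : 0 < b -> (fun x : R => x `^ s) @ b --> b `^ s.
Proof.
move=> b0; suff : {for b, continuous (fun x : R => x `^ s)} by [].
apply/differentiable_continuous/derivable1_diffP/derivable_powR.
by rewrite in_itv /= b0.
Qed.

Lemma integral_powR_tail (s b : R) : 0 < s -> 0 < b ->
  (\int[mu]_(r in `]b, +oo[) (r `^ (- s - 1))%:E <= (b `^ (- s) / s)%:E)%E.
Proof.
move=> s0 b0; rewrite integral_itv_obnd_cbnd; last first.
  by apply: measurable_funTS; apply/measurable_EFinP; exact: measurable_powR.
rewrite (@ge0_continuous_FTC2y _ _ (fun x => - s^-1 * x `^ (- s)) _ 0).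
- by rewrite sub0e -EFinN lee_fin mulNr opprK mulrC.
- by move=> x _; exact: powR_ge0.
- apply/continuous_within_itvcyP; split.
    by move=> x; rewrite in_itv /= andbT => bx; apply: cvg_powRN_at; exact: lt_trans bx.
  by apply: cvg_at_right_filter; exact: cvg_powRN_at.
- rewrite -[X in _ --> X](mulr0 (- s^-1)); apply: cvgMr; exact: cvg_powRN.
- move=> x bx; apply: derivableM; first exact: derivable_cst.
  by apply: derivable_powR; rewrite in_itv /= andbT; exact: lt_trans bx.
- apply: cvgMr; apply: cvg_at_right_filter; exact: cvg_powRN_at.
- move=> x; rewrite in_itv /= andbT => bx.
  have x0 : 0 < x by exact: lt_trans bx.
  have := is_derive1_powR (- s) x0 => dx.
  rewrite derive1E.
  have -> : (fun x : R => - s^-1 * x `^ (- s)) = (- s^-1) \*: (fun x : R => x `^ (- s)) by [].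
  rewrite deriveZ ?derive_val.
    by rewrite /GRing.scale /=; move: (x `^ _) => y; field; rewrite gt_eqF.
  by apply: derivable_powR; rewrite in_itv /= andbT.
Qed.

End PowerIntegrals.

Section LightConeExponent.
Context {R : realType} (d n : nat) (alpha sigma v K : R).
Local Notation mu := (@lebesgue_measure R).
Hypothesis d1 : (1 <= d)%N.
Hypothesis n1 : (1 <= n)%N.
Hypothesis alphad : d%:R < alpha.
Hypothesis sP : sigma_range d alpha sigma.
Hypothesis v0 : 0 < v.
Hypothesis K0 : 0 < K.
Let p := 1 - sigma.
Let A := sigma * alpha.
Let Q := 1 + d%:R / p.
Local Notation lr := (lr_function d n alpha sigma v K).
Definition lc2_integrand (t r : R) : R := r ^+ d.-1 * lr r t.

Let p0 : 0 < p. Proof. exact: subr_sigma_gt0 sP. Qed.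
Let dA : d%:R < A. Proof. exact: (sigma_alpha_gt_dim alphad sP). Qed.
Let Q1 : 1 <= Q. Proof. by rewrite lerDl divr_ge0// ltW. Qed.

Lemma lc2_integrandE t r : lc2_integrand t r =
  r ^+ d.-1 * (2 * n%:R * expR (v * t - r `^ p)) +
  K * (v * t + (v * t) `^ Q) * (r ^+ d.-1 * r `^ (- A)).
Proof. by rewrite /lc2_integrand /lr_function -/p -/A -/Q powRN; ring. Qed.

Lemma lc2_integrand_ge0 t r : 0 <= t -> 0 <= r -> 0 <= lc2_integrand t r.
Proof.
move=> t0 r0; rewrite mulr_ge0 ?exprn_ge0//; case/andP: sP => _ s1.
exact: lr_function_ge0.
Qed.

Lemma measurable_lc2_integrand t D : measurable_fun D (fun r => (lc2_integrand t r)%:E).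
Proof.
apply/measurable_EFinP; apply: (eq_measurable_fun (fun r : R =>
    r ^+ d.-1 * (2 * n%:R * expR (v * t - r `^ p)) +
    K * (v * t + (v * t) `^ Q) * (r ^+ d.-1 * r `^ (- A)))) => [r _|].
  by rewrite lc2_integrandE.
apply: measurable_funTS; apply: measurable_funD.
  apply: measurable_funM; first exact: exprn_measurable.
  apply: measurable_funM; first exact: measurable_cst.
  apply: measurableT_comp; first exact: measurable_expR.
  apply: measurable_funB; first exact: measurable_cst.
  exact: measurable_powR.
apply: measurable_funM; first exact: measurable_cst.
apply: measurable_funM; first exact: exprn_measurable.
exact: measurable_powR.
Qed.

Lemma exprn_powR (r a : R) : 0 < r -> r ^+ d.-1 * r `^ a = r `^ (d%:R + a - 1).
Proof.
move=> r0; rewrite -powR_mulrn ?(ltW r0)// -powRD ?(gt_eqF r0) ?implybT//.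
by congr (_ `^ _); rewrite -[in RHS](prednK d1) -natr1; ring.
Qed.

(* Both terms of the integrand are dominated by powers of [r] beyond [t^gamma];
   for the first one this uses [gamma * p > 1]. *)
Lemma is_LC2_above gamma : 0 < gamma -> p^-1 < gamma -> (1 + Q) / (A - d%:R) < gamma ->
  is_LC2 d lr (fun t => t `^ gamma).
Proof.
move=> g0 gp gQ.
have Ad : 0 < A - d%:R by rewrite subr_gt0.
have gp1 : 0 < gamma * p - 1 by rewrite subr_gt0 -ltr_pdivrMr// div1r.
(* With this decay the first term contributes [t * t ^ (- gamma s) = 1 / t]. *)
pose s := 2 / gamma; have s0 : 0 < s by rewrite divr_gt0.
have [E E0 hE] := expR_powR_le (d%:R + s) p0.
pose eta := gamma * (A - d%:R) - (1 + Q).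
have eta0 : 0 < eta by rewrite subr_gt0 -ltr_pdivrMr.
pose c1 := 2 * n%:R * E; have c10 : 0 <= c1 by rewrite !mulr_ge0// ltW.
pose c2 := K * (v + v `^ Q).
have c20 : 0 <= c2 by rewrite mulr_ge0 ?addr_ge0 ?powR_ge0// ltW.
(* From this time on, [v * t <= r ^ p / 2] for all [r] beyond [t ^ gamma]. *)
pose t0 := (2 * v) `^ (gamma * p - 1)^-1.
have bound t : 1 <= t -> t0 <= t ->
    (t%:E * \int[mu]_(r in `](t `^ gamma)%R, +oo[) (lc2_integrand t r)%:E <=
     (c1 / s * t `^ (- 1) + c2 / (A - d%:R) * t `^ (- eta))%:E)%E.
  move=> t1 tt0.
  have tpos : 0 < t by exact: lt_le_trans t1.
  set b := t `^ gamma; have b0 : 0 < b by exact: powR_gt0.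
  have b1 : 1 <= b by rewrite /b -(powRr0 t); apply: ler_powR => //; exact: ltW.
  have vt r : b <= r -> v * t <= r `^ p / 2.
    move=> br; rewrite ler_pdivlMr//; apply: (@le_trans _ _ (b `^ p)); last first.
      by apply: ge0_ler_powR; rewrite ?nnegrE ?(ltW p0) ?(ltW b0)// (le_trans (ltW b0)).
    have -> : b `^ p = t * t `^ (gamma * p - 1).
      by rewrite /b -powRrM mulr_powRB1 ?(ltW tpos)// mulr_gt0.
    rewrite mulrAC mulrC ler_wpM2l ?(ltW tpos)// mulrC.
    have -> : 2 * v = t0 `^ (gamma * p - 1).
      by rewrite /t0 -powRrM mulVf ?gt_eqF// powRr1// mulr_ge0// ltW.
    by apply: ge0_ler_powR; rewrite ?nnegrE ?powR_ge0 ?(ltW gp1) ?(ltW tpos).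
  have Cle : v * t + (v * t) `^ Q <= (v + v `^ Q) * t `^ Q.
    rewrite powRM ?(ltW v0) ?(ltW tpos)// mulrDl lerD2r ler_wpM2l ?(ltW v0)//.
    exact: le1r_powR.
  have pw r : b < r -> (lc2_integrand t r <=
      c1 * r `^ (- s - 1) + c2 * t `^ Q * r `^ (- (A - d%:R) - 1)).
    move=> br; have r0 : 0 < r by exact: lt_trans br.
    have r1 : 1 <= r by exact: le_trans b1 (ltW br).
    rewrite lc2_integrandE; apply: lerD.
      have -> : c1 * r `^ (- s - 1) =
          r ^+ d.-1 * (2 * n%:R * (E * r `^ (- (d%:R + s)))).
        rewrite /c1 -[in LHS](_ : d%:R + - (d%:R + s) - 1 = - s - 1); last by ring.
        by rewrite -exprn_powR//; ring.
      rewrite ler_wpM2l ?exprn_ge0 ?(ltW r0)// ler_wpM2l ?mulr_ge0//.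
      apply: le_trans (hE _ r0 r1); rewrite ler_expR.
      by have := vt r (ltW br); lra.
    rewrite exprn_powR// (_ : d%:R + - A - 1 = - (A - d%:R) - 1); last by ring.
    by rewrite ler_wpM2r ?powR_ge0// /c2 -mulrA ler_wpM2l// ltW.
  have m1 s' : measurable_fun `]b, +oo[ (fun r : R => (r `^ s')%:E).
    by apply: measurable_funTS; apply/measurable_EFinP; exact: measurable_powR.
  have nn s' r : (0 <= (r `^ s' : R)%:E)%E by rewrite lee_fin powR_ge0.
  have ct0 : 0 <= c2 * t `^ Q by rewrite mulr_ge0 ?powR_ge0.
  have int_le : (\int[mu]_(r in `]b, +oo[) (lc2_integrand t r)%:E <=
      (c1 * (b `^ (- s) / s) + c2 * t `^ Q * (b `^ (- (A - d%:R)) / (A - d%:R)))%:E)%E.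
    apply: (@le_trans _ _ (\int[mu]_(r in `]b, +oo[)
        (c1%:E * (r `^ (- s - 1))%:E + (c2 * t `^ Q)%:E * (r `^ (- (A - d%:R) - 1))%:E))%E).
      apply: ge0_le_integral => //.
      - move=> r /=; rewrite in_itv /= andbT => br; rewrite lee_fin.
        by apply: lc2_integrand_ge0; [exact: ltW|exact/ltW/(lt_trans b0)].
      - exact: measurable_lc2_integrand.
      - by apply: emeasurable_funD; (apply: emeasurable_funM; [exact: measurable_cst|exact: m1]).
      - by move=> r /=; rewrite in_itv /= andbT => br; rewrite -!EFinM -EFinD lee_fin pw.
    rewrite ge0_integralD//.
    - rewrite !ge0_integralZl_EFin; try exact: m1; try by []; try by move=> r _; exact: nn.
      rewrite EFinD !(EFinM _ (_ / _)).
      by apply: leeD; (apply: lee_wpmul2l; [by rewrite lee_fin|exact: integral_powR_tail]).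
    - by move=> r _; rewrite mule_ge0.
    - by apply: emeasurable_funM; [exact: measurable_cst|exact: m1].
    - by move=> r _; rewrite mule_ge0.
    - by apply: emeasurable_funM; [exact: measurable_cst|exact: m1].
  apply: (@le_trans _ _ (t%:E * (c1 * (b `^ (- s) / s) +
      c2 * t `^ Q * (b `^ (- (A - d%:R)) / (A - d%:R)))%:E)%E).
    by rewrite lee_wpmul2l// lee_fin ltW.
  rewrite -EFinM lee_fin.
  have e1 : t * b `^ (- s) = t `^ (- 1).
    rewrite /b -powRrM /s mulrN mulrCA divff ?gt_eqF// mulr1.
    rewrite -[X in X * _]powRr1 ?(ltW tpos)// -powRD ?(gt_eqF tpos) ?implybT//.
    by congr (_ `^ _); ring.
  have e2 : t * t `^ Q * b `^ (- (A - d%:R)) = t `^ (- eta).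
    rewrite /b -powRrM -[X in X * _ * _]powRr1 ?(ltW tpos)//.
    rewrite -!powRD ?(gt_eqF tpos) ?implybT//.
    by congr (_ `^ _); rewrite /eta; ring.
  rewrite -e1 -e2 le_eqVlt; apply/orP; left; apply/eqP; field.
  by rewrite !gt_eqF.
rewrite /is_LC2.
apply: (@squeeze_cvge _ _ _ _ (fun=> 0%E) _ (fun t =>
   (c1 / s * t `^ (- 1) + c2 / (A - d%:R) * t `^ (- eta))%:E)).
- near=> t; apply/andP; split.
    apply: mule_ge0; first by rewrite lee_fin; near: t; exact: nbhs_pinfty_ge.
    apply: integral_ge0 => r /=; rewrite in_itv /= andbT => br; rewrite lee_fin.
    apply: lc2_integrand_ge0; first by near: t; exact: nbhs_pinfty_ge.
    by apply/ltW; apply: le_lt_trans br; exact: powR_ge0.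
  apply: bound; first by near: t; apply: nbhs_pinfty_ge; exact: num_real.
  by near: t; apply: nbhs_pinfty_ge; exact: num_real.
- exact: cvg_cst.
- apply: cvg_EFin; first by near=> t.
  rewrite -[X in _ --> X](_ : c1 / s * 0 + c2 / (A - d%:R) * 0 = 0); last first.
    by rewrite !mulr0 addr0.
  by apply: cvgD; apply: cvgMr; exact: cvg_powRN.
Unshelve. all: by end_near. Qed.

(** The tail integral dominates a rectangle at its left end; the two necessary conditions below
    choose the height [m] and the width [l]. *)
Lemma is_LC2_lower_bound gamma c : is_LC2 d lr (fun t => t `^ gamma) -> 0 < c ->
  exists t1, forall t m l, t1 <= t -> 0 < t -> 0 <= m -> 0 <= l ->
    (forall r, t `^ gamma < r <= t `^ gamma + l -> m <= lc2_integrand t r) ->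
    t * (m * l) < c.
Proof.
move=> hL c0.
have : \forall t \near +oo, (t%:E * \int[mu]_(r in `](t `^ gamma)%R, +oo[)
    (lc2_integrand t r)%:E < c%:E)%E.
  have := hL `]-oo, c%:E[%classic; apply.
  by apply: open_nbhs_nbhs; split; [exact: open_ereal_lt_ereal|rewrite /= in_itv /= lte_fin].
move=> [t1 [_ ht]]; exists (t1 + 1) => t m l tt1 t0 m0 l0 hm.
have {}ht : (t%:E * \int[mu]_(r in `](t `^ gamma)%R, +oo[) (lc2_integrand t r)%:E < c%:E)%E.
  by apply: ht; apply: lt_le_trans tt1; rewrite ltrDl.
rewrite -lte_fin; apply: le_lt_trans ht.
rewrite EFinM; apply: lee_wpmul2l; first by rewrite lee_fin ltW.
set b := t `^ gamma.
have b0 : 0 <= b by exact: powR_ge0.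
have sub : (\int[mu]_(r in `]b, (b + l)%R]) (lc2_integrand t r)%:E <=
    \int[mu]_(r in `]b, +oo[) (lc2_integrand t r)%:E)%E.
  apply: ge0_subset_integral => //.
  - exact: measurable_lc2_integrand.
  - move=> r /=; rewrite in_itv /= andbT => br; rewrite lee_fin.
    by apply: lc2_integrand_ge0; [exact: ltW|exact: le_trans (ltW br)].
  - by move=> r /=; rewrite !in_itv /= => /andP[-> _].
apply: le_trans sub.
have low : (\int[mu]_(r in `]b, (b + l)%R]) cst m%:E r <=
    \int[mu]_(r in `]b, (b + l)%R]) (lc2_integrand t r)%:E)%E.
  apply: ge0_le_integral => //.
  exact: measurable_lc2_integrand.
apply: le_trans low; rewrite integral_cst//.
have := @lebesgue_measure_itv R `]b, (b + l)%R].
rewrite /= lte_fin => ->.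
have [_|] := ltP; first by rewrite -EFinD addrAC subrr add0r EFinM.
by rewrite gerDl => l0'; rewrite (@le_anti _ _ l 0) ?l0 ?l0'// mulr0 mule0.
Qed.

(** If [gamma * p < 1], then [r ^ p <= v * t] just beyond [t ^ gamma] at large [t]: the exponential
    is at least [1] there, and a rectangle of height [2] and width [1] contradicts the limit. *)
Lemma is_LC2_exp_le gamma : 0 < gamma -> is_LC2 d lr (fun t => t `^ gamma) ->
  p^-1 <= gamma.
Proof.
move=> g0 hL; rewrite leNgt; apply/negP => gp.
have gp1 : 0 < 1 - gamma * p by rewrite subr_gt0 -ltr_pdivlMr// div1r.
have [t1 ht1] := is_LC2_lower_bound hL ltr01.
(* Ensures [(2 * t ^ gamma) ^ p <= v * t], where [2 * t ^ gamma] bounds [t ^ gamma + 1]. *)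
pose t0 := (2 `^ p / v) `^ (1 - gamma * p)^-1.
pose t := Num.max 1 (Num.max t1 t0).
have [t_1 t_t1 t_t0] : [/\ 1 <= t, t1 <= t & t0 <= t].
  by rewrite /t !le_max !lexx !orbT.
have tpos : 0 < t by exact: lt_le_trans t_1.
suff h : forall r, t `^ gamma < r <= t `^ gamma + 1 -> 2 <= lc2_integrand t r.
  by have := ht1 t 2 1 t_t1 tpos (ler0n _ _) ler01 h; lra.
set b := t `^ gamma => r /andP[br rb].
have b1 : 1 <= b by rewrite /b -(powRr0 t); apply: ler_powR => //; exact: ltW.
have r1 : 1 <= r by exact: le_trans b1 (ltW br).
have r0 : 0 < r by exact: lt_le_trans r1.
have rp : r `^ p <= v * t.
  apply: (@le_trans _ _ ((2 * b) `^ p)).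
    by apply: ge0_ler_powR; rewrite ?nnegrE ?(ltW p0) ?(ltW r0)//; lra.
  rewrite powRM ?ler0n ?powR_ge0// /b -powRrM.
  have h : 2 `^ p <= v * t `^ (1 - gamma * p).
    rewrite mulrC -ler_pdivrMr//.
    have -> : 2 `^ p / v = t0 `^ (1 - gamma * p).
      by rewrite /t0 -powRrM mulVf ?gt_eqF// powRr1// divr_ge0 ?powR_ge0// ltW.
    by apply: ge0_ler_powR; rewrite ?nnegrE ?powR_ge0 ?(ltW gp1) ?(ltW tpos).
  apply: (@le_trans _ _ (v * t `^ (1 - gamma * p) * t `^ (gamma * p))).
    by rewrite ler_wpM2r ?powR_ge0.
  rewrite -mulrA -powRD ?(gt_eqF tpos) ?implybT//.
  by rewrite subrK powRr1 ?(ltW tpos).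
rewrite lc2_integrandE -[leLHS]addr0; apply: lerD; last first.
  apply: mulr_ge0; first by rewrite mulr_ge0 ?addr_ge0 ?powR_ge0 ?mulr_ge0 ?(ltW K0) ?(ltW v0) ?(ltW tpos).
  by rewrite mulr_ge0 ?exprn_ge0 ?powR_ge0 ?(ltW r0).
have n1' : 1 <= n%:R :> R by rewrite ler1n.
have e1 : 1 <= expR (v * t - r `^ p) by rewrite -[leLHS]expR0 ler_expR subr_ge0.
have d1' : 1 <= r ^+ d.-1 by exact: exprn_ege1.
apply: (@le_trans _ _ (1 * (2 * 1 * 1))); first by lra.
by rewrite !ler_pM ?mulr_ge0.
Qed.

(** Between [t ^ gamma] and its double the power term alone contributes a constant times
    [t ^ (1 + Q - gamma * (A - d))], which does not vanish if the exponent is nonnegative. *)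
Lemma is_LC2_pow_le gamma : 0 < gamma -> is_LC2 d lr (fun t => t `^ gamma) ->
  (1 + Q) / (A - d%:R) <= gamma.
Proof.
move=> g0 hL; rewrite leNgt; apply/negP => gQ.
have Ad : 0 < A - d%:R by rewrite subr_gt0.
have eta0 : 0 <= 1 + Q - gamma * (A - d%:R) by rewrite subr_ge0 ltW// -ltr_pdivlMr.
(* The constant in front of that power of [t]; [2 ^ (- A)] comes from [r <= 2 * b]. *)
pose c := K * v `^ Q * 2 `^ (- A).
have c0 : 0 < c by rewrite !mulr_gt0 ?powR_gt0.
have [t1 ht1] := is_LC2_lower_bound hL c0.
pose t := Num.max 1 t1.
have [t_1 t_t1] : 1 <= t /\ t1 <= t by rewrite /t !le_max !lexx orbT.
have tpos : 0 < t by exact: lt_le_trans t_1.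
pose b := t `^ gamma; have b0 : 0 < b by exact: powR_gt0.
pose m := K * (v * t) `^ Q * (b ^+ d.-1 * (2 * b) `^ (- A)).
have m0 : 0 <= m by rewrite !mulr_ge0 ?powR_ge0 ?exprn_ge0 ?(ltW K0) ?(ltW b0).
suff h : forall r, b < r <= b + b -> m <= lc2_integrand t r.
  have := ht1 t m b t_t1 tpos m0 (ltW b0) h; apply/negP; rewrite -leNgt.
  have -> : t * (m * b) = c * t `^ (1 + Q - gamma * (A - d%:R)).
    rewrite /m !powRM ?(ltW v0) ?(ltW tpos) ?(ltW b0)//.
    have e : b ^+ d.-1 * b `^ (- A) * b = t `^ (- (gamma * (A - d%:R))).
      rewrite exprn_powR// -[X in _ * X]powRr1 ?(ltW b0)// -powRD ?(gt_eqF b0) ?implybT//.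
      by rewrite /b -powRrM; congr (_ `^ _); ring.
    have e2 : t * t `^ Q * t `^ (- (gamma * (A - d%:R))) = t `^ (1 + Q - gamma * (A - d%:R)).
      by rewrite -[X in X * _ * _]powRr1 ?(ltW tpos)// -!powRD ?(gt_eqF tpos) ?implybT.
    by rewrite -e2 -e /c; ring.
  rewrite ler_peMr ?(ltW c0)// -[leLHS](powRr0 t).
  exact: ler_powR.
move=> r /andP[br rb].
have r0 : 0 < r by exact: lt_trans br.
rewrite lc2_integrandE -[leLHS]add0r; apply: lerD.
  by rewrite !mulr_ge0 ?exprn_ge0 ?expR_ge0 ?(ltW r0).
have vt : 0 < v * t by rewrite mulr_gt0.
rewrite /m; apply: ler_pM.
- by rewrite mulr_ge0 ?powR_ge0 ?(ltW K0).
- by rewrite mulr_ge0 ?exprn_ge0 ?powR_ge0 ?(ltW b0).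
- by rewrite ler_wpM2l ?(ltW K0)// lerDr ltW.
apply: ler_pM; rewrite ?exprn_ge0 ?powR_ge0 ?(ltW b0)//.
  by rewrite lerXn2r ?nnegrE ?(ltW b0) ?(ltW r0)// ltW.
rewrite !powRN lef_pV2 ?posrE ?powR_gt0 ?mulr_gt0//.
have A0 : 0 <= A by apply: le_trans (ltW dA); rewrite ler0n.
have rb2 : r <= 2 * b by lra.
by apply: ge0_ler_powR => //; rewrite nnegrE ?mulr_ge0 ?ltW.
Qed.

Lemma beta_LC2_ofE :
  beta_LC2_of d lr = (Num.max p^-1 ((1 + Q) / (A - d%:R)))%:E.
Proof.
set M := Num.max _ _.
have M0 : 0 < M by rewrite lt_max invr_gt0 p0.
apply/eqP; rewrite eq_le; apply/andP; split; last first.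
  apply: le_ereal_inf_tmp => _ [gamma [g0 hL] <-].
  by rewrite lee_fin ge_max is_LC2_exp_le// is_LC2_pow_le.
apply/lee_addgt0Pr => e e0; apply: ereal_inf_lbound; exists (M + e) => //.
have Me : M < M + e by rewrite ltrDl.
split; first by rewrite addr_gt0.
by apply: is_LC2_above; rewrite ?addr_gt0//; apply: le_lt_trans Me;
  rewrite le_max lexx ?orbT.
Qed.

End LightConeExponent.

(** * The optimal exponent *)

Section Optimisation.
Context {R : realType} (d : nat) (alpha : R).
Hypothesis d1 : (1 <= d)%N.
Hypothesis alphad : d%:R < alpha.

(* The exponent attained at sigma = 1 - u. *)
Definition LC2_exponent (u : R) : R :=
  Num.max u^-1 ((2 + d%:R / u) / (alpha - d%:R - alpha * u)).

Let d_gt0 : 0 < d%:R :> R. Proof. by rewrite ltr0n. Qed.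
Let alpha_gt0 : 0 < alpha. Proof. exact: lt_trans alphad. Qed.
Let D_gt0 : 0 < alpha - d%:R. Proof. by rewrite subr_gt0. Qed.

Lemma sigma_rangeE (u : R) : sigma_range d alpha (1 - u) <->
  0 < u < (alpha - d%:R) / (alpha + 1).
Proof.
have a1 : 0 < alpha + 1 by rewrite addr_gt0.
rewrite /sigma_range /= ltr_pdivrMr// ltr_pdivlMr//.
by split=> /andP[h1 h2]; apply/andP; split; lra.
Qed.

Lemma LC2_den_gt0 (u : R) : 0 < u < (alpha - d%:R) / (alpha + 1) ->
  0 < alpha - d%:R - alpha * u.
Proof.
have a1 : 0 < alpha + 1 by rewrite addr_gt0.
by rewrite ltr_pdivlMr// => /andP[u0]; lra.
Qed.

(** [alpha_M] is the larger root of the quadratic; the other root is nonpositive, so its factor is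
    positive at [alpha]. *)
Lemma lt_alpha_M :
  (alpha < alpha_M d) = (alpha ^+ 2 - 3 * d%:R * alpha - 2 * d%:R < 0).
Proof.
rewrite /alpha_M; set y := Num.sqrt _.
have y0 : 0 <= y by exact: sqrtr_ge0.
have y2 : y ^+ 2 = 1 + 8 / (9 * d%:R).
  by rewrite sqr_sqrtr// addr_ge0// divr_ge0// mulr_ge0.
have -> : alpha ^+ 2 - 3 * d%:R * alpha - 2 * d%:R =
    (alpha - 3 * d%:R / 2 * (1 + y)) * (alpha - 3 * d%:R / 2 * (1 - y)).
  have -> : (alpha - 3 * d%:R / 2 * (1 + y)) * (alpha - 3 * d%:R / 2 * (1 - y)) =
    alpha ^+ 2 - 3 * d%:R * alpha + (3 * d%:R / 2) ^+ 2 * (1 - y ^+ 2) by field.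
  by rewrite y2; field; rewrite gt_eqF.
have y1 : 1 <= y.
  by rewrite /y -[leLHS]sqrtr1 ler_wsqrtr// lerDl divr_ge0// mulr_ge0.
rewrite pmulr_llt0 ?subr_lt0//.
apply: lt_le_trans alpha_gt0 _; rewrite lerBrDl gerDr.
by rewrite mulr_ge0_le0 ?subr_le0// divr_ge0 ?mulr_ge0.
Qed.

Lemma LC2_exponentE (u : R) : 0 < u ->
  (2 + d%:R / u) / (alpha - d%:R - alpha * u) =
  (2 * u + d%:R) / (u * (alpha - d%:R - alpha * u)).
Proof.
by move=> u0; rewrite invfM mulrA; congr (_ / _); field; rewrite gt_eqF.
Qed.

(** [G] is the minimum of the second function of [u]: numerator minus [G] times denominator is a
    multiple of the square [(u - u0) ^ 2]. *)
Lemma optimum_below : alpha ^+ 2 - 3 * d%:R * alpha - 2 * d%:R < 0 ->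
  let G := 2 / (alpha - d%:R) ^+ 2 * (alpha - d%:R +
       d%:R * alpha * (1 + Num.sqrt (1 + 2 / d%:R - 2 / alpha))) in
  (exists2 u, 0 < u < (alpha - d%:R) / (alpha + 1) & LC2_exponent u = G) /\
  forall u, 0 < u < (alpha - d%:R) / (alpha + 1) -> G <= LC2_exponent u.
Proof.
move=> hM; set s := Num.sqrt _ => G.
have x0 : 0 <= 2 / d%:R - 2 / alpha.
  rewrite subr_ge0 ler_wpM2l// lef_pV2 ?posrE//; exact: ltW.
have s2 : s ^+ 2 = 1 + 2 / d%:R - 2 / alpha by rewrite sqr_sqrtr; lra.
have s1 : 1 <= s by rewrite /s -[leLHS]sqrtr1 ler_wsqrtr//; lra.
have sE : alpha * d%:R * (s ^+ 2 - 1) = 2 * (alpha - d%:R).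
  by rewrite s2; field; rewrite !gt_eqF.
have s_1 : 0 < s + 1 by lra.
have GE : G = d%:R * alpha * (s + 1) ^+ 2 / (alpha - d%:R) ^+ 2.
  have e : alpha - d%:R + d%:R * alpha * (1 + s) = d%:R * alpha * (s + 1) ^+ 2 / 2.
    by move: sE; rewrite !expr2; lra.
  by rewrite /G e; field; rewrite gt_eqF.
pose u0 := (alpha - d%:R) / (alpha * (s + 1)).
have u0_gt0 : 0 < u0 by rewrite divr_gt0// mulr_gt0.
have u0_lt : u0 < (alpha - d%:R) / (alpha + 1).
  rewrite ltr_pM2l// ltf_pV2 ?posrE ?addr_gt0 ?mulr_gt0//.
  have a1 : 1 < alpha by apply: le_lt_trans alphad; rewrite ler1n.
  by rewrite mulrDr mulr1; have := @ler_wpM2l _ _ (ltW alpha_gt0) _ _ s1; lra.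
have key u : 0 < u < (alpha - d%:R) / (alpha + 1) ->
    (2 * u + d%:R) - G * (u * (alpha - d%:R - alpha * u)) = G * alpha * (u - u0) ^+ 2.
  move=> hu; have Gu : G * alpha * u0 ^+ 2 = d%:R.
    by rewrite GE /u0; field; rewrite !gt_eqF.
  have Gu' : G * (alpha - d%:R - 2 * alpha * u0) = 2.
    have -> : G * (alpha - d%:R - 2 * alpha * u0) =
        alpha * d%:R * (s ^+ 2 - 1) / (alpha - d%:R).
      by rewrite GE /u0; field; rewrite !gt_eqF.
    by rewrite sE mulfK// gt_eqF.
  have -> : G * alpha * (u - u0) ^+ 2 = G * alpha * u ^+ 2 +
      (G * (alpha - d%:R - 2 * alpha * u0) - G * (alpha - d%:R)) * u + G * alpha * u0 ^+ 2.
    by ring.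
  by rewrite Gu Gu'; ring.
have u0P : 0 < u0 < (alpha - d%:R) / (alpha + 1) by rewrite u0_gt0.
split; last first.
  move=> u uP; have /andP[ugt0 _] := uP.
  rewrite /LC2_exponent le_max; apply/orP; right.
  rewrite LC2_exponentE// ler_pdivlMr ?mulr_gt0 ?LC2_den_gt0//.
  rewrite -subr_ge0 key// mulr_ge0 ?sqr_ge0// GE.
  by rewrite mulr_ge0 ?divr_ge0 ?mulr_ge0 ?sqr_ge0 ?ltW.
exists u0 => //; rewrite /LC2_exponent.
have -> : (2 + d%:R / u0) / (alpha - d%:R - alpha * u0) = G.
  have D0 := LC2_den_gt0 u0P.
  have := key _ u0P; rewrite subrr expr0n mulr0 => /eqP.
  by rewrite subr_eq0 LC2_exponentE// => /eqP ->; rewrite mulfK// gt_eqF// mulr_gt0.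
(* After cancellation [u0^-1 <= G] reads [alpha - 2 d <= d s]; squared, it is the sign condition
   [hM] multiplied by [alpha - d]. *)
apply/max_idPr; rewrite GE /u0 invf_div ler_pdivlMr ?exprn_gt0//.
have -> : alpha * (s + 1) / (alpha - d%:R) * (alpha - d%:R) ^+ 2 =
    (alpha * (s + 1)) * (alpha - d%:R) by field; rewrite gt_eqF.
have -> : d%:R * alpha * (s + 1) ^+ 2 = alpha * (s + 1) * (d%:R * (s + 1)) by ring.
rewrite ler_wpM2l ?mulr_ge0 ?(ltW alpha_gt0) ?(ltW s_1)//.
have [h|h] := lerP (alpha - 2 * d%:R) 0.
  by have := @ler_wpM2l _ _ (ltW d_gt0) _ _ s1; move: h d_gt0; lra.
suff : alpha - 2 * d%:R <= d%:R * s by lra.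
rewrite -(@ler_pXn2r _ 2) ?nnegrE ?mulr_ge0 ?(ltW h)//; last by lra.
rewrite -(@ler_pM2l _ alpha)//.
have -> : alpha * (d%:R * s) ^+ 2 = d%:R * (2 * (alpha - d%:R) + alpha * d%:R).
  by rewrite -sE; ring.
rewrite -subr_ge0.
have -> : d%:R * (2 * (alpha - d%:R) + alpha * d%:R) - alpha * (alpha - 2 * d%:R) ^+ 2 =
  (alpha - d%:R) * (- (alpha ^+ 2 - 3 * d%:R * alpha - 2 * d%:R)) by ring.
by rewrite mulr_ge0 ?(ltW D_gt0)// oppr_ge0 ltW.
Qed.

(** Left of the crossing point [u0] the function [u^-1] is at least its value there; right of it the
    second function is. *)
Lemma optimum_above : 0 <= alpha ^+ 2 - 3 * d%:R * alpha - 2 * d%:R ->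
  let G := (alpha + 2) / (alpha - 2 * d%:R) in
  (exists2 u, 0 < u < (alpha - d%:R) / (alpha + 1) & LC2_exponent u = G) /\
  forall u, 0 < u < (alpha - d%:R) / (alpha + 1) -> G <= LC2_exponent u.
Proof.
move=> hM /=.
have a3 : 3 * d%:R < alpha.
  rewrite ltNge; apply/negP => h.
  have := @ler_wpM2l _ _ (ltW alpha_gt0) _ _ h.
  by move: hM d_gt0; rewrite expr2; lra.
have a2 : 0 < alpha - 2 * d%:R by move: a3 d_gt0; lra.
have a2' : 0 < alpha + 2 by rewrite addr_gt0.
pose u0 := (alpha - 2 * d%:R) / (alpha + 2).
have u0_gt0 : 0 < u0 by rewrite divr_gt0.
have u0E : u0 * (alpha + 2) = alpha - 2 * d%:R by rewrite divfK ?gt_eqF.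
have GE : (alpha + 2) / (alpha - 2 * d%:R) = u0^-1 by rewrite invf_div.
have u0P : 0 < u0 < (alpha - d%:R) / (alpha + 1).
  rewrite u0_gt0/= ltr_pdivrMr// mulrAC ltr_pdivlMr ?addr_gt0//.
  have : 0 < d%:R * alpha by rewrite mulr_gt0.
  by move: alpha_gt0; lra.
(* This is [hM] after clearing denominators. The comparison to the right of [u0] factors through
   [(u - u0) * (u - d / alpha)], so here [alpha_M] enters. *)
have du0 : d%:R / alpha <= u0.
  rewrite ler_pdivrMr// mulrAC ler_pdivlMr//; move: hM; rewrite expr2; lra.
rewrite GE; split.
  exists u0 => //; rewrite /LC2_exponent LC2_exponentE//.
  have -> : 2 * u0 + d%:R = alpha - d%:R - alpha * u0 by lra.
  rewrite (_ : _ / (u0 * _) = u0^-1) ?maxxx//.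
  by have := LC2_den_gt0 u0P; move: (_ - alpha * u0) => D D0; field; rewrite !gt_eqF.
move=> u uP; have /andP[ugt0 _] := uP; rewrite /LC2_exponent le_max.
have [uu|uu] := lerP u u0; first by rewrite lef_pV2 ?posrE// uu.
apply/orP; right; rewrite LC2_exponentE// ler_pdivlMr ?mulr_gt0 ?LC2_den_gt0//.
rewrite mulrC ler_pdivrMr// -subr_ge0.
have -> : (2 * u + d%:R) * u0 - u * (alpha - d%:R - alpha * u) =
   alpha * (u - u0) * (u - d%:R / alpha) + u * (u0 * (alpha + 2) - (alpha - 2 * d%:R)).
  by field; rewrite gt_eqF.
rewrite u0E subrr mulr0 addr0 mulr_ge0 ?subr_ge0 ?mulr_ge0 ?(ltW alpha_gt0) ?subr_ge0 ?ltW//.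
exact: le_lt_trans uu.
Qed.

Lemma LC2_exponent_optimum :
  (exists2 sigma, sigma_range d alpha sigma & LC2_exponent (1 - sigma) = beta_formula d alpha) /\
  forall sigma, sigma_range d alpha sigma -> beta_formula d alpha <= LC2_exponent (1 - sigma).
Proof.
have [[u uP uE] h] : let G := beta_formula d alpha in
  (exists2 u, 0 < u < (alpha - d%:R) / (alpha + 1) & LC2_exponent u = G) /\
  forall u, 0 < u < (alpha - d%:R) / (alpha + 1) -> G <= LC2_exponent u.
  rewrite /beta_formula lt_alpha_M; case: ltP => hM.
    exact: optimum_below.
  exact: optimum_above.
split; first by exists (1 - u); [exact/sigma_rangeE|rewrite opprB addrC subrK].
by move=> sigma sP; apply: h; apply/sigma_rangeE; rewrite opprB addrC subrK.
Qed.

(** The exponents do not depend on the positive constants [v sigma] and [K sigma], and the infimum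
    over [sigma] is attained. *)
Lemma beta_LC2E (n : nat) (v K : R -> R) : (1 <= n)%N ->
  (forall sigma, sigma_range d alpha sigma -> 0 < v sigma /\ 0 < K sigma) ->
  beta_LC2 d alpha (fun sigma => lr_function d n alpha sigma (v sigma) (K sigma)) =
  (beta_formula d alpha)%:E.
Proof.
move=> n1 vK.
have E sigma : sigma_range d alpha sigma ->
    beta_LC2_of d (lr_function d n alpha sigma (v sigma) (K sigma)) =
    (LC2_exponent (1 - sigma))%:E.
  move=> sP; have [v0 K0] := vK _ sP; rewrite beta_LC2_ofE// /LC2_exponent.
  by congr (Num.max _ (_ / _))%:E; ring.
have [[sigma sP sE] h] := LC2_exponent_optimum.
apply/eqP; rewrite eq_le; apply/andP; split.
  by apply: ereal_inf_lbound; exists sigma => //; rewrite E// sE.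
by apply: le_ereal_inf_tmp => _ [sigma' sP' <-]; rewrite E// lee_fin h.
Qed.

End Optimisation.

Local Close Scope complex_scope.

(** The first clause provides the limit [T] that [lieb_robinson] takes as given, so the second is
    not vacuous; the third covers every admissible choice of constants. *)
Theorem mainTheorem2 (R : realType) (d : nat) (L : choiceType)
    (pos : L -> 'rV[R]_d) (q : L -> nat) (H : interaction R q)
    (J alpha : R) (X : {fset L}) :
  (1 <= d)%N ->
  (forall x y : L, x != y -> 1 <= dist pos x y) ->
  (forall Z : {fset L}, H Z \is hermsymmx) ->
  0 < J ->
  d%:R < alpha ->
  (forall r : R, 0 < r ->
     (tail_coupling H pos r <= (J * r `^ (- alpha))%:E)%E) ->
  (total_coupling H < +oo)%E ->
  X != fset0 ->
  let C (v K sigma : R) := lr_function d #|` X|%fset alpha sigma v K in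
  [/\ forall (t : R) (A : operator q), 0 <= t -> local_on X A ->
        exists T : operator q, is_heisenberg H t A T,
      forall sigma : R, sigma_range d alpha sigma ->
        exists v K : R,
          [/\ 0 < v, 0 < K & lieb_robinson H pos X (C v K sigma)]
    & forall v K : R -> R,
        (forall sigma : R, sigma_range d alpha sigma ->
           [/\ 0 < v sigma, 0 < K sigma &
               lieb_robinson H pos X (C (v sigma) (K sigma) sigma)]) ->
        let beta := beta_LC2 d alpha (fun sigma => C (v sigma) (K sigma) sigma) in
        beta \is a fin_num /\ beta = (beta_formula d alpha)%:E].
Proof.
move=> d1 sep H_herm J0 alphad Htail Htot X0 C; split.
- by move=> t A t0 XA; exact: (heisenberg_exists d1 sep H_herm J0 alphad Htail Htot X0 t0 XA).
- by move=> sigma sP; exact: (infinite_volume_lieb_robinson d1 sep H_herm J0 alphad Htail Htot X0 sP).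
move=> v K vK beta; suff -> : beta = (beta_formula d alpha)%:E by [].
apply: beta_LC2E => // [|sigma /vK[]//].
by rewrite cardfs_gt0.
Qed.
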